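(* Let $y:M\to Q^n_r$ be a timelike $(\pm)$-isothermic surface, with adapted coordinate $(u,v)$, canonical lift $Y$ and conformal Hopf differentials $\kappa_1=\pm\kappa_2$. (i) Let $c\neq 0$ and let $\psi$ be any $c$-polar transform of $y$. If $\langle\psi,\kappa_1\rangle\neq 0$ on an open dense subset $M_0$ of $M$, then $\psi:M_0\to P_c$ is also a timelike $(\pm)$-isothermic surface (with the same sign as $y$), and $\psi$ shares the same adapted coordinate $(u,v)$ with $y$. Moreover, $\psi$ is a generalized $H$-surface admitting a parallel minimal section. To be concrete, there exists a local lift $Y^{\psi}$ of $y$ (i.e. $[Y^{\psi}]=y$) with $Y^{\psi}_u\parallel\psi_v$ and $Y^{\psi}_v\parallel\psi_u$, that is, $Y^\psi$ is dual to $\psi$. (ii) Let $\psi$ be a $c$-polar transform of $y$. The conformal invariant metric of $\psi$ (where $\langle\psi,\kappa_1\rangle\ne0$) is of the form $$g^{\psi}=\left(\langle \kappa_1,\kappa_2\rangle+\left(\frac{\langle\psi,D_u \kappa_1\rangle}{\langle\psi,\kappa_1\rangle}\right)_v\right)du\,dv .$$ Furthermore, suppose that $M$ is a closed surface. If $\psi$ is globally immersed, then $W(\psi)=W(y)$, i.e. in this case the Willmore functional is invariant under the polar transform.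
   Context: $\mathbb{R}^m_s$ is $\mathbb{R}^m$ with $\langle x,x\rangle=\sum_{i=1}^{m-s}x_i^2-\sum_{i=m-s+1}^m x_i^2$. Let $n-r\ge 2$, $r\ge 1$. $Q^n_r$ is the set of points $[x]\in\mathbb{R}P^{n+1}$ with $x\in\mathbb{R}^{n+2}_{r+1}\setminus\{0\}$, $\langle x,x\rangle=0$, with the conformal structure of signature $(n-r,r)$ induced by $\langle\,,\rangle$. Surfaces in a projective light cone. $M$ is an oriented surface. A lift of $y:M\to Q^n_r$ is a local map $Y$ into nonzero null vectors with $[Y]=y$. $y$ is timelike if $\langle dY,dY\rangle$ is a Lorentzian metric. Asymptotic coordinates $(u,v)$ are local coordinates with $\langle Y_u,Y_u\rangle=\langle Y_v,Y_v\rangle=0$; the canonical lift satisfies $\langle Y_u,Y_v\rangle=\frac12$. (If $\langle Y_u,Y_v\rangle<0$ for given null coordinates, one passes to $(u,-v)$; coordinates $(u,v)$ and $(u,-v)$ are not distinguished when speaking of a surface ''having'' an adapted coordinate.) Put $V=\mathrm{Span}\{Y,Y_u,Y_v,Y_{uv}\}$, let $V^\perp$ be its orthogonal complement in $\mathbb{R}^{n+2}_{r+1}$ (conformal normal bundle), and $D$ the normal connection on $V^\perp$ (orthogonal projection of the derivative). The conformal Hopf differentials $\kappa_1,\kappa_2\in\Gamma(V^\perp)$ and Schwarzians $s_1,s_2$ are defined by $Y_{uu}=-\frac{s_1}{2}Y+\kappa_1$, $Y_{vv}=-\frac{s_2}{2}Y+\kappa_2$. $y$ is timelike $(\pm)$-isothermic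 if around each point there are asymptotic coordinates with $\kappa_1=\pm\kappa_2$ (adapted coordinates). The same definitions apply to surfaces in the projective light cone of any nondegenerate indefinite inner product space. The conformal invariant metric is $g=\langle\kappa_1,\kappa_2\rangle\,du\,dv$ (independent of the choice of asymptotic coordinates, including the passage from $(u,v)$ to $(u,-v)$), and the Willmore functional is $W=\frac12\int_M G\,du\wedge dv$ where $g=G\,du\,dv$. $c$-polar transforms. A $c$-polar transform of $y$ is a section $\psi\in\Gamma(V^\perp)$ with $D_u\psi=D_v\psi=0$ and $\langle\psi,\psi\rangle=c$ constant; for $c\ne0$ it is regarded as a map $\psi:M\to P_c:=\{x\in\mathbb{R}^{n+2}_{r+1}:\langle x,x\rangle=c\}$ (a pseudo-Riemannian space form of curvature $1/c$ and dimension $n+1$), and for $c=0$ as the map $[\psi]:M\to Q^n_r$. Surfaces in $P_c$, $c\neq0$. A timelike surface $x:M\to P_c$ (Lorentzian induced metric) with null coordinates $(u,v)$ has vector-valued Hopf differentials $\Omega_1,\Omega_2$, the components of $x_{uu}$, $x_{vv}$ tangent to $P_c$ and normal to the surface; $x$ is $(\pm)$-isothermic if locally there are null coordinates with $\Omega_1=\pm\Omega_2$ (adapted coordinates). Its conformal invariants are those of the surface $[(x,1)]$ in the projective light cone of $\mathbb{R}^{n+2}_{r+1}\oplus\mathbb{R}$ with quadratic form $\langle x,x\rangle-ct^2$; in particular $g=\frac{\langle\Omega_1,\Omega_2\rangle}{2\langle x_u,x_v\rangle}du\,dv$. Let $H$ be the mean curvature vector of $x$ in $P_c$. An isoperimetric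 section is a unit normal vector field $N$ of $x$ with $\langle N,H\rangle$ constant; it is called a minimal section if $\langle N,H\rangle\equiv0$. $x$ is a generalized $H$-surface if there exists an isoperimetric section of $x$ which is parallel in the normal bundle.
   Formalization: ''Unit normal'' in isoperimetric/minimal sections also admits lightlike sections: Y^ψ is null, and for the circular timelike cylinder in R^3_1 no unit parallel minimal section exists. Sections are local, on adapted coordinate domains in M_0; W(ψ), W(y) use the same labelling of null coordinates. *)

(* Defs.v *)
From HB Require Import structures.
From mathcomp Require Import all_boot all_order all_algebra.
From mathcomp Require Import all_classical all_reals all_analysis.

Set Implicit Arguments.
Unset Strict Implicit.
Unset Printing Implicit Defensive.

Import Order.TTheory GRing.Theory Num.Theory.
Import numFieldNormedType.Exports.

Local Open Scope classical_set_scope.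
Local Open Scope ring_scope.

(** * Inner products

  An inner product on R^m is given by its Gram matrix [A].  A linear subspace
  is the row space of a matrix; the point [x] of projective space is the
  canonical matrix [<<x>>%MS], so that <<x>> = <<x'>> iff x and x' span the
  same line. *)

Definition dot (R : realType) m (A : 'M[R]_m) (x x' : 'rV[R]_m) : R :=
  form idfun A x x'.

(* R^m_s: the last s basis vectors are negative. *)
Definition pseudo_gram (R : realType) (m s : nat) : 'M[R]_m :=
  diag_mx (\row_(i < m) if (i < m - s)%N then 1 else - 1).

(* <x,x> - c t^2 on R^m (+) R *)
Definition ext_gram (R : realType) m (A : 'M[R]_m) (c : R) : 'M[R]_(m + 1) :=
  block_mx A 0 0 (- c)%:M.

Definition orth (R : realType) m (A U : 'M[R]_m) : 'M[R]_m := orthomx idfun A U.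

(* Orthogonal projection onto the complement of U, meaningful when A is
   nondegenerate on U. *)
Definition oproj (R : realType) m (A U : 'M[R]_m) (w : 'rV[R]_m) : 'rV[R]_m :=
  w *m proj_mx (orth A U) U.

Section Plane.
Context {R : realType} {V : normedModType R}.
Implicit Types (F : R * R -> V) (q : R * R) (O : set (R * R)).

Definition du F q : V := derive1 (fun t : R => F (t, q.2)) q.1.
Definition dv F q : V := derive1 (fun t : R => F (q.1, t)) q.2.

Fixpoint Ck_on (k : nat) O F : Prop :=
  (forall q, O q -> {for q, continuous F}) /\
  if k is k'.+1 then
    [/\ forall q, O q -> derivable (fun t : R => F (t, q.2)) q.1 1,
        forall q, O q -> derivable (fun t : R => F (q.1, t)) q.2 1,
        Ck_on k' O (du F) & Ck_on k' O (dv F)]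
  else True.

Definition smooth_on O F : Prop := forall k, Ck_on k O F.

End Plane.

(** * Oriented surfaces

  A chart is a coordinate map (u, v) on the set [chart_dom] together with its inverse
  [chart_param], which is only meaningful on the image of [chart_dom]. *)

Record chart (R : realType) (M : Type) := Chart {
  chart_dom : set M;
  chart_coord : M -> R * R;
  chart_param : R * R -> M
}.

Definition chart_img (R : realType) (M : Type) (k : chart R M) : set (R * R) :=
  chart_coord k @` chart_dom k.

Definition chart_restr (R : realType) (M : Type) (k : chart R M) (W : set M) :
  chart R M := Chart (chart_dom k `&` W) (chart_coord k) (chart_param k).

Section Charts.
Context {R : realType} {M : topologicalType}.
Implicit Types (k l : chart R M).

Definition is_chart k : Prop :=
  [/\ open (chart_dom k), open (chart_img k),
      forall p, chart_dom k p -> chart_param k (chart_coord k p) = p,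
      forall p, chart_dom k p -> {for p, continuous (chart_coord k)} &
      forall q, chart_img k q -> {for q, continuous (chart_param k)}].

Definition overlap k l : set (R * R) := chart_coord k @` (chart_dom k `&` chart_dom l).

Definition trans1 k l (q : R * R) : R := (chart_coord l (chart_param k q)).1.
Definition trans2 k l (q : R * R) : R := (chart_coord l (chart_param k q)).2.

Definition smooth_trans k l : Prop :=
  smooth_on (overlap k l) (trans1 k l) /\ smooth_on (overlap k l) (trans2 k l).

Definition jacobian k l (q : R * R) : R :=
  du (trans1 k l) q * dv (trans2 k l) q - dv (trans1 k l) q * du (trans2 k l) q.

Definition oriented_compat k l : Prop :=
  smooth_trans k l /\ forall q, overlap k l q -> 0 < jacobian k l q.

End Charts.

Record oriented_surface (R : realType) (M : topologicalType) := OrientedSurface {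
  atlas : set (chart R M);
  surface_hausdorff : hausdorff_space M;
  surface_countable : @second_countable M;
  atlas_chart : forall k, atlas k -> is_chart k;
  atlas_cover : forall p, exists2 k, atlas k & chart_dom k p;
  atlas_compat : forall k l, atlas k -> atlas l -> oriented_compat k l
}.

Section Surface.
Context {R : realType} {M : topologicalType} (S : oriented_surface R M).
Implicit Types (k : chart R M) (W : set M).

(* Local coordinates of either orientation. *)
Definition local_coords k : Prop :=
  is_chart k /\
  forall l, atlas S l -> smooth_trans k l /\ smooth_trans l k.

Definition positive_coords k : Prop :=
  local_coords k /\ forall l, atlas S l -> oriented_compat k l.

Definition smooth_fun (V : normedModType R) W (f : M -> V) : Prop :=
  forall k, atlas S k ->
    smooth_on (chart_coord k @` (chart_dom k `&` W)) (fun q => f (chart_param k q)).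

End Surface.

(* The first fundamental form of X has signature (1,1), i.e. its determinant is
   negative. *)
Definition lorentzian (R : realType) m (A : 'M[R]_m) (X : R * R -> 'rV[R]_m)
    (q : R * R) : Prop :=
  dot A (du X q) (du X q) * dot A (dv X q) (dv X q)
    - dot A (du X q) (dv X q) ^+ 2 < 0.

(* A lift Y in a chart, with its Schwarzians and conformal Hopf differentials. *)
Record frame (R : realType) m := Frame {
  frame_lift : R * R -> 'rV[R]_m;
  schw1 : R * R -> R;
  schw2 : R * R -> R;
  hopf1 : R * R -> 'rV[R]_m;
  hopf2 : R * R -> 'rV[R]_m
}.

Section LightCone.
Context {R : realType} {M : topologicalType} (S : oriented_surface R M).
Context {m : nat} (A : 'M[R]_m) (y : M -> 'M[R]_m).
Implicit Types (k : chart R M) (Y : R * R -> 'rV[R]_m) (q : R * R)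
  (F : frame R m) (e : bool).

Definition is_lift k Y : Prop :=
  smooth_on (chart_img k) Y /\
  forall q, chart_img k q ->
    [/\ Y q != 0, dot A (Y q) (Y q) = 0 & <<Y q>>%MS = y (chart_param k q)].

(* y is a smooth map into the projective light cone. *)
Definition cone_surface : Prop :=
  forall p, exists k Y, [/\ local_coords S k, chart_dom k p & is_lift k Y].

Definition timelike : Prop :=
  cone_surface /\
  forall k Y, local_coords S k -> is_lift k Y ->
    forall q, chart_img k q -> lorentzian A Y q.

(* Null coordinates, with the normalised lift.  If <Y_u,Y_v> = - 1/2 then
   (u, - v) are asymptotic coordinates and Y is their canonical lift. *)
Definition null_lift k Y : Prop :=
  is_lift k Y /\
  forall q, chart_img k q ->
    [/\ dot A (du Y q) (du Y q) = 0, dot A (dv Y q) (dv Y q) = 0 &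
        `|dot A (du Y q) (dv Y q)| = 2^-1].

(* k is asymptotic, with canonical lift Y. *)
Definition canonical_lift k Y : Prop :=
  null_lift k Y /\ forall q, chart_img k q -> dot A (du Y q) (dv Y q) = 2^-1.

(* V = Span {Y, Y_u, Y_v, Y_uv} *)
Definition conf_span Y q : 'M[R]_m :=
  (Y q + du Y q + dv Y q + dv (du Y) q)%MS.

Definition conf_normal Y q : 'M[R]_m := orth A (conf_span Y q).

(* The normal connection; xi is a section of the conformal normal bundle. *)
Definition Du Y (xi : R * R -> 'rV[R]_m) q : 'rV[R]_m :=
  oproj A (conf_span Y q) (du xi q).
Definition Dv Y (xi : R * R -> 'rV[R]_m) q : 'rV[R]_m :=
  oproj A (conf_span Y q) (dv xi q).

Definition hopf_schwarz k F : Prop :=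
  forall q, chart_img k q ->
    [/\ (hopf1 F q <= conf_normal (frame_lift F) q)%MS,
        (hopf2 F q <= conf_normal (frame_lift F) q)%MS,
        du (du (frame_lift F)) q = - (schw1 F q / 2) *: frame_lift F q + hopf1 F q &
        dv (dv (frame_lift F)) q = - (schw2 F q / 2) *: frame_lift F q + hopf2 F q].

(* The sign of (+-)-isothermic is (-1) ^+ e. *)
Definition adapted e k F : Prop :=
  [/\ local_coords S k, canonical_lift k (frame_lift F), hopf_schwarz k F &
      forall q, chart_img k q -> hopf1 F q = (-1) ^+ e *: hopf2 F q].

Definition isothermic e : Prop :=
  timelike /\ forall p, exists k F, adapted e k F /\ chart_dom k p.

(* The conformal invariant metric is G du dv in the null coordinates k.  The
   factor Num.sg accounts for the passage to (u, - v) when <Y_u,Y_v> < 0: Y and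
   both Hopf differentials are unchanged while du dv changes sign. *)
Definition conf_metric k (G : R * R -> R) : Prop :=
  exists F, [/\ null_lift k (frame_lift F), hopf_schwarz k F &
    forall q, chart_img k q ->
      G q = Num.sg (dot A (du (frame_lift F) q) (dv (frame_lift F) q))
            * dot A (hopf1 F q) (hopf2 F q)].

Definition polar_transform (c : R) (psi : M -> 'rV[R]_m) : Prop :=
  [/\ smooth_fun S setT psi,
      forall p, psi p != 0,
      forall p, dot A (psi p) (psi p) = c &
      forall k Y, local_coords S k -> canonical_lift k Y ->
        forall q, chart_img k q ->
          [/\ (psi (chart_param k q) <= conf_normal Y q)%MS,
              Du Y (fun q' => psi (chart_param k q')) q = 0 &
              Dv Y (fun q' => psi (chart_param k q')) q = 0]].

(** ** The Willmore functional

  The 2-form G du /\ dv is invariant under u' = u'(u), v' = v'(v) with signs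
  of any kind, in particular under (u, v) -> (u, - v), but changes sign when u
  and v are exchanged.  It is therefore determined by a consistent choice of
  which null direction is called u.  Such a choice is a family [N] of null
  coordinates, covering M and never exchanging u and v.  As <Y_u,Y_v> may have
  either sign, the coordinates can be taken positively oriented. *)

Definition null_atlas (N : set (chart R M)) : Prop :=
  [/\ forall k, N k -> positive_coords S k /\ exists G, conf_metric k G,
      forall p, exists2 k, N k & chart_dom k p &
      forall k l, N k -> N l -> forall q, overlap k l q ->
        dv (trans1 k l) q = 0 /\ du (trans2 k l) q = 0].

Definition partition_of_unity d (k : 'I_d -> chart R M) (rho : 'I_d -> M -> R) :
  Prop :=
  [/\ forall i, smooth_fun S setT (rho i),
      forall i p, 0 <= rho i p,
      forall i, closure [set p | rho i p != 0] `<=` chart_dom (k i) &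
      forall p, \sum_(i < d) rho i p = 1].

(* W = 1/2 \int_M G du /\ dv, for M compact. *)
Definition is_willmore (N : set (chart R M)) (w : R) : Prop :=
  exists d (k : 'I_d -> chart R M) (rho : 'I_d -> M -> R)
         (G : 'I_d -> R * R -> R),
    [/\ forall i, N (k i), partition_of_unity k rho,
        forall i, conf_metric (k i) (G i) &
        w = 2^-1 * \sum_(i < d)
              \int[(@lebesgue_measure R \x @lebesgue_measure R)%E]_(q in chart_img (k i))
                (rho i (chart_param (k i) q) * G i q)].

(* For M compact and N a null atlas, exactly one w satisfies is_willmore. *)
Definition willmore (N : set (chart R M)) : R := xget 0 (is_willmore N).

End LightCone.

(** * Timelike surfaces in P_c, c <> 0

  In coordinates, X : R * R -> R^m with <X,X> = c. *)

Section SpaceForm.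
Context {R : realType} {m : nat} (A : 'M[R]_m).
Implicit Types (X N : R * R -> 'rV[R]_m) (q : R * R) (O : set (R * R)).

(* The complement of Span {X, X_u, X_v} is the normal space of the surface
   inside T P_c, the latter being the complement of X. *)
Definition pc_span X q : 'M[R]_m := (X q + du X q + dv X q)%MS.

Definition pc_normal X q : 'M[R]_m := orth A (pc_span X q).

Definition Omega1 X q : 'rV[R]_m := oproj A (pc_span X q) (du (du X) q).
Definition Omega2 X q : 'rV[R]_m := oproj A (pc_span X q) (dv (dv X) q).
Definition Omega12 X q : 'rV[R]_m := oproj A (pc_span X q) (dv (du X) q).

(* Half the trace of the second fundamental form with respect to the metric
   a du^2 + 2 b du dv + d dv^2. *)
Definition mean_curvature X q : 'rV[R]_m :=
  let a := dot A (du X q) (du X q) in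
  let b := dot A (du X q) (dv X q) in
  let d := dot A (dv X q) (dv X q) in
  (2 * (a * d - b ^+ 2))^-1 *:
    (d *: Omega1 X q - (2 * b) *: Omega12 X q + a *: Omega2 X q).

(* A nowhere vanishing normal field with <N,N> constantly 1, -1 or 0.  Lightlike
   sections have to be admitted: the minimal sections of polar transforms are
   lightlike, and in general there is none with <N,N> = 1 or -1. *)
Definition unit_normal X O N : Prop :=
  [/\ smooth_on O N,
      forall q, O q -> (N q <= pc_normal X q)%MS,
      forall q, O q -> N q != 0 &
      exists2 a : R, a \in [:: 1; -1; 0] & forall q, O q -> dot A (N q) (N q) = a].

Definition isoperimetric_section X O N : Prop :=
  unit_normal X O N /\
  exists a : R, forall q, O q -> dot A (N q) (mean_curvature X q) = a.

Definition minimal_section X O N : Prop :=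
  unit_normal X O N /\
  forall q, O q -> dot A (N q) (mean_curvature X q) = 0.

Definition parallel_section X O N : Prop :=
  forall q, O q ->
    oproj A (pc_span X q) (du N q) = 0 /\ oproj A (pc_span X q) (dv N q) = 0.

Definition generalized_H_surface X O : Prop :=
  exists N, isoperimetric_section X O N /\ parallel_section X O N.

End SpaceForm.

Section SpaceFormSurface.
Context {R : realType} {M : topologicalType} (S : oriented_surface R M).
Context {m : nat} (A : 'M[R]_m).
Implicit Types (k : chart R M) (W : set M) (x : M -> 'rV[R]_m) (e : bool).

Definition pc_timelike (c : R) W x : Prop :=
  [/\ smooth_fun S W x,
      forall p, W p -> dot A (x p) (x p) = c &
      forall k, local_coords S k -> chart_dom k `<=` W ->
        forall q, chart_img k q -> lorentzian A (fun q' => x (chart_param k q')) q].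

Definition pc_adapted e k x : Prop :=
  local_coords S k /\
  forall q, chart_img k q ->
    let X := fun q' => x (chart_param k q') in
    [/\ dot A (du X q) (du X q) = 0, dot A (dv X q) (dv X q) = 0 &
        Omega1 A X q = (-1) ^+ e *: Omega2 A X q].

Definition pc_isothermic (c : R) e W x : Prop :=
  pc_timelike c W x /\
  forall p, W p -> exists k, [/\ pc_adapted e k x, chart_dom k `<=` W & chart_dom k p].

(* [conf_of A c x P] is P for the surface in a projective light cone associated
   with x: [(x,1)] in the light cone of <,> - c t^2 if x takes its values in P_c,
   c <> 0, and [x] itself if x is null. *)
Definition conf_of (c : R) x
    (P : forall m' : nat, 'M[R]_m' -> (M -> 'M[R]_m') -> Prop) : Prop :=
  if c == 0 then P m A (fun p => <<x p>>%MS)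
  else P (m + 1)%N (ext_gram A c) (fun p => <<row_mx (x p) (1%:M : 'M[R]_1)>>%MS).

(* x : M -> P_c (c <> 0), resp. [x] : M -> projective light cone (c = 0), is an
   immersion. *)
Definition immersed (c : R) x : Prop :=
  forall k, local_coords S k -> forall q, chart_img k q ->
    let X := fun q' => x (chart_param k q') in
    if c == 0 then \rank (X q + du X q + dv X q)%MS = 3%N
    else \rank (du X q + dv X q)%MS = 2%N.

End SpaceFormSurface.

(* Main.v *)
Require Import Defs.
From HB Require Import structures.
From mathcomp Require Import all_boot all_order all_algebra.
From mathcomp Require Import all_classical all_reals all_analysis.
From mathcomp Require Import ring lra.

Set Implicit Arguments.
Unset Strict Implicit.
Unset Printing Implicit Defensive.

Import Order.TTheory GRing.Theory Num.Theory.
Import numFieldNormedType.Exports.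

Local Open Scope classical_set_scope.
Local Open Scope ring_scope.

(** The proof rests on two formulas.  Let Y be a lift of y in null coordinates with
    <Y_u, Y_v> = s/2, where s = 1 or s = -1, and put f1 = <psi, Y_uu> and f2 = <psi, Y_vv>;
    these are the products of psi with the Hopf differentials.  As psi is a parallel normal
    section, psi_u and psi_v lie in the span of Y, Y_u, Y_v and Y_uv, and taking products
    with these vectors gives ([polar_du], [polar_dv])

      psi_u = 2 s ((f1)_v Y - f1 Y_v),    psi_v = 2 s ((f2)_u Y - f2 Y_u).

    So (u, v) are null coordinates of psi, with <psi_u, psi_v> = 2 s f1 f2.  In adapted
    coordinates f2 = f1 or f2 = - f1.  The derivatives of the lift Y / f1 are then parallel
    to psi_v and psi_u ([dual_lift_du]), which makes it a parallel lightlike normal field of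
    psi, and a minimal section because <Y, psi_uv> = 0.  Moreover psi_uu and psi_vv agree up
    to sign and a tangent vector ([adapted_duu_dvv]), hence psi is isothermic.

    The second formula computes the conformal invariant metric from an arbitrary lift X in
    null coordinates ([metric_of_lift], [conf_metric_exists], [conf_metric_unique]).  Applied
    to psi it yields ([polar_metric])

      g^psi = g + (1/2) (log |f1 f2|)_uv du dv,

    which in adapted coordinates is the asserted expression.

    For the Willmore functional the integral of the correction term has to vanish.  If psi is
    immersed then f1 and f2 have no zeros ([immersed_pairing]).  The function f1 f2 depends
    on the coordinates, but in adapted coordinates f1 / f2 is constant, so in other null
    coordinates it is, up to sign, a function of u times a function of v, and log |f1| and
    log |f2| have the same mixed derivative ([isothermic_log_uv]).  Therefore log |f1 f2| can be
    replaced by log |f1 f2^3| / 2.  A change of null coordinates that does not exchange u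
    and v multiplies f1 f2^3 by a function of v alone ([pairing_transition]), so the
    u-derivative of this logarithm is the coefficient of a globally defined 1-form p du
    ([potential_form]), and the two Willmore densities differ by its exterior derivative.

    It remains to prove Stokes' theorem for p du on a closed surface covered by null
    coordinates ([stokes]).  An integration by parts in each chart leaves integrals that are
    transported from one chart to another, where the derivatives of a partition of unity add
    up to zero.  The transition maps are locally of the form (alpha(u), beta(v)), and after
    cutting the integrands into pieces supported in small squares the change of variables
    follows from Fubini's theorem and the substitution rule in one variable
    ([null_substitution]). *)

(** * Differential calculus in the plane *)

Definition pd (R : realType) (V : normedModType R) (b : bool) (F : R * R -> V) :
  R * R -> V := if b then du F else dv F.

Arguments pd : simpl never.

Definition axis (R : realType) (b : bool) : R * R := if b then (1, 0) else (0, 1).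

Section PartialDerivatives.
Context {R : realType} {V : normedModType R}.
Implicit Types (F G : R * R -> V) (O : set (R * R)) (b : bool) (q : R * R).

Lemma du_derive F q : du F q = 'D_(axis R true) F q.
Proof.
rewrite /du derive1E /derive /axis.
suff -> : (fun h : R => h^-1 *: (F (h *: (1:R) + q.1, q.2) - F (q.1, q.2))) =
          (fun h : R => h^-1 *: (F (h *: ((1, 0) : R * R) + q) - F q)) by [].
apply/funext => h; case: q => a c /=.
congr (_ *: (F _ - _)).
by congr (_, _); rewrite /= /GRing.scale /= mulr0 add0r.
Qed.

Lemma dv_derive F q : dv F q = 'D_(axis R false) F q.
Proof.
rewrite /dv derive1E /derive /axis.
suff -> : (fun h : R => h^-1 *: (F (q.1, h *: (1:R) + q.2) - F (q.1, q.2))) =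
          (fun h : R => h^-1 *: (F (h *: ((0, 1) : R * R) + q) - F q)) by [].
apply/funext => h; case: q => a c /=.
congr (_ *: (F _ - _)).
by congr (_, _); rewrite /= /GRing.scale /= mulr0 add0r.
Qed.

Lemma pd_derive b F q : pd b F q = 'D_(axis R b) F q.
Proof. by case: b; [exact: du_derive | exact: dv_derive]. Qed.

Lemma derivable_slice1 F q :
  derivable (fun t => F (t, q.2)) q.1 1 <-> derivable F q (axis R true).
Proof.
rewrite /derivable /axis.
suff -> : (fun h : R => h^-1 *: (F (h *: (1:R) + q.1, q.2) - F (q.1, q.2))) =
          (fun h : R => h^-1 *: (F (h *: ((1, 0) : R * R) + q) - F q)) by [].
by apply/funext => h; case: q => a c /=; congr (_ *: (F (_, _) - _)) => /=; rewrite scaler0 add0r.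
Qed.

Lemma derivable_slice2 F q :
  derivable (fun t => F (q.1, t)) q.2 1 <-> derivable F q (axis R false).
Proof.
rewrite /derivable /axis.
suff -> : (fun h : R => h^-1 *: (F (q.1, h *: (1:R) + q.2) - F (q.1, q.2))) =
          (fun h : R => h^-1 *: (F (h *: ((0, 1) : R * R) + q) - F q)) by [].
by apply/funext => h; case: q => a c /=; congr (_ *: (F (_, _) - _)) => /=; rewrite scaler0 add0r.
Qed.

Lemma Ck_onS k O F : Ck_on k.+1 O F <->
  (forall q, O q -> {for q, continuous F}) /\
  forall b, (forall q, O q -> derivable F q (axis R b)) /\ Ck_on k O (pd b F).
Proof.
split=> [[cF [d1 d2 k1 k2]]|[cF H]].
  split => // -[]; split => // q Oq.
    exact/derivable_slice1/d1.
  exact/derivable_slice2/d2.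
split => //; have [d1 k1] := H true; have [d2 k2] := H false; split => // q Oq.
  exact/derivable_slice1/d1.
exact/derivable_slice2/d2.
Qed.

Lemma Ck_onW k O F : Ck_on k.+1 O F -> Ck_on k O F.
Proof.
elim: k F => [|k IH] F; first by case.
move=> /Ck_onS [cF H]; apply/Ck_onS; split => // b.
by have [dF kF] := H b; split => //; exact: IH.
Qed.

Lemma eq_nbhs_on O F G q : open O -> O q -> (forall q', O q' -> F q' = G q') ->
  \near q, F q = G q.
Proof.
move=> oO Oq FG; have : nbhs q O by exact: open_nbhs_nbhs.
by apply: filterS => q' /FG.
Qed.

Lemma near_eq_pd b F G q : (\near q, F q = G q) -> pd b F q = pd b G q.
Proof. by move=> FG; rewrite !pd_derive; apply: near_eq_derive. Qed.

Lemma eq_on_pd b O F G q : open O -> (forall q', O q' -> F q' = G q') -> O q ->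
  pd b F q = pd b G q.
Proof. by move=> oO FG Oq; apply: near_eq_pd; exact: (eq_nbhs_on oO Oq FG). Qed.

Lemma near_eq_continuous F G q : (\near q, F q = G q) ->
  {for q, continuous F} -> {for q, continuous G}.
Proof.
move=> FG; rewrite /prop_for /continuous_at -(nbhs_singleton FG) => cF.
by apply: cvg_trans cF; exact: near_eq_cvg.
Qed.

Lemma Ck_on_eq k O F G : open O -> (forall q, O q -> F q = G q) ->
  Ck_on k O F -> Ck_on k O G.
Proof.
move=> oO; elim: k F G => [|k IH] F G FG.
  move=> [cF _]; split => // q Oq.
  exact: near_eq_continuous (eq_nbhs_on oO Oq FG) (cF q Oq).
move=> /Ck_onS [cF H]; apply/Ck_onS; split.
  by move=> q Oq; exact: near_eq_continuous (eq_nbhs_on oO Oq FG) (cF q Oq).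
move=> b; have [dF kF] := H b; split.
  by move=> q Oq; exact: near_eq_derivable (eq_nbhs_on oO Oq FG) (dF q Oq).
by apply: IH kF => q Oq; exact: (eq_on_pd b oO FG Oq).
Qed.

Lemma Ck_on_local k O F :
  (forall q, O q -> exists2 O', O' q & Ck_on k O' F) -> Ck_on k O F.
Proof.
elim: k F => [|k IH] F H.
  by split => // q /H[P O'q [cF _]]; exact: (cF q O'q).
apply/Ck_onS; split.
  by move=> q /H[P O'q /Ck_onS[cF _]]; exact: cF.
move=> b; split.
  by move=> q /H[P O'q /Ck_onS[_ /(_ b)[dF _]]]; exact: dF.
by apply: IH => q /H[P O'q /Ck_onS[_ /(_ b)[_ kF]]]; exists P.
Qed.

Lemma Ck_on_sub k O O' F : O' `<=` O -> Ck_on k O F -> Ck_on k O' F.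
Proof.
move=> sub; elim: k F => [|k IH] F.
  by move=> [cF _]; split => // q /sub; exact: cF.
move=> /Ck_onS[cF H]; apply/Ck_onS; split; first by move=> q /sub; exact: cF.
by move=> b; have [dF kF] := H b; split; [move=> q /sub; exact: dF|exact: IH].
Qed.

Lemma Ck_on_cst k O (c : V) : Ck_on k O (fun=> c).
Proof.
elim: k c => [|k IH] c; first by split => // q _; exact: cst_continuous.
apply/Ck_onS; split; first by move=> q _; exact: cst_continuous.
move=> b; split; first by move=> q _; exact: derivable_cst.
suff -> : pd b (fun=> c) = (fun=> 0) :> (R * R -> V) by exact: IH.
by apply/funext => q; rewrite pd_derive derive_cst.
Qed.

Lemma Ck_onD k O F G : open O -> Ck_on k O F -> Ck_on k O G ->
  Ck_on k O (fun q => F q + G q).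
Proof.
move=> oO; elim: k F G => [|k IH] F G.
  by move=> [cF _] [cG _]; split=> // q Oq; apply: continuousD; [exact: cF|exact: cG].
move=> /Ck_onS[cF HF] /Ck_onS[cG HG]; apply/Ck_onS; split.
  by move=> q Oq; apply: continuousD; [exact: cF|exact: cG].
move=> b; have [dF kF] := HF b; have [dG kG] := HG b; split.
  by move=> q Oq; apply: derivableD; [exact: dF|exact: dG].
apply: Ck_on_eq (IH _ _ kF kG) => // q Oq; rewrite !pd_derive.
by rewrite -deriveD//; [exact: dF|exact: dG].
Qed.

End PartialDerivatives.

Opaque du dv.

Section ScalarCalculus.
Context {R : realType}.
Implicit Types (f g h : R * R -> R) (O : set (R * R)) (b : bool) (q : R * R).

Lemma Ck_onM k O f g : open O -> Ck_on k O f -> Ck_on k O g ->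
  Ck_on k O (fun q => f q * g q).
Proof.
move=> oO; elim: k f g => [|k IH] f g.
  by move=> [cF _] [cG _]; split=> // q Oq; apply: continuousM; [exact: cF|exact: cG].
move=> kf kg; have := kf; have := kg.
move=> /Ck_onS[cg Hg] /Ck_onS[cf Hf]; apply/Ck_onS; split.
  by move=> q Oq; apply: continuousM; [exact: cf|exact: cg].
move=> b; have [df kdf] := Hf b; have [dg kdg] := Hg b; split.
  by move=> q Oq; apply: derivableM; [exact: df|exact: dg].
have := Ck_onD oO (IH _ _ (Ck_onW kf) kdg) (IH _ _ (Ck_onW kg) kdf).
apply: Ck_on_eq => // q Oq; rewrite !pd_derive.
by rewrite -deriveM//; [exact: df|exact: dg].
Qed.

Lemma Ck_onV k O f : open O -> (forall q, O q -> f q != 0) -> Ck_on k O f ->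
  Ck_on k O (fun q => (f q)^-1).
Proof.
move=> oO f0; elim: k => [|k IH].
  by move=> [cf _]; split => // q Oq; apply: cvgV; [exact: f0|exact: cf].
move=> kf; have := kf; move=> /Ck_onS[cf Hf]; apply/Ck_onS; split.
  by move=> q Oq; apply: cvgV; [exact: f0|exact: cf].
move=> b; have [df kdf] := Hf b; split.
  by move=> q Oq; apply: derivableV; [exact: f0|exact: df].
have kV := IH (Ck_onW kf).
have := Ck_onM oO (Ck_onM oO (Ck_on_cst k O (-1 : R)) (Ck_onM oO kV kV)) kdf.
apply: Ck_on_eq => // q Oq; rewrite !pd_derive deriveV//; [|exact: f0|exact: df].
by rewrite /GRing.scale/= mulN1r expr2 invfM.
Qed.

Lemma is_derive_line (V W : normedModType R) (F : V -> W) (x v : V) (d : W) :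
  is_derive (0 : R) (1 : R) (fun t : R => F (t *: v + x)) d <-> is_derive x v F d.
Proof.
have E : (fun h : R => h^-1 *: (F ((h *: (1 : R) + 0) *: v + x) - F (0 *: v + x))) =
    (fun h : R => h^-1 *: (F (h *: v + x) - F x)).
  by apply/funext => h; rewrite addr0 scale0r add0r [_ *: 1]mulr1.
split=> [] [d1 d2]; split.
- exact/derivable1P.
- by rewrite -d2 /derive E.
- by move/derivable1P : d1.
- by rewrite -d2 /derive E.
Qed.

Lemma is_derive_comp1 (V : normedModType R) (f : V -> R) (g : R -> R) (x v : V) (a d : R) :
  is_derive (f x) 1 g a -> is_derive x v f d -> is_derive x v (g \o f) (a * d).
Proof.
move=> dg df; apply/is_derive_line; apply: is_derive1_comp.
  by rewrite scale0r add0r.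
exact/is_derive_line.
Qed.

Lemma Ck_on_sqrt k O f : open O -> (forall q, O q -> 0 < f q) -> Ck_on k O f ->
  Ck_on k O (fun q => Num.sqrt (f q)).
Proof.
move=> oO f0; elim: k => [|k IH].
  move=> [cf _]; split => // q Oq; apply: continuous_comp; first exact: cf.
  exact: sqrt_continuous.
move=> kf; have := kf; move=> /Ck_onS[cf Hf]; apply/Ck_onS; split.
  move=> q Oq; apply: continuous_comp; first exact: cf.
  exact: sqrt_continuous.
move=> b; have [df kdf] := Hf b.
have dS q (Oq : O q) : is_derive q (axis R b) (Num.sqrt \o f)
    ((2 * Num.sqrt (f q))^-1 * pd b f q).
  apply: is_derive_comp1; first by apply: is_derive1_sqrt; exact: f0.
  by rewrite pd_derive; apply: derivableP; exact: df.
split.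
  by move=> q Oq; have := dS q Oq => -[].
have kS := IH (Ck_onW kf).
have s0 q : O q -> 2 * Num.sqrt (f q) != 0.
  by move=> Oq; rewrite mulf_neq0// gt_eqF// sqrtr_gt0 f0.
have := Ck_onM oO (Ck_onV oO s0 (Ck_onM oO (Ck_on_cst k O (2 : R)) kS)) kdf.
apply: Ck_on_eq => // q Oq.
by rewrite [RHS]pd_derive; have /@derive_val <- := dS q Oq.
Qed.

Lemma mvt0 (g dg : R -> R) (t : R) :
  (forall s, s \in `[Num.min 0 t, Num.max 0 t] -> is_derive s 1 g (dg s)) ->
  exists2 c, c \in `[Num.min 0 t, Num.max 0 t] & g t - g 0 = dg c * t.
Proof.
move=> H.
have cg : {within `[Num.min 0 t, Num.max 0 t], continuous g}.
  by apply: derivable_within_continuous => s /H [].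
have dg' s : s \in `]Num.min 0 t, Num.max 0 t[ -> is_derive s 1 g (dg s).
  by move=> sI; apply: H; exact: subset_itv_oo_cc.
have le : Num.min 0 t <= Num.max 0 t by rewrite ge_min !le_max !lexx.
have [c cI E] := MVT_segment le dg' cg; exists c => //.
move: E; case: (leP 0 t) => _ E; first by rewrite E subr0.
by rewrite -opprB E sub0r mulrN opprK.
Qed.

Lemma ball_prodE (p q : R * R) (d : R) :
  ball q d p <-> `|q.1 - p.1| < d /\ `|q.2 - p.2| < d.
Proof. by []. Qed.

Lemma ball_segment (q p : R * R) (b : bool) (d s t : R) :
  ball q d p -> ball q d (t *: axis R b + p) ->
  s \in `[Num.min 0 t, Num.max 0 t] -> ball q d (s *: axis R b + p).
Proof.
have conv (a x : R) : `|a - x| < d -> `|a - (t + x)| < d ->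
    s \in `[Num.min 0 t, Num.max 0 t] -> `|a - (s + x)| < d.
  rewrite !ltr_norml in_itv/= ge_min le_max => /andP[a1 a2] /andP[a3 a4].
  move=> /andP[/orP[] s1 /orP[] s2]; apply/andP; split; lra.
move=> /ball_prodE[p1 p2] /ball_prodE[]; rewrite /axis; case: b => /= t1 t2 sI; apply/ball_prodE => /=.
all: rewrite /GRing.scale/= ?mulr1 ?mulr0 ?add0r; split => //; apply: conv => //.
all: by move: t1 t2; rewrite /GRing.scale/= ?mulr1 ?mulr0 ?add0r.
Qed.

(** The mean value theorem on a coordinate segment.  Balls of the sup norm contain the
    segment between two of their points that lie on a common coordinate line, and there
    the partial derivative stays close to its value at [q]. *)
Lemma slope_C1 O f q b (eps : R) : open O -> O q -> 0 < eps -> Ck_on 1 O f ->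
  exists2 d : R, 0 < d & forall p t, ball q d p -> ball q d (t *: axis R b + p) ->
    `|f (t *: axis R b + p) - f p - t * pd b f q| <= eps * `|t|.
Proof.
move=> oO Oq e0 /Ck_onS[cf /(_ b)[df [cdf _]]].
have [d1 d10 B1] : exists2 d : R, 0 < d & ball q d `<=` O.
  have /nbhs_ballP[d /= d0 H] : nbhs q O by exact: open_nbhs_nbhs.
  by exists d.
have /cvgrPdist_le /(_ eps e0) /nbhs_ballP[d2 /= d20 B2] := cdf q Oq.
exists (Num.min d1 d2); first by rewrite lt_min d10.
move=> p t Bp Bt.
have line s := ball_segment (s := s) Bp Bt.
pose g (s : R) := f (s *: axis R b + p).
have dg s : s \in `[Num.min 0 t, Num.max 0 t] -> is_derive s 1 g (pd b f (s *: axis R b + p)).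
  move=> sI; apply/is_derive_line; rewrite /g.
  have -> : (fun h : R => f ((h *: (1 : R) + s) *: axis R b + p)) =
      (fun h : R => f (h *: axis R b + (s *: axis R b + p))).
    by apply/funext => h; rewrite scalerDl addrA [_ *: 1]mulr1.
  apply/is_derive_line; rewrite pd_derive; apply: derivableP; apply: df.
  by apply: B1; apply: le_ball (line s sI); rewrite ge_min lexx.
have [c cI E] := mvt0 dg.
have -> : f p = g 0 by rewrite /g scale0r add0r.
rewrite -/(g t) E.
rewrite [t * _]mulrC -mulrBl normrM ler_wpM2r// distrC; apply: B2.
by apply: le_ball (line c cI); rewrite ge_min lexx orbT.
Qed.

Lemma is_derive_cvg (F : R -> R) (l : R) :
  (fun h : R => h^-1 *: (F h - F 0)) @ 0^' --> l <-> is_derive (0 : R) (1 : R) F l.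
Proof.
have E : (fun h : R => h^-1 *: (F (h *: (1 : R) + 0) - F 0)) = (fun h : R => h^-1 *: (F h - F 0)).
  by apply/funext => h; rewrite addr0 [_ *: 1]mulr1.
split=> [H|[d1 d2]].
  split; first by apply/cvg_ex; exists l; rewrite /= E.
  by rewrite /derive E; apply/cvg_lim.
by rewrite -d2 /derive E; move: d1; rewrite /derivable E.
Qed.

(** The increment of [f] is split into one along each axis, and [slope_C1] is applied to
    both. *)
Lemma is_derive_chain0 O f (g1 g2 : R -> R) (a1 a2 : R) :
  open O -> Ck_on 1 O f -> O (g1 0, g2 0) ->
  is_derive (0 : R) (1 : R) g1 a1 -> is_derive (0 : R) (1 : R) g2 a2 ->
  is_derive (0 : R) (1 : R) (fun t => f (g1 t, g2 t))
    (a1 * pd true f (g1 0, g2 0) + a2 * pd false f (g1 0, g2 0)).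
Proof.
move=> oO kf; set q := (g1 0, g2 0) => Oq dg1 dg2.
have c1 : {for 0, continuous g1}.
  by apply/differentiable_continuous/derivable1_diffP; case: dg1.
have c2 : {for 0, continuous g2}.
  by apply/differentiable_continuous/derivable1_diffP; case: dg2.
move/is_derive_cvg : dg1 => dg1; move/is_derive_cvg : dg2 => dg2.
apply/is_derive_cvg; apply/cvgrPdist_le => /= e e0.
pose C : R := `|a1| + 1 + (`|a2| + 1).
have C0 : 0 < C by rewrite /C; have := normr_ge0 a1; have := normr_ge0 a2; lra.
pose eta := e / 2 / C.
have eta0 : 0 < eta by rewrite /eta !divr_gt0.
have [d1 d10 S1] := slope_C1 true oO Oq eta0 kf.
have [d2 d20 S2] := slope_C1 false oO Oq eta0 kf.
have lim : (fun h : R => (h^-1 *: (g1 h - g1 0)) * pd true f q +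
    (h^-1 *: (g2 h - g2 0)) * pd false f q) @ 0^' -->
    a1 * pd true f q + a2 * pd false f q.
  by apply: cvgD; apply: cvgM => //; exact: cvg_cst.
have e20 : 0 < e / 2 by rewrite divr_gt0.
near=> h.
have h0 : h != 0 by near: h; exact: nbhs_dnbhs_neq.
have B1 : `|g1 0 - g1 h| < Num.min d1 d2.
  by near: h; apply: nbhs_dnbhs; move/cvgrPdist_lt : c1; apply; rewrite lt_min d10.
have B2 : `|g2 0 - g2 h| < Num.min d1 d2.
  by near: h; apply: nbhs_dnbhs; move/cvgrPdist_lt : c2; apply; rewrite lt_min d10.
have L : `|a1 * pd true f q + a2 * pd false f q - ((h^-1 *: (g1 h - g1 0)) * pd true f q +
    (h^-1 *: (g2 h - g2 0)) * pd false f q)| <= e / 2.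
  by near: h; move/cvgrPdist_le : lim; apply.
have N1 : `|h^-1 *: (g1 h - g1 0)| <= `|a1| + 1.
  have : `|a1 - h^-1 *: (g1 h - g1 0)| <= 1 by near: h; move/cvgrPdist_le : dg1; apply.
  by rewrite -lerBlDl distrC => /(le_trans (lerB_dist _ _)).
have N2 : `|h^-1 *: (g2 h - g2 0)| <= `|a2| + 1.
  have : `|a2 - h^-1 *: (g2 h - g2 0)| <= 1 by near: h; move/cvgrPdist_le : dg2; apply.
  by rewrite -lerBlDl distrC => /(le_trans (lerB_dist _ _)).
move: B1 B2; rewrite !lt_min => /andP[B11 B12] /andP[B21 B22].
have := S1 (g1 0, g2 h) (g1 h - g1 0).
have := S2 (g1 0, g2 0) (g2 h - g2 0).
have -> : (g2 h - g2 0) *: axis R false + (g1 0, g2 0) = (g1 0, g2 h).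
  by congr (_, _); rewrite /= /GRing.scale /= ?mulr0 ?mulr1 ?add0r ?subrK.
have -> : (g1 h - g1 0) *: axis R true + (g1 0, g2 h) = (g1 h, g2 h).
  by congr (_, _); rewrite /= /GRing.scale /= ?mulr0 ?mulr1 ?add0r ?subrK.
have bb (d x y : R) : `|g1 0 - x| < d -> `|g2 0 - y| < d -> ball q d (x, y) by [].
have nn (x : R) (d : R) : 0 < d -> `|x - x| < d by rewrite subrr normr0.
move=> /(_ (bb _ _ _ (nn _ _ d20) (nn _ _ d20)) (bb _ _ _ (nn _ _ d20) B22)) T2.
move=> /(_ (bb _ _ _ (nn _ _ d10) B21) (bb _ _ _ B11 B21)) T1.
set l := a1 * _ + _ in L *.
set m := h^-1 *: _ * _ + _ in L.
rewrite -[l](subrK m) -addrA (le_trans (ler_normD _ _))// [leRHS]splitr lerD//.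
have -> : m - h^-1 *: (f (g1 h, g2 h) - f (g1 0, g2 0)) =
    - h^-1 * ((f (g1 h, g2 h) - f (g1 0, g2 h) - (g1 h - g1 0) * pd true f q) +
    (f (g1 0, g2 h) - f (g1 0, g2 0) - (g2 h - g2 0) * pd false f q)).
  by rewrite /m /GRing.scale /=; ring.
rewrite normrM normrN.
apply: (@le_trans _ _ (`|h^-1| * (eta * `|g1 h - g1 0| + eta * `|g2 h - g2 0|))).
  by rewrite ler_wpM2l// (le_trans (ler_normD _ _))// lerD.
have -> : `|h^-1| * (eta * `|g1 h - g1 0| + eta * `|g2 h - g2 0|) =
    eta * (`|h^-1 *: (g1 h - g1 0)| + `|h^-1 *: (g2 h - g2 0)|).
  by rewrite /GRing.scale /= !normrM; ring.
rewrite (_ : e / 2 = eta * C); last by rewrite /eta divfK// gt_eqF.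
by apply: ler_wpM2l; [exact: ltW|exact: lerD].
Unshelve. all: by end_near. Qed.

(** On the line through [x] in the direction [v] this is [is_derive_chain0]. *)
Lemma is_derive_chain (V : normedModType R) O f (g1 g2 : V -> R) (x v : V) (a1 a2 : R) :
  open O -> Ck_on 1 O f -> O (g1 x, g2 x) ->
  is_derive x v g1 a1 -> is_derive x v g2 a2 ->
  is_derive x v (fun t => f (g1 t, g2 t))
    (a1 * pd true f (g1 x, g2 x) + a2 * pd false f (g1 x, g2 x)).
Proof.
move=> oO kf Ox /is_derive_line d1 /is_derive_line d2; apply/is_derive_line.
have E : 0 *: v + x = x by rewrite scale0r add0r.
have := is_derive_chain0 oO kf _ d1 d2.
by rewrite E; exact.
Qed.

Lemma pd_comp O f (g1 g2 : R * R -> R) b q :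
  open O -> Ck_on 1 O f -> O (g1 q, g2 q) ->
  derivable g1 q (axis R b) -> derivable g2 q (axis R b) ->
  pd b (fun q' => f (g1 q', g2 q')) q =
    pd true f (g1 q, g2 q) * pd b g1 q + pd false f (g1 q, g2 q) * pd b g2 q.
Proof.
move=> oO kf Oq /derivableP d1 /derivableP d2.
have [_ ] := is_derive_chain oO kf Oq d1 d2.
by rewrite -pd_derive => ->; rewrite !pd_derive; congr (_ + _); rewrite mulrC.
Qed.

Lemma Ck_on_comp k O U f (g1 g2 : R * R -> R) : open O -> open U ->
  (forall q, U q -> O (g1 q, g2 q)) ->
  Ck_on k O f -> Ck_on k U g1 -> Ck_on k U g2 ->
  Ck_on k U (fun q => f (g1 q, g2 q)).
Proof.
move=> oO oU UO.
have cont f' : (forall q, O q -> {for q, continuous f'}) ->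
    (forall q, U q -> {for q, continuous g1}) ->
    (forall q, U q -> {for q, continuous g2}) ->
    forall q, U q -> {for q, continuous (fun q' => f' (g1 q', g2 q'))}.
  move=> cf c1 c2 q Uq.
  apply: (@continuous_comp _ _ _ (fun q => (g1 q, g2 q)) f').
    exact: (cvg_pair (c1 q Uq) (c2 q Uq)).
  exact/cf/UO.
elim: k f => [|k IH] f; first by move=> [cf _] [c1 _] [c2 _]; split => //; exact: cont.
move=> kf k1 k2; have := kf; have := k1; have := k2.
move=> /Ck_onS[c2 H2] /Ck_onS[c1 H1] /Ck_onS[cf H]; apply/Ck_onS; split; first exact: cont.
have kf1 : Ck_on 1 O f by elim: k kf {IH H H1 H2 k1 k2} => // k IH /Ck_onW.
move=> b; have [dg1 kdg1] := H1 b; have [dg2 kdg2] := H2 b; split.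
  move=> q Uq; have := is_derive_chain oO kf1 (UO _ Uq) (derivableP (dg1 q Uq)) (derivableP (dg2 q Uq)).
  by case.
have [_ kfu] := H true; have [_ kfv] := H false.
have := Ck_onD oU (Ck_onM oU (IH _ kfu (Ck_onW k1) (Ck_onW k2)) kdg1)
  (Ck_onM oU (IH _ kfv (Ck_onW k1) (Ck_onW k2)) kdg2).
apply: Ck_on_eq => // q Uq.
by rewrite (pd_comp oO kf1 (UO _ Uq))//; [exact: dg1|exact: dg2].
Qed.

Lemma ball_axes (q : R * R) (b : bool) (d s t : R) : `|s| < d -> `|t| < d ->
  ball q d (s *: axis R b + (t *: axis R (~~ b) + q)).
Proof.
move=> sd td; apply/ball_prodE.
by split; case: b; rewrite /axis /= /GRing.scale/= !mulr1 !mulr0 ?add0r opprD addrA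
   addrAC subrr add0r normrN.
Qed.

Lemma second_difference O f q b (eps : R) : open O -> O q -> 0 < eps -> Ck_on 2 O f ->
  exists2 d : R, 0 < d & forall t, 0 < t < d ->
    `|(f (t *: axis R b + (t *: axis R (~~ b) + q)) - f (t *: axis R (~~ b) + q)) -
      (f (t *: axis R b + q) - f q) - t ^+ 2 * pd (~~ b) (pd b f) q| <= eps * t ^+ 2.
Proof.
move=> oO Oq e0 /Ck_onS[_ /(_ b)[df kf]].
have [d1 d10 B1] : exists2 d : R, 0 < d & ball q d `<=` O.
  have /nbhs_ballP[d /= d0 H] : nbhs q O by exact: open_nbhs_nbhs.
  by exists d.
have [d2 d20 S] := slope_C1 (~~ b) oO Oq e0 kf.
exists (Num.min d1 d2); first by rewrite lt_min d10.
move=> t /andP[t0]; rewrite lt_min => /andP[td1 td2].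
have nt : `|t| = t by rewrite ger0_norm// ltW.
have int s : s \in `[Num.min 0 t, Num.max 0 t] -> `|s| <= t.
  by rewrite (min_idPl (ltW t0)) (max_idPr (ltW t0)) in_itv/= => /andP[s0 st]; rewrite ger0_norm.
pose g (s : R) := f (s *: axis R b + (t *: axis R (~~ b) + q)) - f (s *: axis R b + q).
pose g' (s : R) := pd b f (s *: axis R b + (t *: axis R (~~ b) + q)) - pd b f (s *: axis R b + q).
have tr p (s : R) : O (s *: axis R b + p) ->
    is_derive s 1 (fun s : R => f (s *: axis R b + p)) (pd b f (s *: axis R b + p)).
  move=> Op; apply/is_derive_line.
  have -> : (fun h : R => f ((h *: (1 : R) + s) *: axis R b + p)) =
      (fun h : R => f (h *: axis R b + (s *: axis R b + p))).
    by apply/funext => h; rewrite scalerDl addrA [_ *: 1]mulr1.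
  by apply/is_derive_line; rewrite pd_derive; apply: derivableP; exact: df.
have dg s : s \in `[Num.min 0 t, Num.max 0 t] -> is_derive s 1 g (g' s).
  move=> /int sI; apply: is_deriveB; apply: tr; apply: B1.
    by apply: ball_axes; rewrite ?nt// (le_lt_trans sI).
  by rewrite -[q in _ + q]add0r -(scale0r (axis R (~~ b))); apply: ball_axes;
    rewrite ?normr0// (le_lt_trans sI).
have [c /int cI] := mvt0 dg; rewrite /g !scale0r !add0r => E.
rewrite (_ : _ - _ = t * (pd b f (t *: axis R (~~ b) + (c *: axis R b + q)) - pd b f (c *: axis R b + q)
   - t * pd (~~ b) (pd b f) q)); last first.
  have -> : forall x y z w : R, x - y - (z - w) = x - z - (y - w) by move=> *; ring.
  by rewrite E /g' (addrCA (c *: _)); ring.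
rewrite normrM nt (_ : eps * t ^+ 2 = t * (eps * t)); last by ring.
apply: ler_wpM2l; first exact: ltW.
rewrite -[in leRHS]nt; apply: S.
  by rewrite -[q in _ + q]add0r -(scale0r (axis R (~~ b))); apply: ball_axes;
    rewrite ?normr0// (le_lt_trans cI).
by rewrite addrCA; apply: ball_axes; rewrite ?nt// (le_lt_trans cI).
Qed.

(** Both mixed derivatives are the limit of the same second difference quotient. *)
Lemma clairaut_real O f q : open O -> Ck_on 2 O f -> O q -> dv (du f) q = du (dv f) q.
Proof.
move=> oO kf Oq; apply/eqP; rewrite -subr_eq0 -normr_le0; apply/ler_addgt0Pl => e e0.
rewrite addr0.
have e20 : 0 < e / 2 by rewrite divr_gt0.
have [d1 d10 H1] := second_difference true oO Oq e20 kf.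
have [d2 d20 H2] := second_difference false oO Oq e20 kf.
pose t := Num.min d1 d2 / 2.
have m0 : 0 < Num.min d1 d2 by rewrite lt_min d10.
have t0 : 0 < t by rewrite divr_gt0.
have tm : t < Num.min d1 d2 by rewrite /t; lra.
have /H1 : 0 < t < d1 by rewrite t0 (lt_le_trans tm)// ge_min lexx.
have /H2 : 0 < t < d2 by rewrite t0 (lt_le_trans tm)// ge_min lexx orbT.
rewrite /= [t *: axis R false + (_ + _)]addrCA.
set D1 := f _; set D2 := f (t *: axis R true + q); set D3 := f (t *: axis R false + q).
set A := pd true (pd false f) q; set B := pd false (pd true f) q => h2 h1.
have t20 : 0 < t ^+ 2 by rewrite exprn_gt0.
rewrite -(ler_pM2l t20) -[X in X * _](gtr0_norm t20) -normrM.
rewrite -[dv (du f) q]/B -[du (dv f) q]/A.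
have -> : t ^+ 2 * (B - A) = (D1 - D2 - (D3 - f q) - t ^+ 2 * A) - (D1 - D3 - (D2 - f q) - t ^+ 2 * B).
  by ring.
apply: (le_trans (ler_normB _ _)); apply: le_trans (lerD h2 h1) _.
by rewrite le_eqVlt; apply/orP; left; apply/eqP; field.
Qed.

End ScalarCalculus.

Section VectorCalculus.
Context {R : realType} {m : nat}.
Implicit Types (F G : R * R -> 'rV[R]_m) (f g : R * R -> R) (O : set (R * R)) (b : bool)
  (q : R * R) (A : 'M[R]_m).

Lemma continuous_rVP F q :
  {for q, continuous F} <-> forall j, {for q, continuous (fun q' => F q' 0 j)}.
Proof.
split=> [cF j|H].
  by apply: (@continuous_comp _ _ _ F (fun M : 'rV[R]_m => M 0 j)) => //; exact: coord_continuous.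
apply/cvgrPdist_le => e e0; near=> p.
rewrite /Num.Def.normr/= mx_normrE (bigmax_le _ (ltW e0))//= => -[i j] _.
rewrite !mxE/= ord1; move: j; near: p; apply: filter_forall => j.
exact: ((cvgrPdist_le _ _).1 (H j)).
Unshelve. all: by end_near. Qed.

Lemma derivable_rVP F q v :
  derivable F q v <-> forall j, derivable (fun q' => F q' 0 j) q v.
Proof.
split=> [/derivable_mxP H j|H]; first exact: H.
by apply/derivable_mxP => i j; rewrite ord1; exact: H.
Qed.

Lemma pd_coord b F q j : derivable F q (axis R b) ->
  pd b F q 0 j = pd b (fun q' => F q' 0 j) q.
Proof. by move=> dF; rewrite !pd_derive derive_mx// mxE. Qed.

Lemma Ck_on_rVP k O F : open O ->
  Ck_on k O F <-> forall j, Ck_on k O (fun q => F q 0 j).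
Proof.
move=> oO; elim: k F => [|k IH] F.
  split=> [[cF _] j|H].
    by split=> // q Oq; exact: ((continuous_rVP F q).1 (cF q Oq) j).
  by split => // q Oq; apply/continuous_rVP => j; have [cF _] := H j; exact: cF.
split=> [/Ck_onS[cF H] j|H].
  apply/Ck_onS; split; first by move=> q Oq; exact: ((continuous_rVP F q).1 (cF q Oq) j).
  move=> b; have [dF kF] := H b; split; first by move=> q Oq; exact: ((derivable_rVP F q _).1 (dF q Oq) j).
  move/(IH (pd b F))/(_ j): kF.
  by apply: Ck_on_eq => // q Oq; rewrite pd_coord//; exact: dF.
apply/Ck_onS; split.
  by move=> q Oq; apply/continuous_rVP => j; have [+ _] := (Ck_onS _ _ _).1 (H j); apply.
move=> b.
have dF q (Oq : O q) : derivable F q (axis R b).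
  by apply/derivable_rVP => j; have [_ /(_ b)[+ _]] := (Ck_onS _ _ _).1 (H j); apply.
split => //; apply/(IH (pd b F)) => j.
have [_ /(_ b)[_]] := (Ck_onS _ _ _).1 (H j).
by apply: Ck_on_eq => // q Oq; rewrite pd_coord//; exact: dF.
Qed.

End VectorCalculus.

Section Dot.
Context {R : realType} {m : nat}.
Implicit Types (A U : 'M[R]_m) (x y z : 'rV[R]_m).

Lemma dotE A x y : dot A x y = \sum_i \sum_j x 0 i * A i j * y 0 j.
Proof.
rewrite /dot /form mxE exchange_big /=; apply: eq_bigr => j _.
rewrite !mxE /= big_distrl /=; exact: eq_bigr.
Qed.

Lemma dotC A x y : A^T = A -> dot A x y = dot A y x.
Proof.
move=> sA; rewrite !dotE exchange_big /=; apply: eq_bigr => j _; apply: eq_bigr => i _.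
by rewrite -[in LHS]sA mxE; ring.
Qed.

Lemma dotDl A x y z : dot A (x + y) z = dot A x z + dot A y z.
Proof.
rewrite !dotE -big_split /=; apply: eq_bigr => i _; rewrite -big_split /=.
by apply: eq_bigr => j _; rewrite !mxE; ring.
Qed.

Lemma dotDr A x y z : dot A z (x + y) = dot A z x + dot A z y.
Proof.
rewrite !dotE -big_split /=; apply: eq_bigr => i _; rewrite -big_split /=.
by apply: eq_bigr => j _; rewrite !mxE; ring.
Qed.

Lemma dotZl A (a : R) x y : dot A (a *: x) y = a * dot A x y.
Proof.
rewrite !dotE mulr_sumr; apply: eq_bigr => i _; rewrite mulr_sumr.
by apply: eq_bigr => j _; rewrite !mxE; ring.
Qed.

Lemma dotZr A (a : R) x y : dot A x (a *: y) = a * dot A x y.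
Proof.
rewrite !dotE mulr_sumr; apply: eq_bigr => i _; rewrite mulr_sumr.
by apply: eq_bigr => j _; rewrite !mxE; ring.
Qed.

Lemma dotNl A x y : dot A (- x) y = - dot A x y.
Proof. by rewrite -scaleN1r dotZl mulN1r. Qed.

Lemma dotNr A x y : dot A x (- y) = - dot A x y.
Proof. by rewrite -scaleN1r dotZr mulN1r. Qed.

Lemma dotBl A x y z : dot A (x - y) z = dot A x z - dot A y z.
Proof. by rewrite dotDl dotNl. Qed.

Lemma dotBr A x y z : dot A z (x - y) = dot A z x - dot A z y.
Proof. by rewrite dotDr dotNr. Qed.

Lemma dot0l A x : dot A 0 x = 0.
Proof. by rewrite -(scale0r 0) dotZl mul0r. Qed.

Lemma dot0r A x : dot A x 0 = 0.
Proof. by rewrite -(scale0r 0) dotZr mul0r. Qed.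

End Dot.

Section SmoothScalar.
Context {R : realType}.
Variable O : set (R * R).
Hypothesis oO : open O.
Implicit Types (f g : R * R -> R) (b : bool) (q : R * R).

Section Gen.
Context {V : normedModType R}.
Implicit Types F G : R * R -> V.

Lemma smooth_continuous F : smooth_on O F -> forall q, O q -> {for q, continuous F}.
Proof. by move=> /(_ 0%N)[]. Qed.

Lemma smooth_derivable b F : smooth_on O F -> forall q, O q -> derivable F q (axis R b).
Proof. by move=> /(_ 1%N)/Ck_onS[_ /(_ b)[]]. Qed.

Lemma smooth_pd b F : smooth_on O F -> smooth_on O (pd b F).
Proof. by move=> sF k; have /Ck_onS[_ /(_ b)[]] := sF k.+1. Qed.

Lemma smooth_du F : smooth_on O F -> smooth_on O (du F).
Proof. exact: (smooth_pd true). Qed.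

Lemma smooth_dv F : smooth_on O F -> smooth_on O (dv F).
Proof. exact: (smooth_pd false). Qed.

Lemma smooth_eq F G : (forall q, O q -> F q = G q) -> smooth_on O F -> smooth_on O G.
Proof. by move=> FG sF k; exact: Ck_on_eq FG (sF k). Qed.

Lemma smooth_local F :
  (forall q, O q -> exists2 P, P q & smooth_on P F) -> smooth_on O F.
Proof. by move=> H k; apply: Ck_on_local => q /H[P Pq sF]; exists P. Qed.

Lemma smooth_sub P F : P `<=` O -> smooth_on O F -> smooth_on P F.
Proof. by move=> PO sF k; exact: Ck_on_sub PO (sF k). Qed.

Lemma smooth_cst (c : V) : smooth_on O (fun=> c).
Proof. by move=> k; exact: Ck_on_cst. Qed.

Lemma smoothD F G : smooth_on O F -> smooth_on O G -> smooth_on O (fun q => F q + G q).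
Proof. by move=> sF sG k; exact: Ck_onD. Qed.

Lemma pd_cst b (c : V) q : pd b (fun=> c) q = 0.
Proof. by rewrite pd_derive derive_cst. Qed.

Lemma pdD b F G q : smooth_on O F -> smooth_on O G -> O q ->
  pd b (fun q => F q + G q) q = pd b F q + pd b G q.
Proof.
move=> sF sG Oq; rewrite !pd_derive -deriveD//.
  exact: smooth_derivable sF _ Oq.
exact: smooth_derivable sG _ Oq.
Qed.

End Gen.

Lemma smoothM f g : smooth_on O f -> smooth_on O g -> smooth_on O (fun q => f q * g q).
Proof. by move=> sF sG k; exact: Ck_onM. Qed.

Lemma smoothN f : smooth_on O f -> smooth_on O (fun q => - f q).
Proof.
move=> sf; apply: smooth_eq (smoothM (smooth_cst (-1 : R)) sf) => q _.
by rewrite mulN1r.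
Qed.

Lemma smoothB f g : smooth_on O f -> smooth_on O g -> smooth_on O (fun q => f q - g q).
Proof. by move=> sf sg; apply: smoothD => //; exact: smoothN. Qed.

Lemma smoothV f : (forall q, O q -> f q != 0) -> smooth_on O f ->
  smooth_on O (fun q => (f q)^-1).
Proof. by move=> f0 sf k; exact: Ck_onV. Qed.

Lemma smooth_div f g : (forall q, O q -> g q != 0) -> smooth_on O f -> smooth_on O g ->
  smooth_on O (fun q => f q / g q).
Proof. by move=> g0 sf sg; apply: smoothM => //; exact: smoothV. Qed.

Lemma smooth_sqrt f : (forall q, O q -> 0 < f q) -> smooth_on O f ->
  smooth_on O (fun q => Num.sqrt (f q)).
Proof. by move=> f0 sf k; exact: Ck_on_sqrt. Qed.

Lemma smooth_sum I (r : seq I) (F : I -> R * R -> R) :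
  (forall i, smooth_on O (F i)) -> smooth_on O (fun q => \sum_(i <- r) F i q).
Proof.
move=> sF; elim: r => [|i r IH].
  by apply: smooth_eq (smooth_cst (0 : R)) => q _; rewrite big_nil.
by apply: smooth_eq (smoothD (sF i) IH) => q _; rewrite big_cons.
Qed.

Lemma pdM b f g q : smooth_on O f -> smooth_on O g -> O q ->
  pd b (fun q => f q * g q) q = pd b f q * g q + f q * pd b g q.
Proof.
move=> sF sG Oq; rewrite !pd_derive.
rewrite -[fun _ => _]/(f * g) deriveM//; last 2 first.
- exact: smooth_derivable sF _ Oq.
- exact: smooth_derivable sG _ Oq.
by rewrite addrC /GRing.scale /= [g q * _]mulrC.
Qed.

Lemma pdN b f q : smooth_on O f -> O q -> pd b (fun q => - f q) q = - pd b f q.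
Proof. by move=> sf Oq; rewrite !pd_derive deriveN//; exact: smooth_derivable sf _ Oq. Qed.

Lemma pdV b f q : smooth_on O f -> O q -> f q != 0 ->
  pd b (fun q => (f q)^-1) q = - pd b f q / f q ^+ 2.
Proof.
move=> sf Oq f0; rewrite !pd_derive deriveV//; last exact: smooth_derivable sf _ Oq.
by rewrite -[LHS]/(_ * _) mulNr mulrC mulNr.
Qed.

Lemma pd_div b f g q : smooth_on O f -> smooth_on O g -> (forall q, O q -> g q != 0) ->
  O q -> pd b (fun q => f q / g q) q = (pd b f q * g q - f q * pd b g q) / g q ^+ 2.
Proof.
move=> sf sg g0 Oq; rewrite pdM//; last exact: smoothV.
by rewrite pdV ?g0//; field; exact: g0.
Qed.

Lemma smooth_fst : smooth_on O (fun q => q.1).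
Proof.
move=> k; case: k => [|k].
  by split; [move=> q _; exact: cvg_fst|].
apply/Ck_onS; split; first (move=> q _; exact: cvg_fst).
have D b q : is_derive q (axis R b) (fun q => q.1) (if b then 1 else 0 : R).
  apply/is_derive_line; case: b => /=; rewrite /axis /=.
    rewrite (_ : (fun _ => _) = shift q.1); first exact: is_derive_shift.
    by apply/funext => h; rewrite /= /GRing.scale/= mulr1.
  rewrite (_ : (fun _ => _) = cst q.1); first exact: is_derive_cst.
  by apply/funext => h; rewrite /= /GRing.scale/= mulr0 add0r.
move=> b; split; first by move=> q _; case: (D b q).
apply: Ck_on_eq (Ck_on_cst k O (if b then 1 else 0 : R)) => // q _.
by rewrite pd_derive; case: (D b q) => _ ->.
Qed.

Lemma continuous_snd_at q : {for q, continuous (fun q : R * R => q.2)}.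
Proof.
case: q => x y; rewrite /prop_for /continuous_at /=.
exact: (@cvg_snd _ _ (nbhs x) (nbhs y)).
Qed.

Lemma smooth_snd : smooth_on O (fun q => q.2).
Proof.
move=> k; case: k => [|k].
  by split; [move=> q _; exact: continuous_snd_at|].
apply/Ck_onS; split; first (move=> q _; exact: continuous_snd_at).
have D b q : is_derive q (axis R b) (fun q => q.2) (if b then 0 else 1 : R).
  apply/is_derive_line; case: b => /=; rewrite /axis /=.
    rewrite (_ : (fun _ => _) = cst q.2); first exact: is_derive_cst.
    by apply/funext => h; rewrite /= /GRing.scale/= mulr0 add0r.
  rewrite (_ : (fun _ => _) = shift q.2); first exact: is_derive_shift.
  by apply/funext => h; rewrite /= /GRing.scale/= mulr1.
move=> b; split; first by move=> q _; case: (D b q).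
apply: Ck_on_eq (Ck_on_cst k O (if b then 0 else 1 : R)) => // q _.
by rewrite pd_derive; case: (D b q) => _ ->.
Qed.

Lemma pd_fst b q : pd b (fun q : R * R => q.1) q = if b then 1 else 0.
Proof.
rewrite pd_derive; apply: derive_val; apply/is_derive_line; case: b => /=; rewrite /axis /=.
  rewrite (_ : (fun _ => _) = shift q.1); first exact: is_derive_shift.
  by apply/funext => h; rewrite /= /GRing.scale/= mulr1.
rewrite (_ : (fun _ => _) = cst q.1); first exact: is_derive_cst.
by apply/funext => h; rewrite /= /GRing.scale/= mulr0 add0r.
Qed.

Lemma pd_snd b q : pd b (fun q : R * R => q.2) q = if b then 0 else 1.
Proof.
rewrite pd_derive; apply: derive_val; apply/is_derive_line; case: b => /=; rewrite /axis /=.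
  rewrite (_ : (fun _ => _) = cst q.2); first exact: is_derive_cst.
  by apply/funext => h; rewrite /= /GRing.scale/= mulr0 add0r.
rewrite (_ : (fun _ => _) = shift q.2); first exact: is_derive_shift.
by apply/funext => h; rewrite /= /GRing.scale/= mulr1.
Qed.

End SmoothScalar.

Section SmoothVector.
Context {R : realType} {m : nat}.
Variable O : set (R * R).
Hypothesis oO : open O.
Implicit Types (F G : R * R -> 'rV[R]_m) (f g : R * R -> R) (b : bool) (q : R * R)
  (A : 'M[R]_m).

Lemma smooth_rVP F : smooth_on O F <-> forall j, smooth_on O (fun q => F q 0 j).
Proof.
split=> [sF j k|H k]; first exact: ((Ck_on_rVP k F oO).1 (sF k)).
by apply/(Ck_on_rVP k F oO) => j; exact: H.
Qed.

Lemma smooth_coord F j : smooth_on O F -> smooth_on O (fun q => F q 0 j).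
Proof. by move=> /smooth_rVP. Qed.

Lemma pd_coordE b F q j : smooth_on O F -> O q -> pd b F q 0 j = pd b (fun q => F q 0 j) q.
Proof. by move=> sF Oq; apply: pd_coord; exact: smooth_derivable sF _ Oq. Qed.

Lemma smoothZ f F : smooth_on O f -> smooth_on O F -> smooth_on O (fun q => f q *: F q).
Proof.
move=> sf sF; apply/smooth_rVP => j.
apply: (smooth_eq oO _ (smoothM oO sf (smooth_coord j sF))) => q _.
by rewrite mxE.
Qed.

Lemma pdZ b f F q : smooth_on O f -> smooth_on O F -> O q ->
  pd b (fun q => f q *: F q) q = pd b f q *: F q + f q *: pd b F q.
Proof.
move=> sf sF Oq; apply/rowP => j; rewrite pd_coordE//; last exact: smoothZ.
have -> : (fun q => (f q *: F q) 0 j) = (fun q => f q * F q 0 j).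
  by apply/funext => q'; rewrite mxE.
rewrite (pdM _ sf (smooth_coord j sF) Oq).
by rewrite !mxE (pd_coordE _ _ sF Oq).
Qed.

Lemma smoothNv F : smooth_on O F -> smooth_on O (fun q => - F q).
Proof.
move=> sF; apply: (smooth_eq oO _ (smoothZ (smooth_cst O (-1 : R)) sF)) => q _ /=.
by rewrite scaleN1r.
Qed.

Lemma smoothBv F G : smooth_on O F -> smooth_on O G -> smooth_on O (fun q => F q - G q).
Proof. by move=> sF sG; apply: smoothD => //; exact: smoothNv. Qed.

Lemma pdBv b F G q : smooth_on O F -> smooth_on O G -> O q ->
  pd b (fun q => F q - G q) q = pd b F q - pd b G q.
Proof.
move=> sF sG Oq; rewrite !pd_derive -deriveB//.
  exact: smooth_derivable sF _ Oq.
exact: smooth_derivable sG _ Oq.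
Qed.

Lemma smooth_dot A F G : smooth_on O F -> smooth_on O G ->
  smooth_on O (fun q => dot A (F q) (G q)).
Proof.
move=> sF sG; apply: (smooth_eq oO (fun q _ => esym (dotE _ _ _))).
apply: smooth_sum => // i; apply: smooth_sum => // j.
apply: smoothM => //; last exact: smooth_coord.
apply: smoothM => //; first exact: smooth_coord.
exact: smooth_cst.
Qed.

Lemma pd_sum I (r : seq I) (h : I -> R * R -> R) b q :
  (forall i, smooth_on O (h i)) -> O q ->
  pd b (fun q => \sum_(i <- r) h i q) q = \sum_(i <- r) pd b (h i) q.
Proof.
move=> sh Oq; elim: r => [|i r IH].
  rewrite big_nil (_ : (fun _ => _) = fun=> 0) ?pd_cst//.
  by apply/funext => q'; rewrite big_nil.
rewrite big_cons -IH -(pdD _ (sh i) _ Oq); last exact: smooth_sum.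
by congr (pd b _ q); apply/funext => q'; rewrite big_cons.
Qed.

Lemma pd_dot b A F G q : smooth_on O F -> smooth_on O G -> O q ->
  pd b (fun q => dot A (F q) (G q)) q = dot A (pd b F q) (G q) + dot A (F q) (pd b G q).
Proof.
move=> sF sG Oq.
have sm i j : smooth_on O (fun q => F q 0 i * A i j).
  by apply: smoothM => //; [exact: smooth_coord|exact: smooth_cst].
have -> : (fun q => dot A (F q) (G q)) =
    (fun q => \sum_i \sum_j F q 0 i * A i j * G q 0 j).
  by apply/funext => q'; rewrite dotE.
rewrite pd_sum//; last first.
  move=> i; apply: smooth_sum => // j; apply: smoothM => //; exact: smooth_coord.
rewrite !dotE -big_split /=; apply: eq_bigr => i _.
rewrite pd_sum//; last first.
  by move=> j; apply: smoothM => //; exact: smooth_coord.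
rewrite -big_split /=; apply: eq_bigr => j _.
rewrite (pdM _ (sm i j) (smooth_coord j sG) Oq).
rewrite (pdM _ (smooth_coord i sF) (smooth_cst O (A i j)) Oq).
by rewrite pd_cst !(pd_coordE _ _ _ Oq) //; ring.
Qed.

Lemma clairaut F q : smooth_on O F -> O q -> dv (du F) q = du (dv F) q.
Proof.
move=> sF Oq; apply/rowP => j.
transitivity (pd false (fun q => du F q 0 j) q).
  exact: (pd_coordE false j (smooth_du sF) Oq).
transitivity (pd true (fun q => dv F q 0 j) q); last first.
  exact/esym/(pd_coordE true j (smooth_dv sF) Oq).
transitivity (dv (du (fun q => F q 0 j)) q).
  by apply: (eq_on_pd false oO _ Oq) => q' Oq'; exact: (pd_coordE true _ sF Oq').
rewrite (clairaut_real oO (smooth_coord j sF 2%N) Oq).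
by apply: (eq_on_pd true oO _ Oq) => q' Oq'; exact/esym/(pd_coordE false j sF Oq').
Qed.

Lemma smooth_comp U F (g1 g2 : R * R -> R) : open U ->
  (forall q, U q -> O (g1 q, g2 q)) ->
  smooth_on O F -> smooth_on U g1 -> smooth_on U g2 ->
  smooth_on U (fun q => F (g1 q, g2 q)).
Proof.
move=> oU UO sF s1 s2 k; apply/(Ck_on_rVP k _ oU) => j.
by apply: (Ck_on_comp oO oU UO (smooth_coord j sF k) (s1 k) (s2 k)).
Qed.

Lemma pd_compv U b F (g1 g2 : R * R -> R) q : open U ->
  (forall q, U q -> O (g1 q, g2 q)) ->
  smooth_on O F -> smooth_on U g1 -> smooth_on U g2 -> U q ->
  pd b (fun q => F (g1 q, g2 q)) q =
    pd b g1 q *: du F (g1 q, g2 q) + pd b g2 q *: dv F (g1 q, g2 q).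
Proof.
move=> oU UO sF s1 s2 Uq; apply/rowP => j.
have sC : smooth_on U (fun q => F (g1 q, g2 q)) by exact: (smooth_comp oU UO).
have dC := smooth_derivable (b:=b) sC Uq.
have d1 := smooth_derivable (b:=b) s1 Uq.
have d2 := smooth_derivable (b:=b) s2 Uq.
have Oq := UO _ Uq.
transitivity (pd b (fun q' => F (g1 q', g2 q') 0 j) q); first exact: pd_coord dC.
have -> := pd_comp oO (smooth_coord j sF 1%N) Oq d1 d2.
have <- := pd_coordE true j sF Oq; have <- := pd_coordE false j sF Oq.
by rewrite !mxE mulrC [X in _ + X]mulrC.
Qed.

End SmoothVector.

Section SmoothCompReal.
Context {R : realType} (O U : set (R * R)) (f g1 g2 : R * R -> R).
Hypotheses (oO : open O) (oU : open U) (UO : forall q, U q -> O (g1 q, g2 q))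
  (sf : smooth_on O f) (s1 : smooth_on U g1) (s2 : smooth_on U g2).

Lemma smooth_comp_real : smooth_on U (fun q => f (g1 q, g2 q)).
Proof. by move=> k; exact: (Ck_on_comp oO oU UO (sf k) (s1 k) (s2 k)). Qed.

Lemma pd_comp_real b q : U q ->
  pd b (fun q => f (g1 q, g2 q)) q =
    du f (g1 q, g2 q) * pd b g1 q + dv f (g1 q, g2 q) * pd b g2 q.
Proof.
move=> Uq; exact: (pd_comp oO (sf 1%N) (UO Uq) (smooth_derivable s1 Uq) (smooth_derivable s2 Uq)).
Qed.

Lemma du_comp_real q : U q ->
  du (fun q => f (g1 q, g2 q)) q = du f (g1 q, g2 q) * du g1 q + dv f (g1 q, g2 q) * du g2 q.
Proof. exact: (pd_comp_real true). Qed.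

Lemma dv_comp_real q : U q ->
  dv (fun q => f (g1 q, g2 q)) q = du f (g1 q, g2 q) * dv g1 q + dv f (g1 q, g2 q) * dv g2 q.
Proof. exact: (pd_comp_real false). Qed.

End SmoothCompReal.

Lemma clairaut_smooth (R : realType) (O : set (R * R)) (f : R * R -> R) q :
  open O -> smooth_on O f -> O q -> dv (du f) q = du (dv f) q.
Proof. by move=> oO sf; exact: clairaut_real oO (sf 2%N). Qed.

Opaque smooth_on.

Lemma eq_du (R : realType) (V : normedModType R) O (F G : R * R -> V) q :
  open O -> (forall q, O q -> F q = G q) -> O q -> du F q = du G q.
Proof. by move=> oO FG Oq; exact: (eq_on_pd true oO FG Oq). Qed.

Lemma eq_dv (R : realType) (V : normedModType R) O (F G : R * R -> V) q :
  open O -> (forall q, O q -> F q = G q) -> O q -> dv F q = dv G q.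
Proof. by move=> oO FG Oq; exact: (eq_on_pd false oO FG Oq). Qed.

(** [du], [dv] and [dot] behind opaque proofs: in computations with second and third
    derivatives unification must not unfold them into limits and matrix entries. *)
Fact pu_key : {d : forall (R : realType) (V : normedModType R), (R * R -> V) -> R * R -> V |
  d = @du}.
Proof. by exists @du. Qed.

Fact pv_key : {d : forall (R : realType) (V : normedModType R), (R * R -> V) -> R * R -> V |
  d = @dv}.
Proof. by exists @dv. Qed.

Fact ip_key : {d : forall (R : realType) m, 'M[R]_m -> 'rV[R]_m -> 'rV[R]_m -> R | d = @dot}.
Proof. by exists @dot. Qed.

Definition pu (R : realType) (V : normedModType R) := @sval _ _ pu_key R V.
Definition pv (R : realType) (V : normedModType R) := @sval _ _ pv_key R V.
Definition ip (R : realType) m := @sval _ _ ip_key R m.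

Lemma puE (R : realType) (V : normedModType R) (F : R * R -> V) : du F = pu F.
Proof. by rewrite /pu (svalP pu_key). Qed.

Lemma pvE (R : realType) (V : normedModType R) (F : R * R -> V) : dv F = pv F.
Proof. by rewrite /pv (svalP pv_key). Qed.

Lemma ipE (R : realType) m (A : 'M[R]_m) x y : dot A x y = ip A x y.
Proof. by rewrite /ip (svalP ip_key). Qed.

Section InnerProduct.
Context {R : realType} {m : nat} (A : 'M[R]_m).
Implicit Types (x y z : 'rV[R]_m) (a : R).

Lemma ipC x y : A^T = A -> ip A x y = ip A y x.
Proof. by move=> sA; rewrite -!ipE dotC. Qed.

Lemma ipDl x y z : ip A (x + y) z = ip A x z + ip A y z.
Proof. by rewrite -!ipE dotDl. Qed.

Lemma ipDr x y z : ip A z (x + y) = ip A z x + ip A z y.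
Proof. by rewrite -!ipE dotDr. Qed.

Lemma ipBl x y z : ip A (x - y) z = ip A x z - ip A y z.
Proof. by rewrite -!ipE dotBl. Qed.

Lemma ipBr x y z : ip A z (x - y) = ip A z x - ip A z y.
Proof. by rewrite -!ipE dotBr. Qed.

Lemma ipNl x y : ip A (- x) y = - ip A x y.
Proof. by rewrite -!ipE dotNl. Qed.

Lemma ipNr x y : ip A x (- y) = - ip A x y.
Proof. by rewrite -!ipE dotNr. Qed.

Lemma ipZl a x y : ip A (a *: x) y = a * ip A x y.
Proof. by rewrite -!ipE dotZl. Qed.

Lemma ipZr a x y : ip A x (a *: y) = a * ip A x y.
Proof. by rewrite -!ipE dotZr. Qed.

Lemma ip0l x : ip A 0 x = 0.
Proof. by rewrite -!ipE dot0l. Qed.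

Lemma ip0r x : ip A x 0 = 0.
Proof. by rewrite -!ipE dot0r. Qed.

Definition ip_linE := (ipDl, ipDr, ipBl, ipBr, ipNl, ipNr, ipZl, ipZr, ip0l, ip0r).

End InnerProduct.

Section SealedRules.
Context {R : realType}.
Variable O : set (R * R).
Hypothesis oO : open O.
Context {m : nat}.
Implicit Types (F G : R * R -> 'rV[R]_m) (f g : R * R -> R) (q : R * R) (A : 'M[R]_m).

Lemma smooth_pu (V : normedModType R) (F : R * R -> V) : smooth_on O F -> smooth_on O (pu F).
Proof. by rewrite -puE; exact: smooth_du. Qed.

Lemma pu_cst (V : normedModType R) (c : V) q : pu (fun=> c) q = 0.
Proof. by rewrite -puE; exact: (pd_cst true). Qed.

Lemma puD (V : normedModType R) (F G : R * R -> V) q :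
  smooth_on O F -> smooth_on O G -> O q ->
  pu (fun q => F q + G q) q = pu F q + pu G q.
Proof. rewrite -!puE; exact: (@pdD R O V true). Qed.

Lemma puN f q : smooth_on O f -> O q -> pu (fun q => - f q) q = - pu f q.
Proof. rewrite -!puE; exact: (@pdN R O true). Qed.

Lemma puM f g q : smooth_on O f -> smooth_on O g -> O q ->
  pu (fun q => f q * g q) q = pu f q * g q + f q * pu g q.
Proof. rewrite -!puE; exact: (@pdM R O true). Qed.

Lemma puV f q : smooth_on O f -> O q -> f q != 0 ->
  pu (fun q => (f q)^-1) q = - pu f q / f q ^+ 2.
Proof. rewrite -!puE; exact: (@pdV R O true). Qed.

Lemma puZ f F q : smooth_on O f -> smooth_on O F -> O q ->
  pu (fun q => f q *: F q) q = pu f q *: F q + f q *: pu F q.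
Proof. rewrite -!puE; exact: (@pdZ R m O oO true). Qed.

Lemma puBv F G q : smooth_on O F -> smooth_on O G -> O q ->
  pu (fun q => F q - G q) q = pu F q - pu G q.
Proof. rewrite -!puE; exact: (@pdBv R m O true). Qed.

Lemma pu_ip A F G q : smooth_on O F -> smooth_on O G -> O q ->
  pu (fun q => ip A (F q) (G q)) q = ip A (pu F q) (G q) + ip A (F q) (pu G q).
Proof.
have E : (fun q => ip A (F q) (G q)) = (fun q => dot A (F q) (G q)).
  by apply/funext => q'; rewrite ipE.
by rewrite E -!puE -!ipE; exact: (@pd_dot R m O oO true).
Qed.

Lemma eq_pu (V : normedModType R) (F G : R * R -> V) q :
  (forall q, O q -> F q = G q) -> O q -> pu F q = pu G q.
Proof. move=> FG Oq; rewrite -!puE; exact: (eq_on_pd true oO FG Oq). Qed.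

Lemma pu_compv U F (g1 g2 : R * R -> R) q : open U ->
  (forall q, U q -> O (g1 q, g2 q)) ->
  smooth_on O F -> smooth_on U g1 -> smooth_on U g2 -> U q ->
  pu (fun q => F (g1 q, g2 q)) q =
    pu g1 q *: pu F (g1 q, g2 q) + pu g2 q *: pv F (g1 q, g2 q).
Proof.
by rewrite -!puE -?pvE => oU UO sF s1 s2 Uq; exact: (pd_compv oO true oU UO sF s1 s2 Uq).
Qed.

Lemma pu_comp U f (g1 g2 : R * R -> R) q :
  (forall q, U q -> O (g1 q, g2 q)) ->
  smooth_on O f -> smooth_on U g1 -> smooth_on U g2 -> U q ->
  pu (fun q => f (g1 q, g2 q)) q =
    pu f (g1 q, g2 q) * pu g1 q + pv f (g1 q, g2 q) * pu g2 q.
Proof.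
by rewrite -!puE -?pvE => UO sF s1 s2 Uq; exact: (pd_comp_real oO UO sF s1 s2 true Uq).
Qed.

Lemma smooth_pv (V : normedModType R) (F : R * R -> V) : smooth_on O F -> smooth_on O (pv F).
Proof. by rewrite -pvE; exact: smooth_dv. Qed.

Lemma pv_cst (V : normedModType R) (c : V) q : pv (fun=> c) q = 0.
Proof. by rewrite -pvE; exact: (pd_cst false). Qed.

Lemma pvD (V : normedModType R) (F G : R * R -> V) q :
  smooth_on O F -> smooth_on O G -> O q ->
  pv (fun q => F q + G q) q = pv F q + pv G q.
Proof. rewrite -!pvE; exact: (@pdD R O V false). Qed.

Lemma pvN f q : smooth_on O f -> O q -> pv (fun q => - f q) q = - pv f q.
Proof. rewrite -!pvE; exact: (@pdN R O false). Qed.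

Lemma pvM f g q : smooth_on O f -> smooth_on O g -> O q ->
  pv (fun q => f q * g q) q = pv f q * g q + f q * pv g q.
Proof. rewrite -!pvE; exact: (@pdM R O false). Qed.

Lemma pvV f q : smooth_on O f -> O q -> f q != 0 ->
  pv (fun q => (f q)^-1) q = - pv f q / f q ^+ 2.
Proof. rewrite -!pvE; exact: (@pdV R O false). Qed.

Lemma pv_div f g q : smooth_on O f -> smooth_on O g ->
  (forall q, O q -> g q != 0) -> O q ->
  pv (fun q => f q / g q) q = (pv f q * g q - f q * pv g q) / g q ^+ 2.
Proof. rewrite -!pvE; exact: (@pd_div R O oO false). Qed.

Lemma pvZ f F q : smooth_on O f -> smooth_on O F -> O q ->
  pv (fun q => f q *: F q) q = pv f q *: F q + f q *: pv F q.
Proof. rewrite -!pvE; exact: (@pdZ R m O oO false). Qed.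

Lemma pvBv F G q : smooth_on O F -> smooth_on O G -> O q ->
  pv (fun q => F q - G q) q = pv F q - pv G q.
Proof. rewrite -!pvE; exact: (@pdBv R m O false). Qed.

Lemma pv_ip A F G q : smooth_on O F -> smooth_on O G -> O q ->
  pv (fun q => ip A (F q) (G q)) q = ip A (pv F q) (G q) + ip A (F q) (pv G q).
Proof.
have E : (fun q => ip A (F q) (G q)) = (fun q => dot A (F q) (G q)).
  by apply/funext => q'; rewrite ipE.
by rewrite E -!pvE -!ipE; exact: (@pd_dot R m O oO false).
Qed.

Lemma eq_pv (V : normedModType R) (F G : R * R -> V) q :
  (forall q, O q -> F q = G q) -> O q -> pv F q = pv G q.
Proof. move=> FG Oq; rewrite -!pvE; exact: (eq_on_pd false oO FG Oq). Qed.

Lemma pv_compv U F (g1 g2 : R * R -> R) q : open U ->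
  (forall q, U q -> O (g1 q, g2 q)) ->
  smooth_on O F -> smooth_on U g1 -> smooth_on U g2 -> U q ->
  pv (fun q => F (g1 q, g2 q)) q =
    pv g1 q *: pu F (g1 q, g2 q) + pv g2 q *: pv F (g1 q, g2 q).
Proof.
by rewrite -!puE -?pvE => oU UO sF s1 s2 Uq; exact: (pd_compv oO false oU UO sF s1 s2 Uq).
Qed.

Lemma pv_comp U f (g1 g2 : R * R -> R) q :
  (forall q, U q -> O (g1 q, g2 q)) ->
  smooth_on O f -> smooth_on U g1 -> smooth_on U g2 -> U q ->
  pv (fun q => f (g1 q, g2 q)) q =
    pu f (g1 q, g2 q) * pv g1 q + pv f (g1 q, g2 q) * pv g2 q.
Proof.
by rewrite -!puE -?pvE => UO sF s1 s2 Uq; exact: (pd_comp_real oO UO sF s1 s2 false Uq).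
Qed.

Lemma smooth_ip A F G : smooth_on O F -> smooth_on O G ->
  smooth_on O (fun q => ip A (F q) (G q)).
Proof.
move=> sF sG; have := smooth_dot oO A sF sG; apply: (smooth_eq oO) => q _.
exact: ipE.
Qed.

Lemma pvuC F q : smooth_on O F -> O q -> pv (pu F) q = pu (pv F) q.
Proof. by rewrite -!puE -!pvE => sF Oq; exact: (clairaut oO). Qed.

Lemma pvuC_real f q : smooth_on O f -> O q -> pv (pu f) q = pu (pv f) q.
Proof. by rewrite -!puE -!pvE => sF Oq; exact: (clairaut_smooth oO). Qed.

End SealedRules.

(** * Orthogonal projections and Gram matrices *)

Section Orthogonal.
Context {R : realType} {m : nat}.
Implicit Types (A U : 'M[R]_m) (x y z w u : 'rV[R]_m).

Lemma orthP A U x :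
  reflect (forall u, (u <= U)%MS -> dot A x u = 0) (x <= orth A U)%MS.
Proof.
have mxid (M : 'M[R]_m) : map_mx idfun M = M by apply/matrixP => i j; rewrite mxE.
have dotM u : dot A x u = (x *m A *m u^T) 0 0.
  by rewrite /dot /form; congr ((_ *m _) 0 0); apply/matrixP => i j; rewrite !mxE.
apply: (iffP idP) => [/sub_kermxP H u /submxP[D ->]|H].
  rewrite mxid in H.
  by rewrite dotM trmx_mul mulmxA -[x *m A *m _]mulmxA H mul0mx mxE.
apply/sub_kermxP; rewrite mxid; apply/rowP => j; rewrite mulmxA mxE [RHS]mxE.
have E := H (row j U) (row_sub _ _); rewrite dotM mxE in E; rewrite -[RHS]E.
by apply: eq_bigr => i _; rewrite !mxE.
Qed.

Lemma dot_adds A x (k l : nat) (U : 'M[R]_(k, m)) (W : 'M[R]_(l, m)) :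
  (forall u, (u <= U + W)%MS -> dot A x u = 0) <->
  (forall u, (u <= U)%MS -> dot A x u = 0) /\ (forall u, (u <= W)%MS -> dot A x u = 0).
Proof.
split=> [H|[HU HW] u].
  split=> u uU; apply: H; [exact: submx_trans uU (addsmxSl _ _)|].
  exact: submx_trans uU (addsmxSr _ _).
move=> /sub_addsmxP[[a b] /= ->]; rewrite dotDr HU ?HW ?addr0//; exact: submxMl.
Qed.

Lemma dot_line A x y : (forall u, (u <= y)%MS -> dot A x u = 0) <-> dot A x y = 0.
Proof.
split=> [->//|H u /sub_rVP[a ->]].
by rewrite dotZr H mulr0.
Qed.

Definition nondegenerate_on A U :=
  forall u, (u <= U)%MS -> (u <= orth A U)%MS -> u = 0.

Variable A : 'M[R]_m.
Hypothesis uA : A \in unitmx.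

Lemma oproj_split U w : nondegenerate_on A U ->
  (oproj A U w <= orth A U)%MS /\ (w - oproj A U w <= U)%MS.
Proof.
move=> nd.
have cap0 : (orth A U :&: U = 0)%MS.
  apply/eqP; rewrite -submx0; apply/rV_subP => u.
  by rewrite sub_capmx => /andP[u1 u2]; rewrite (nd u u2 u1) sub0mx.
have full : (w <= orth A U + U)%MS.
  apply: submx_full; rewrite -col_leq_rank.
  have -> : \rank (orth A U + U)%MS = (\rank (orth A U) + \rank U)%N.
    by rewrite -mxrank_sum_cap cap0 mxrank0 addn0.
  rewrite /orth /orthomx mxrank_ker -mxrank_tr.
  have -> : (A *m U ^t idfun)%sesqui = A *m U^T.
    by congr (_ *m _); apply/matrixP => i j; rewrite !mxE.
  rewrite trmx_mul trmxK mxrankMfree ?row_free_unit ?unitmx_tr//.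
  by rewrite subnK// rank_leq_row.
split; first exact: proj_mx_sub.
have E := add_proj_mx cap0 full.
rewrite -[X in (X - _ <= _)%MS]E /oproj addrAC subrr add0r; exact: proj_mx_sub.
Qed.

(** The projection is characterised by its defining properties because a nondegenerate
    subspace meets its orthogonal complement trivially. *)
Lemma oproj_eq U w z : nondegenerate_on A U -> (z <= orth A U)%MS -> (w - z <= U)%MS ->
  oproj A U w = z.
Proof.
move=> nd zo zU; have [po pU] := oproj_split w nd.
apply/eqP; rewrite -subr_eq0; apply/eqP/nd.
  rewrite (_ : _ - z = (w - z) - (w - oproj A U w)); last by rewrite opprB [RHS]addrC addrA subrK.
  by rewrite addmx_sub// eqmx_opp.
by rewrite addmx_sub// eqmx_opp.
Qed.

Lemma oproj_in U w : nondegenerate_on A U -> (w <= U)%MS -> oproj A U w = 0.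
Proof. by move=> nd wU; apply: oproj_eq => //; rewrite ?sub0mx// subr0. Qed.

Lemma oproj0_sub U w : nondegenerate_on A U -> oproj A U w = 0 -> (w <= U)%MS.
Proof. by move=> nd w0; have [_] := oproj_split w nd; rewrite w0 subr0. Qed.

Lemma dot_oproj U w x : nondegenerate_on A U -> (x <= orth A U)%MS ->
  dot A x (oproj A U w) = dot A x w.
Proof.
move=> nd /orthP xo; have [_ pU] := oproj_split w nd.
by apply/eqP; rewrite eq_sym -subr_eq0 -dotBr xo.
Qed.

Lemma oprojD U w z : oproj A U (w + z) = oproj A U w + oproj A U z.
Proof. by rewrite /oproj mulmxDl. Qed.

Lemma oprojZ U a w : oproj A U (a *: w) = a *: oproj A U w.
Proof. by rewrite /oproj scalemxAl. Qed.

End Orthogonal.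

Section Gram.
Context {R : realType}.

Lemma pseudo_gram_sym m s : (pseudo_gram R m s)^T = pseudo_gram R m s.
Proof. exact: tr_diag_mx. Qed.

Lemma pseudo_gram_unit m s : pseudo_gram R m s \in unitmx.
Proof.
rewrite unitmxE det_diag unitfE prodf_seq_neq0; apply/allP => i _.
by rewrite mxE; case: ifP => _; rewrite ?oppr_eq0 oner_eq0.
Qed.

Lemma ext_gram_sym m (A : 'M[R]_m) c : A^T = A -> (ext_gram A c)^T = ext_gram A c.
Proof. by move=> sA; rewrite /ext_gram tr_block_mx sA !trmx0 tr_scalar_mx. Qed.

Lemma dot_ext m (A : 'M[R]_m) c (x x' : 'rV[R]_m) (t t' : 'rV[R]_1) :
  dot (ext_gram A c) (row_mx x t) (row_mx x' t') = dot A x x' - c * (t 0 0 * t' 0 0).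
Proof.
have mxid k l (M : 'M[R]_(k, l)) : map_mx idfun M = M by apply/matrixP => i j; rewrite mxE.
rewrite /dot /form !mxid /ext_gram mul_row_block !mulmx0 addr0 add0r tr_row_mx mul_row_col.
rewrite mxE; congr (_ + _).
by rewrite mul_mx_scalar -scalemxAl mxE mulNr; congr (- (_ * _)); rewrite !mxE big_ord1 mxE.
Qed.

End Gram.

Section Spans.
Context {R : realType} {m : nat} (A : 'M[R]_m).
Hypothesis sA : A^T = A.
Implicit Types (Y X : R * R -> 'rV[R]_m) (q : R * R).

Lemma conf_normalP Y q (x : 'rV[R]_m) :
  (x <= conf_normal A Y q)%MS <->
  [/\ dot A x (Y q) = 0, dot A x (du Y q) = 0, dot A x (dv Y q) = 0 &
      dot A x (dv (du Y) q) = 0].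
Proof.
split=> [/orthP/dot_adds[/dot_adds[/dot_adds[]]]|[h1 h2 h3 h4]].
  by move=> /dot_line ? /dot_line ? /dot_line ? /dot_line ?.
by apply/orthP/dot_adds; split; [apply/dot_adds; split; [apply/dot_adds; split|]|]; apply/dot_line.
Qed.

Lemma pc_normalP X q (x : 'rV[R]_m) :
  (x <= pc_normal A X q)%MS <->
  [/\ dot A x (X q) = 0, dot A x (du X q) = 0 & dot A x (dv X q) = 0].
Proof.
split=> [/orthP/dot_adds[/dot_adds[]]|[h1 h2 h3]].
  by move=> /dot_line ? /dot_line ? /dot_line ?.
by apply/orthP/dot_adds; split; [apply/dot_adds; split|]; apply/dot_line.
Qed.

Lemma conf_spanP Y q (x : 'rV[R]_m) :
  (x <= conf_span Y q)%MS <->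
  exists a b c d, x = a *: Y q + b *: du Y q + c *: dv Y q + d *: dv (du Y) q.
Proof.
split.
  move=> /sub_addsmxP[[u1 u2] /= ->].
  have /sub_rVP[d ->] : (u2 *m dv (du Y) q <= dv (du Y) q)%MS by exact: submxMl.
  have /sub_addsmxP[[u3 u4] /= ->] : (u1 *m (Y q + du Y q + dv Y q)%MS <= Y q + du Y q + dv Y q)%MS by exact: submxMl.
  have /sub_rVP[c ->] : (u4 *m dv Y q <= dv Y q)%MS by exact: submxMl.
  have /sub_addsmxP[[u5 u6] /= ->] : (u3 *m (Y q + du Y q)%MS <= Y q + du Y q)%MS by exact: submxMl.
  have /sub_rVP[b ->] : (u6 *m du Y q <= du Y q)%MS by exact: submxMl.
  have /sub_rVP[a ->] : (u5 *m Y q <= Y q)%MS by exact: submxMl.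
  by exists a, b, c, d.
move=> [a [b [c [d ->]]]].
by rewrite !addmx_sub_adds// scalemx_sub.
Qed.

Lemma pc_spanP X q (x : 'rV[R]_m) :
  (x <= pc_span X q)%MS <->
  exists a b c, x = a *: X q + b *: du X q + c *: dv X q.
Proof.
split.
  move=> /sub_addsmxP[[u3 u4] /= ->].
  have /sub_rVP[c ->] : (u4 *m dv X q <= dv X q)%MS by exact: submxMl.
  have /sub_addsmxP[[u5 u6] /= ->] : (u3 *m (X q + du X q)%MS <= X q + du X q)%MS by exact: submxMl.
  have /sub_rVP[b ->] : (u6 *m du X q <= du X q)%MS by exact: submxMl.
  have /sub_rVP[a ->] : (u5 *m X q <= X q)%MS by exact: submxMl.
  by exists a, b, c.
move=> [a [b [c ->]]].
by rewrite !addmx_sub_adds// scalemx_sub.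
Qed.

End Spans.

(** * Charts and transition maps *)

Section ChartTheory.
Context {R : realType} {M : topologicalType}.
Implicit Types (k l a : chart R M) (p : M) (q : R * R) (W : set M).

Lemma chart_param_dom k q : is_chart k -> chart_img k q ->
  chart_dom k (chart_param k q) /\ chart_coord k (chart_param k q) = q.
Proof. by move=> [_ _ pK _ _] [p dp <-]; rewrite pK. Qed.

Lemma chart_imgP k p : chart_dom k p -> chart_img k (chart_coord k p).
Proof. by exists p. Qed.

Lemma chart_imageE k W q : is_chart k ->
  (chart_coord k @` (chart_dom k `&` W)) q <-> chart_img k q /\ W (chart_param k q).
Proof.
move=> ck; have [_ _ pK _ _] := ck; split=> [[p [dp Wp] <-]|[kq Wq]].
  by rewrite pK//; split => //; exact: chart_imgP.
have [d c] := chart_param_dom ck kq.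
by exists (chart_param k q).
Qed.

Lemma open_chart_image k W : is_chart k -> open (chart_dom k `&` W) ->
  open (chart_coord k @` (chart_dom k `&` W)).
Proof.
move=> ck oW; have [_ oI pK _ cp] := ck.
rewrite openE => q /(chart_imageE _ _ ck)[kq Wq]; rewrite /interior.
have [d c] := chart_param_dom ck kq.
have nI : nbhs q (chart_img k) by exact: open_nbhs_nbhs.
have nW : nbhs q (chart_param k @^-1` (chart_dom k `&` W)).
  by apply: (cp q kq); exact: open_nbhs_nbhs.
apply: filterS (filterI nI nW) => q' [kq' [_ Wq']].
exact/chart_imageE.
Qed.

Lemma is_chart_restr k W : is_chart k -> open (chart_dom k `&` W) ->
  is_chart (chart_restr k W).
Proof.
move=> ck oW; have [oD oI pK cc cp] := ck; split => //=.
- exact: open_chart_image.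
- by move=> p [dp _]; exact: pK.
- by move=> p [dp _]; exact: cc.
- by move=> q /(chart_imageE _ _ ck)[kq _]; exact: cp.
Qed.

Lemma chart_img_restr k W : is_chart k -> chart_img (chart_restr k W) `<=` chart_img k.
Proof. by move=> ck q /(chart_imageE _ _ ck)[]. Qed.

Lemma overlapE k l q : is_chart k ->
  overlap k l q <-> chart_img k q /\ chart_dom l (chart_param k q).
Proof. exact: chart_imageE. Qed.

Lemma overlap_open k l : is_chart k -> is_chart l -> open (overlap k l).
Proof.
move=> ck cl; apply: open_chart_image => //; apply: openI; [by case: ck|by case: cl].
Qed.

Definition transition k l q : R * R := (trans1 k l q, trans2 k l q).

Lemma transitionE k l q : transition k l q = chart_coord l (chart_param k q).
Proof. by rewrite /transition /trans1 /trans2 -surjective_pairing. Qed.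

Lemma param_transition k l q : is_chart k -> is_chart l -> overlap k l q ->
  chart_param l (transition k l q) = chart_param k q.
Proof.
by move=> ck [_ _ pK _ _] /(overlapE _ _ ck)[kq lq]; rewrite transitionE pK.
Qed.

Lemma transition_overlap k l q : is_chart k -> is_chart l -> overlap k l q ->
  overlap l k (transition k l q).
Proof.
move=> ck cl kl; have E := param_transition ck cl kl.
move: kl => /(overlapE _ _ ck)[kq lq]; apply/(overlapE _ _ cl); rewrite E.
by split; [rewrite transitionE; exact: chart_imgP|case: (chart_param_dom ck kq)].
Qed.

Lemma transitionK k l q : is_chart k -> is_chart l -> overlap k l q ->
  transition l k (transition k l q) = q.
Proof.
move=> ck cl kl; rewrite transitionE param_transition//.
by move: kl => /(overlapE _ _ ck)[kq _]; case: (chart_param_dom ck kq).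
Qed.

Lemma smooth_trans_restr k l W : is_chart k -> is_chart l ->
  smooth_trans k l /\ smooth_trans l k ->
  smooth_trans (chart_restr k W) l /\ smooth_trans l (chart_restr k W).
Proof.
move=> ck cl [[s1 s2] [s3 s4]].
have sub1 : overlap (chart_restr k W) l `<=` overlap k l.
  by move=> q [p [[dp _] lp] <-]; exists p.
have sub2 : overlap l (chart_restr k W) `<=` overlap l k.
  by move=> q [p [dp [lp _]] <-]; exists p.
by split; split; [exact: smooth_sub sub1 _|exact: smooth_sub sub1 _|exact: smooth_sub sub2 _|
   exact: smooth_sub sub2 _].
Qed.

Variable S : oriented_surface R M.

Lemma local_coords_restr k W : local_coords S k -> open (chart_dom k `&` W) ->
  local_coords S (chart_restr k W).
Proof.
move=> [ck sk] oW; split; first exact: is_chart_restr.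
by move=> l Sl; apply: smooth_trans_restr => //; [exact: atlas_chart Sl|exact: sk].
Qed.

(** Near each point the coordinate expression factors through a chart of the atlas. *)
Lemma smooth_fun_param m (f : M -> 'rV[R]_m) k : smooth_fun S setT f -> local_coords S k ->
  smooth_on (chart_img k) (fun q => f (chart_param k q)).
Proof.
move=> sf [ck sk]; apply: smooth_local => q kq.
have [dq cq] := chart_param_dom ck kq.
have [a Sa aq] := atlas_cover S (chart_param k q).
have ca := atlas_chart Sa.
have [[s1 s2] _] := sk a Sa.
exists (overlap k a); first exact/overlapE.
have oa := overlap_open ck ca.
have oi : open (chart_coord a @` (chart_dom a `&` setT)).
  by apply: open_chart_image => //; rewrite setIT; case: ca.
have := smooth_comp oi oa _ (sf a Sa) s1 s2.
have H : forall q', overlap k a q' ->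
    (chart_coord a @` (chart_dom a `&` setT)) (trans1 k a q', trans2 k a q').
  move=> q' kaq; apply/chart_imageE => //; split=> //.
  by have /overlapE[] := transition_overlap ck ca kaq.
move=> /(_ H); apply: (smooth_eq oa) => q' kaq /=.
by rewrite -[(trans1 _ _ _, _)]/(transition k a q') param_transition.
Qed.

(** Near each point the transition map factors through a chart of the atlas. *)
Lemma smooth_transition k l : local_coords S k -> local_coords S l -> smooth_trans k l.
Proof.
move=> [ck sk] [cl sl].
have H q : overlap k l q -> exists a, [/\ open (overlap k a `&` overlap k l),
    overlap k a q, atlas S a & forall q', overlap k a q' -> overlap k l q' ->
      overlap a l (trans1 k a q', trans2 k a q') /\
      transition a l (trans1 k a q', trans2 k a q') = transition k l q'].
  move=> kl; have [a Sa aq] := atlas_cover S (chart_param k q).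
  have ca := atlas_chart Sa; exists a; split => //.
  - by apply: openI; exact: overlap_open.
  - by apply/overlapE => //; split => //; move: kl => /(overlapE _ _ ck)[].
  - move=> q' ka kl'; rewrite -[(trans1 _ _ _, _)]/(transition k a q').
    have E := param_transition ck ca ka; split.
      apply/(overlapE _ _ ca); rewrite E.
      have /(overlapE _ _ ca)[aq' _] := transition_overlap ck ca ka.
      by move: kl' => /(overlapE _ _ ck)[].
    by rewrite [LHS]transitionE E -transitionE.
have G (f : chart R M -> chart R M -> R * R -> R) :
    (f = @trans1 R M \/ f = @trans2 R M) -> smooth_on (overlap k l) (f k l).
  move=> ff; apply: smooth_local => q kl.
  have [a [oa ka Sa Ha]] := H q kl.
  exists (overlap k a `&` overlap k l) => //.
  have ca := atlas_chart Sa.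
  have [[s1 s2] _] := sk a Sa; have [_ [t1 t2]] := sl a Sa.
  have sf : smooth_on (overlap a l) (f a l) by case: ff => ->.
  have := smooth_comp_real (overlap_open ca cl) oa
    (fun q' Hq => (Ha q' Hq.1 Hq.2).1) sf
    (smooth_sub (@subIsetl _ _ _) s1) (smooth_sub (@subIsetl _ _ _) s2).
  apply: (smooth_eq oa) => q' [ka' kl'].
  have [_ E] := Ha q' ka' kl'.
  by case: ff => ->; [exact: (congr1 fst E)|exact: (congr1 snd E)].
by split; apply: G; [left|right].
Qed.

Section Jacobian.
Variables (k a l : chart R M).
Hypotheses (lk : local_coords S k) (la : local_coords S a) (ll : local_coords S l).

Let ck : is_chart k. Proof. by case: lk. Qed.
Let ca : is_chart a. Proof. by case: la. Qed.
Let cl : is_chart l. Proof. by case: ll. Qed.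

Lemma transition_comp q : overlap k a q -> overlap k l q ->
  overlap a l (transition k a q) /\ transition a l (transition k a q) = transition k l q.
Proof.
move=> ka kl; have E := param_transition ck ca ka; split.
  apply/(overlapE _ _ ca); rewrite E.
  have /(overlapE _ _ ca)[aq' _] := transition_overlap ck ca ka.
  by move: kl => /(overlapE _ _ ck)[].
by rewrite [LHS]transitionE E -transitionE.
Qed.

Lemma jacobian_comp q : overlap k a q -> overlap k l q ->
  Defs.jacobian k l q = Defs.jacobian k a q * Defs.jacobian a l (transition k a q).
Proof.
move=> ka kl; pose U := overlap k a `&` overlap k l.
have oU : open U by apply: openI; exact: overlap_open.
have Uq : U q by split.
have [s1 s2] := smooth_transition lk la; have [t1 t2] := smooth_transition la ll.
have s1' := smooth_sub (@subIsetl _ (overlap k a) (overlap k l)) s1.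
have s2' := smooth_sub (@subIsetl _ (overlap k a) (overlap k l)) s2.
have UO q' : U q' -> overlap a l (trans1 k a q', trans2 k a q').
  by move=> [? ?]; have [] := transition_comp (q := q').
have E1 q' : U q' -> trans1 a l (trans1 k a q', trans2 k a q') = trans1 k l q'.
  by move=> [ka' kl']; have [_ /(congr1 fst)] := transition_comp ka' kl'.
have E2 q' : U q' -> trans2 a l (trans1 k a q', trans2 k a q') = trans2 k l q'.
  by move=> [ka' kl']; have [_ /(congr1 snd)] := transition_comp ka' kl'.
have oal := overlap_open ca cl.
rewrite /Defs.jacobian -(eq_du oU E1 Uq) -(eq_dv oU E1 Uq) -(eq_du oU E2 Uq) -(eq_dv oU E2 Uq).
rewrite (du_comp_real oal UO t1 s1' s2' Uq) (du_comp_real oal UO t2 s1' s2' Uq).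
rewrite (dv_comp_real oal UO t1 s1' s2' Uq) (dv_comp_real oal UO t2 s1' s2' Uq).
rewrite -/(transition k a q); ring.
Qed.

End Jacobian.

Lemma jacobian_id k q : local_coords S k -> chart_img k q -> Defs.jacobian k k q = 1.
Proof.
move=> [ck _] kq; have oI : open (chart_img k) by case: ck.
have E q' : chart_img k q' -> transition k k q' = q'.
  by move=> kq'; rewrite transitionE; case: (chart_param_dom ck kq').
have E1 q' : chart_img k q' -> trans1 k k q' = q'.1 by move=> /E /(congr1 fst).
have E2 q' : chart_img k q' -> trans2 k k q' = q'.2 by move=> /E /(congr1 snd).
rewrite /Defs.jacobian (eq_du oI E1 kq) (eq_dv oI E1 kq) (eq_du oI E2 kq) (eq_dv oI E2 kq).
rewrite -![du _ _]/(pd true _ _) -![dv _ _]/(pd false _ _) !pd_fst !pd_snd.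
by rewrite mulr1 mulr0 subr0.
Qed.

Lemma overlap_self k q : is_chart k -> chart_img k q -> overlap k k q.
Proof. by move=> ck kq; apply/overlapE => //; case: (chart_param_dom ck kq). Qed.

Lemma jacobian_inv k l q : local_coords S k -> local_coords S l -> overlap k l q ->
  Defs.jacobian k l q * Defs.jacobian l k (transition k l q) = 1.
Proof.
move=> lk ll kl; have [ck _] := lk.
have kq : chart_img k q by have /overlapE[] := kl.
by rewrite -(jacobian_comp lk ll lk kl (overlap_self ck kq)) (jacobian_id lk).
Qed.

Lemma jacobian_neq0 k l q : local_coords S k -> local_coords S l -> overlap k l q ->
  Defs.jacobian k l q != 0.
Proof.
move=> lk ll kl; apply/eqP => j0; have := jacobian_inv lk ll kl.
by rewrite j0 mul0r => /esym/eqP; rewrite oner_eq0.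
Qed.

(** The Jacobian is multiplicative, and both factors through a chart of the atlas are
    positive. *)
Lemma jacobian_gt0 k l q : positive_coords S k -> positive_coords S l -> overlap k l q ->
  0 < Defs.jacobian k l q.
Proof.
move=> [lk pk] [ll pl] kl; have [ck sk] := lk; have [cl sl] := ll.
have /(overlapE _ _ ck)[kq lq] := kl.
have [a Sa aq] := atlas_cover S (chart_param k q).
have ca := atlas_chart Sa.
have la : local_coords S a.
  by split=> // b Sb; split; [case: (atlas_compat Sa Sb)|case: (atlas_compat Sb Sa)].
have ka : overlap k a q by exact/overlapE.
have [al E] := transition_comp lk la ka kl.
rewrite (jacobian_comp lk la ll ka kl) mulr_gt0//; first by case: (pk a Sa) => _; apply.
have la' := transition_overlap ca cl al.
have := jacobian_inv la ll al; have [_ /(_ _ la') J] := pl a Sa.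
by move=> H; rewrite -(pmulr_lgt0 _ J) H ltr01.
Qed.

(** The lifts span the same line, so they are proportional; the factor is the quotient of
    two coordinates, the one of [Z] being chosen nonzero at the given point. *)
Lemma lift_change m (A : 'M[R]_m) (y : M -> 'M[R]_m) k l Y Z q0 :
  local_coords S k -> local_coords S l -> is_lift A y k Y -> is_lift A y l Z ->
  overlap k l q0 ->
  exists (P : set (R * R)) (rho : R * R -> R), [/\ open P, P q0, P `<=` overlap k l,
    smooth_on P rho & forall q, P q -> rho q != 0 /\ Y q = rho q *: Z (transition k l q)].
Proof.
move=> lk ll [sY hY] [sZ hZ] kl; have [ck _] := lk; have [cl _] := ll.
have ov q : overlap k l q -> chart_img k q /\ chart_img l (transition k l q).
  move=> kl'; have /overlapE[] := kl' => // kq _; split => //.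
  by have /overlapE[] := transition_overlap ck cl kl'.
have Z0 : Z (transition k l q0) != 0 by have [] := hZ _ (ov _ kl).2.
have [j Zj] : exists j, Z (transition k l q0) 0 j != 0.
  apply/existsP; apply: contraNT Z0; rewrite negb_exists => /forallP H.
  by apply/eqP/rowP => j; rewrite mxE; apply/eqP; move: (H j); rewrite negbK.
have [s1 s2] := smooth_transition lk ll.
have okl := overlap_open ck cl.
have oIl : open (chart_img l) by case: cl.
pose g q := Z (transition k l q) 0 j.
have sg : smooth_on (overlap k l) g.
  apply: (smooth_coord okl).
  exact: (smooth_comp oIl okl (fun q h => (ov q h).2) sZ s1 s2).
pose P := [set q | overlap k l q /\ g q != 0].
have oP : open P.
  rewrite openE => q [klq gq]; rewrite /interior.
  have cg := smooth_continuous sg klq.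
  have n1 : nbhs q (overlap k l) by exact: open_nbhs_nbhs.
  have n2 : nbhs q (g @^-1` [set x | x != 0]).
    by apply: cg; apply: open_nbhs_nbhs; split => //; exact: open_neq.
  by apply: filterS (filterI n1 n2).
have PO : P `<=` overlap k l by move=> q [].
exists P, (fun q => Y q 0 j / g q); split => //.
- apply: (smooth_div oP).
  + by move=> q [].
  + apply: (smooth_coord oP); apply: smooth_sub sY => q /PO; exact: (fun h => (ov _ h).1).
  + exact: smooth_sub PO sg.
- move=> q [klq gq]; have [kq lq] := ov _ klq.
  have [Yn _ Ey] := hY _ kq; have [_ _ Ez] := hZ _ lq.
  rewrite param_transition// -Ey in Ez.
  have : (Y q <= Z (transition k l q))%MS by rewrite -genmxE -Ez genmxE.
  move=> /sub_rVP[a Ea].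
  have -> : Y q 0 j / g q = a by rewrite Ea mxE /g mulfK.
  split => //; apply: contraNneq Yn => a0; by rewrite Ea a0 scale0r.
Qed.

End ChartTheory.

(** * Null lifts and polar transforms on an open subset of the plane *)

Section LocalGeometry.
Context {R : realType} {m : nat} (A : 'M[R]_m) (O : set (R * R)).
Hypotheses (sA : A^T = A) (oO : open O).
Implicit Types (q : R * R).

Lemma dot_const_du (F G : R * R -> 'rV[R]_m) (c : R) q :
  smooth_on O F -> smooth_on O G -> (forall q, O q -> ip A (F q) (G q) = c) -> O q ->
  ip A (pu F q) (G q) = - ip A (F q) (pu G q).
Proof.
move=> sF sG H Oq; apply/eqP; rewrite -addr_eq0 -(pu_ip oO A sF sG Oq).
rewrite (eq_pu oO (G := fun=> c) H Oq); apply/eqP; exact: pu_cst.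
Qed.

Lemma dot_const_dv (F G : R * R -> 'rV[R]_m) (c : R) q :
  smooth_on O F -> smooth_on O G -> (forall q, O q -> ip A (F q) (G q) = c) -> O q ->
  ip A (pv F q) (G q) = - ip A (F q) (pv G q).
Proof.
move=> sF sG H Oq; apply/eqP; rewrite -addr_eq0 -(pv_ip oO A sF sG Oq).
rewrite (eq_pv oO (G := fun=> c) H Oq); apply/eqP; exact: pv_cst.
Qed.

(** The products of derivatives up to order two that do not depend on the normalisation
    of a lift in null coordinates. *)
Section NullLift.
Variable X : R * R -> 'rV[R]_m.
Hypotheses (sX : smooth_on O X)
  (X00 : forall q, O q -> ip A (X q) (X q) = 0)
  (Xuu : forall q, O q -> ip A (pu X q) (pu X q) = 0)
  (Xvv : forall q, O q -> ip A (pv X q) (pv X q) = 0).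

Let sXu := smooth_pu sX.
Let sXv := smooth_pv sX.

Lemma self_dot_du q : O q -> ip A (X q) (pu X q) = 0.
Proof.
move=> Oq; have := dot_const_du sX sX X00 Oq; rewrite (ipC _ _ sA) => E.
by move/eqP: E; rewrite -addr_eq0 -mulr2n mulrn_eq0 /= => /eqP.
Qed.

Lemma self_dot_dv q : O q -> ip A (X q) (pv X q) = 0.
Proof.
move=> Oq; have := dot_const_dv sX sX X00 Oq; rewrite (ipC _ _ sA) => E.
by move/eqP: E; rewrite -addr_eq0 -mulr2n mulrn_eq0 /= => /eqP.
Qed.

Lemma self_dot_duu q : O q -> ip A (X q) (pu (pu X) q) = 0.
Proof.
by move=> Oq; apply/eqP; rewrite -oppr_eq0 -(dot_const_du sX sXu self_dot_du Oq) Xuu.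
Qed.

Lemma self_dot_dvv q : O q -> ip A (X q) (pv (pv X) q) = 0.
Proof.
by move=> Oq; apply/eqP; rewrite -oppr_eq0 -(dot_const_dv sX sXv self_dot_dv Oq) Xvv.
Qed.

Lemma self_dot_duv q : O q -> ip A (X q) (pv (pu X) q) = - ip A (pu X q) (pv X q).
Proof.
move=> Oq; apply/eqP; rewrite -eqr_oppLR -(dot_const_dv sX sXu self_dot_du Oq).
by rewrite (ipC _ _ sA).
Qed.

Lemma du_dot_duv q : O q -> ip A (pu X q) (pv (pu X) q) = 0.
Proof.
move=> Oq; have := dot_const_dv sXu sXu Xuu Oq; rewrite (ipC _ _ sA) => E.
by move/eqP: E; rewrite -addr_eq0 -mulr2n mulrn_eq0 /= => /eqP.
Qed.

Lemma dv_dot_duv q : O q -> ip A (pv X q) (pv (pu X) q) = 0.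
Proof.
move=> Oq; have := dot_const_du sXv sXv Xvv Oq; rewrite (ipC _ _ sA) => E.
by move/eqP: E; rewrite (pvuC oO sX Oq) -addr_eq0 -mulr2n mulrn_eq0 /= => /eqP.
Qed.

Lemma du_dot_duu q : O q -> ip A (pu X q) (pu (pu X) q) = 0.
Proof.
move=> Oq; have := dot_const_du sXu sXu Xuu Oq; rewrite (ipC _ _ sA) => E.
by move/eqP: E; rewrite -addr_eq0 -mulr2n mulrn_eq0 /= => /eqP.
Qed.

Lemma dv_dot_dvv q : O q -> ip A (pv X q) (pv (pv X) q) = 0.
Proof.
move=> Oq; have := dot_const_dv sXv sXv Xvv Oq; rewrite (ipC _ _ sA) => E.
by move/eqP: E; rewrite -addr_eq0 -mulr2n mulrn_eq0 /= => /eqP.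
Qed.

Lemma duu_dot_dv q : O q ->
  ip A (pu (pu X) q) (pv X q) = pu (fun q => ip A (pu X q) (pv X q)) q.
Proof.
move=> Oq; rewrite (pu_ip oO A sXu sXv Oq) -(pvuC oO sX Oq) (du_dot_duv Oq).
exact/esym/addr0.
Qed.

Lemma dvv_dot_du q : O q ->
  ip A (pv (pv X) q) (pu X q) = pv (fun q => ip A (pu X q) (pv X q)) q.
Proof.
move=> Oq; rewrite (pv_ip oO A sXu sXv Oq) (ipC _ (pv X q) sA) (dv_dot_duv Oq) add0r.
exact: ipC.
Qed.

End NullLift.

(** ** The conformal invariant metric in terms of an arbitrary lift

    With Z = rho X and <Z_u,Z_v> = s/2, the factor is determined up to sign by
    rho^2 <X_u,X_v> = s/2, and the terms with rho_uu and rho_vv drop out. *)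
Lemma metric_of_lift (X Z : R * R -> 'rV[R]_m) (rho : R * R -> R) (s : R) :
  smooth_on O X -> smooth_on O Z -> smooth_on O rho -> s ^+ 2 = 1 ->
  (forall q, O q -> Z q = rho q *: X q) ->
  (forall q, O q -> ip A (X q) (X q) = 0) ->
  (forall q, O q -> ip A (pu X q) (pu X q) = 0) ->
  (forall q, O q -> ip A (pv X q) (pv X q) = 0) ->
  (forall q, O q -> ip A (pu Z q) (pv Z q) = s / 2) ->
  let b q := ip A (pu X q) (pv X q) in
  forall q, O q -> s * ip A (pu (pu Z) q) (pv (pv Z) q) =
    (ip A (pu (pu X) q) (pv (pv X) q) - pu b q * pv b q / b q) / (2 * b q).
Proof.
move=> sX sZ sr s2 ZX X00 Xuu Xvv Zuv b.
have sXu := smooth_pu sX; have sXv := smooth_pv sX.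
have sru := smooth_pu sr; have srv := smooth_pv sr.
have Zu q : O q -> pu Z q = pu rho q *: X q + rho q *: pu X q.
  by move=> Oq; rewrite (eq_pu oO ZX Oq) (puZ oO sr sX Oq).
have Zv q : O q -> pv Z q = pv rho q *: X q + rho q *: pv X q.
  by move=> Oq; rewrite (eq_pv oO ZX Oq) (pvZ oO sr sX Oq).
have Zuu q : O q -> pu (pu Z) q = pu (pu rho) q *: X q + pu rho q *: pu X q +
    (pu rho q *: pu X q + rho q *: pu (pu X) q).
  move=> Oq; rewrite (eq_pu oO Zu Oq).
  rewrite (puD (smoothZ oO sru sX) (smoothZ oO sr sXu) Oq).
  by rewrite (puZ oO sru sX Oq) (puZ oO sr sXu Oq).
have Zvv q : O q -> pv (pv Z) q = pv (pv rho) q *: X q + pv rho q *: pv X q +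
    (pv rho q *: pv X q + rho q *: pv (pv X) q).
  move=> Oq; rewrite (eq_pv oO Zv Oq).
  rewrite (pvD (smoothZ oO srv sX) (smoothZ oO sr sXv) Oq).
  by rewrite (pvZ oO srv sX Oq) (pvZ oO sr sXv Oq).
have sb : smooth_on O b by exact: smooth_ip.
have r2b q : O q -> rho q * rho q * b q = s / 2.
  move=> Oq; rewrite -(Zuv q Oq) (Zu q Oq) (Zv q Oq).
  have E1 := self_dot_dv sX X00 Oq; have E2 := self_dot_du sX X00 Oq.
  rewrite !ip_linE E1 (X00 q Oq) [ip A (pu X q) (X q)](ipC _ _ sA) E2 /b; ring.
have srr : smooth_on O (fun q => rho q * rho q) by exact: smoothM.
have ru q : O q -> 2 * pu rho q * rho q * b q + rho q * rho q * pu b q = 0.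
  move=> Oq; have := eq_pu oO r2b Oq; rewrite (puM srr sb Oq) (puM sr sr Oq).
  by rewrite (pu_cst (s / 2) q) => <-; ring.
have rv q : O q -> 2 * pv rho q * rho q * b q + rho q * rho q * pv b q = 0.
  move=> Oq; have := eq_pv oO r2b Oq; rewrite (pvM srr sb Oq) (pvM sr sr Oq).
  by rewrite (pv_cst (s / 2) q) => <-; ring.
move=> q Oq.
have b0 : b q != 0.
  apply/eqP => b0; have := r2b q Oq; rewrite b0 mulr0 => /esym/eqP.
  by rewrite mulf_eq0 invr_eq0 pnatr_eq0 orbF => /eqP sz; move: s2; rewrite sz expr0n => /esym/eqP; rewrite oner_eq0.
have r0 : rho q != 0.
  apply/eqP => r0; have := r2b q Oq; rewrite r0 !mul0r => /esym/eqP.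
  by rewrite mulf_eq0 invr_eq0 pnatr_eq0 orbF => /eqP sz; move: s2; rewrite sz expr0n => /esym/eqP; rewrite oner_eq0.
rewrite (Zuu q Oq) (Zvv q Oq) !ip_linE (X00 q Oq).
have E1 := self_dot_dv sX X00 Oq; have E2 := self_dot_du sX X00 Oq.
have E3 := self_dot_duu sX X00 Xuu Oq; have E4 := self_dot_dvv sX X00 Xvv Oq.
rewrite [ip A (pu X q) (X q)](ipC _ _ sA) [ip A (pu (pu X) q) (X q)](ipC _ _ sA).
rewrite E1 E2 E3 E4 [ip A (pu X q) (pv (pv X) q)](ipC _ _ sA).
rewrite (duu_dot_dv sX Xuu Oq) (dvv_dot_du sX Xvv Oq) -/b -/(b q).
have ruE : pu rho q = - rho q * pu b q / (2 * b q).
  apply: (mulfI (mulf_neq0 r0 b0)).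
  have := ru q Oq; set du_r := pu rho q; set du_b := pu b q => H.
  rewrite [RHS](_ : _ = - (rho q * rho q * du_b) / 2); last by field; exact: b0.
  have -> : rho q * rho q * du_b = - (2 * du_r * rho q * b q).
    by apply/eqP; rewrite -addr_eq0 addrC H.
  by field.
have rvE : pv rho q = - rho q * pv b q / (2 * b q).
  apply: (mulfI (mulf_neq0 r0 b0)).
  have := rv q Oq; set du_r := pv rho q; set du_b := pv b q => H.
  rewrite [RHS](_ : _ = - (rho q * rho q * du_b) / 2); last by field; exact: b0.
  have -> : rho q * rho q * du_b = - (2 * du_r * rho q * b q).
    by apply/eqP; rewrite -addr_eq0 addrC H.
  by field.
rewrite ruE rvE.
set T := ip A _ _; set bu := pu b q; set bv := pv b q.
have -> : s = 2 * (rho q * rho q * b q).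
  by rewrite (r2b q Oq); field.
have R2 : rho q * rho q * b q * (rho q * rho q) = (b q)^-1 / 4.
  have H := r2b q Oq; apply: (mulIf b0).
  transitivity ((rho q * rho q * b q) ^+ 2); first by ring.
  by rewrite H expr_div_n s2; field.
transitivity (rho q * rho q * b q * (rho q * rho q) * (2 * (T - bu * bv / b q))).
  by field.
by rewrite R2; field.
Qed.

(** ** Polar transforms in null coordinates

  Y is a lift with <Y_u,Y_v> = s/2, s = 1 or -1, and psi is a section of the conformal normal
  bundle whose derivatives are tangent to the span of Y, Y_u, Y_v, Y_uv. *)
Section Polar.
Variables (Y psi : R * R -> 'rV[R]_m) (s : R).
Hypotheses (s2 : s ^+ 2 = 1) (sY : smooth_on O Y) (sp : smooth_on O psi)
  (Y00 : forall q, O q -> ip A (Y q) (Y q) = 0)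
  (Yuu0 : forall q, O q -> ip A (pu Y q) (pu Y q) = 0)
  (Yvv0 : forall q, O q -> ip A (pv Y q) (pv Y q) = 0)
  (Yuv : forall q, O q -> ip A (pu Y q) (pv Y q) = s / 2).
Hypotheses (pY : forall q, O q -> ip A (psi q) (Y q) = 0)
  (pYu : forall q, O q -> ip A (psi q) (pu Y q) = 0)
  (pYv : forall q, O q -> ip A (psi q) (pv Y q) = 0)
  (pYuv : forall q, O q -> ip A (psi q) (pv (pu Y) q) = 0)
  (psiu_span : forall q, O q -> exists a b c d,
     pu psi q = a *: Y q + b *: pu Y q + c *: pv Y q + d *: pv (pu Y) q)
  (psiv_span : forall q, O q -> exists a b c d,
     pv psi q = a *: Y q + b *: pu Y q + c *: pv Y q + d *: pv (pu Y) q).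

Let sYu := smooth_pu sY.
Let sYv := smooth_pv sY.
Let spu := smooth_pu sp.

Definition hopf_pairing1 q := ip A (psi q) (pu (pu Y) q).
Definition hopf_pairing2 q := ip A (psi q) (pv (pv Y) q).
Local Notation f1 := hopf_pairing1.
Local Notation f2 := hopf_pairing2.

Let s0 : s != 0.
Proof. by apply/eqP => sz; move/eqP: s2; rewrite sz expr0n eq_sym oner_eq0. Qed.

Lemma smooth_hopf_pairing1 : smooth_on O f1.
Proof. exact: (smooth_ip oO A sp (smooth_pu sYu)). Qed.

Lemma smooth_hopf_pairing2 : smooth_on O f2.
Proof. exact: (smooth_ip oO A sp (smooth_pv sYv)). Qed.

Lemma lift_dot_duv q : O q -> ip A (Y q) (pv (pu Y) q) = - (s / 2).
Proof. by move=> Oq; rewrite (self_dot_duv sY Y00 Oq) (Yuv Oq). Qed.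

Lemma lift_duu_dv q : O q -> ip A (pu (pu Y) q) (pv Y q) = 0.
Proof. by move=> Oq; rewrite (duu_dot_dv sY Yuu0 Oq) (eq_pu oO Yuv Oq) pu_cst. Qed.

Lemma lift_dvv_du q : O q -> ip A (pv (pv Y) q) (pu Y q) = 0.
Proof. by move=> Oq; rewrite (dvv_dot_du sY Yvv0 Oq) (eq_pv oO Yuv Oq) pv_cst. Qed.

Lemma lift_duv_duv q : O q ->
  ip A (pv (pu Y) q) (pv (pu Y) q) = ip A (pu (pu Y) q) (pv (pv Y) q).
Proof.
move=> Oq; have sYuu := smooth_pu sYu; have sYuv := smooth_pv sYu.
have E1 := dot_const_dv sYuu sYv lift_duu_dv Oq.
have E2 := dot_const_du sYv sYuv (dv_dot_duv sY Yvv0) Oq.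
move: E1 E2; rewrite -(pvuC oO sY Oq) (pvuC oO sYu Oq).
rewrite [ip A (pv Y q) _](ipC _ _ sA) => E1 E2.
by rewrite E2 E1 opprK.
Qed.

Lemma polar_du_Y q : O q -> ip A (pu psi q) (Y q) = 0.
Proof. by move=> Oq; rewrite (dot_const_du sp sY pY Oq) (pYu Oq) oppr0. Qed.

Lemma polar_dv_Y q : O q -> ip A (pv psi q) (Y q) = 0.
Proof. by move=> Oq; rewrite (dot_const_dv sp sY pY Oq) (pYv Oq) oppr0. Qed.

(** The coefficient of [Y_uv] vanishes because [Y] is orthogonal to [w], and the others are
    read off from the products with [Y_uv], [Y_u] and [Y_v]. *)
Lemma polar_coef w q : O q -> ip A w (Y q) = 0 ->
  (exists a b c d, w = a *: Y q + b *: pu Y q + c *: pv Y q + d *: pv (pu Y) q) ->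
  w = (- (2 * s * ip A w (pv (pu Y) q))) *: Y q + (2 * s * ip A w (pv Y q)) *: pu Y q
    + (2 * s * ip A w (pu Y q)) *: pv Y q.
Proof.
move=> Oq wY [a [b [c [d E]]]].
have E1 := self_dot_du sY Y00 Oq; have E2 := self_dot_dv sY Y00 Oq.
have E3 := lift_dot_duv Oq; have E4 := du_dot_duv sY Yuu0 Oq.
have E5 := dv_dot_duv sY Yvv0 Oq.
have e1 := ipC (pu Y q) (Y q) sA; have e2 := ipC (pv Y q) (Y q) sA.
have e3 := ipC (pv (pu Y) q) (Y q) sA; have e4 := ipC (pv (pu Y) q) (pu Y q) sA.
have e5 := ipC (pv (pu Y) q) (pv Y q) sA; have e6 := ipC (pv Y q) (pu Y q) sA.
have d0 : d = 0.
  have := wY; rewrite E !ip_linE (Y00 Oq) e1 e2 e3 E1 E2 E3 => H.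
  have : d * s = 0.
    transitivity (- 2 * (a * 0 + b * 0 + c * 0 + d * - (s / 2))); first by field.
    by rewrite H mulr0.
  by move=> /eqP; rewrite mulf_eq0 (negbTE s0) orbF => /eqP.
rewrite d0 scale0r addr0 in E.
have W1 : ip A w (pv (pu Y) q) = - (a * s / 2).
  by rewrite E !ip_linE E3 E4 E5; ring.
have W2 : ip A w (pv Y q) = b * s / 2 by rewrite E !ip_linE E2 (Yuv Oq) (Yvv0 Oq); ring.
have W3 : ip A w (pu Y q) = c * s / 2 by rewrite E !ip_linE E1 (Yuu0 Oq) e6 (Yuv Oq); ring.
rewrite W1 W2 W3 {1}E; congr (_ *: _ + _ *: _ + _ *: _).
- by rewrite (_ : - _ = a * s ^+ 2); [rewrite s2 mulr1|field].
- by transitivity (b * s ^+ 2); [rewrite s2 mulr1|field].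
- by transitivity (c * s ^+ 2); [rewrite s2 mulr1|field].
Qed.

Lemma polar_dv_duu q : O q -> ip A (pv psi q) (pu (pu Y) q) = 0.
Proof.
move=> Oq; rewrite (polar_coef Oq (polar_dv_Y Oq) (psiv_span Oq)) !ip_linE.
rewrite (self_dot_duu sY Y00 Yuu0 Oq) (du_dot_duu sY Yuu0 Oq).
by rewrite (ipC (pv Y q) _ sA) (lift_duu_dv Oq) !mulr0 !addr0.
Qed.

Lemma polar_du_dvv q : O q -> ip A (pu psi q) (pv (pv Y) q) = 0.
Proof.
move=> Oq; rewrite (polar_coef Oq (polar_du_Y Oq) (psiu_span Oq)) !ip_linE.
rewrite (self_dot_dvv sY Y00 Yvv0 Oq) (dv_dot_dvv sY Yvv0 Oq).
by rewrite (ipC (pu Y q) _ sA) (lift_dvv_du Oq) !mulr0 !addr0.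
Qed.

Lemma polar_du_Yu q : O q -> ip A (pu psi q) (pu Y q) = - f1 q.
Proof. exact: (dot_const_du sp sYu pYu). Qed.

Lemma polar_dv_Yv q : O q -> ip A (pv psi q) (pv Y q) = - f2 q.
Proof. exact: (dot_const_dv sp sYv pYv). Qed.

(** The coefficient of [Y_u] vanishes: it is a multiple of <psi_u, Y_v> = - <psi, Y_uv>. *)
Lemma polar_du q : O q -> pu psi q = (2 * s * pv f1 q) *: Y q - (2 * s * f1 q) *: pv Y q.
Proof.
move=> Oq; rewrite (polar_coef Oq (polar_du_Y Oq) (psiu_span Oq)).
have sYuu := smooth_pu sYu; have sYuv := smooth_pv sYu.
have -> : ip A (pu psi q) (pv Y q) = 0.
  by rewrite (dot_const_du sp sYv pYv Oq) -(pvuC oO sY Oq) (pYuv Oq) oppr0.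
rewrite (polar_du_Yu Oq) (dot_const_du sp sYuv pYuv Oq) -(pvuC oO sYu Oq).
have -> : ip A (psi q) (pv (pu (pu Y)) q) = pv f1 q.
  by rewrite (pv_ip oO A sp sYuu Oq) (polar_dv_duu Oq) add0r.
by rewrite mulr0 scale0r addr0 mulrN opprK mulrN scaleNr.
Qed.

Lemma polar_dv q : O q -> pv psi q = (2 * s * pu f2 q) *: Y q - (2 * s * f2 q) *: pu Y q.
Proof.
move=> Oq; rewrite (polar_coef Oq (polar_dv_Y Oq) (psiv_span Oq)).
have sYvv := smooth_pv sYv; have sYuv := smooth_pv sYu.
have -> : ip A (pv psi q) (pu Y q) = 0.
  by rewrite (dot_const_dv sp sYu pYu Oq) (pYuv Oq) oppr0.
rewrite (polar_dv_Yv Oq) (dot_const_dv sp sYuv pYuv Oq).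
have -> : ip A (psi q) (pv (pv (pu Y)) q) = pu f2 q.
  rewrite (pu_ip oO A sp sYvv Oq) (polar_du_dvv Oq) add0r.
  rewrite -(pvuC oO sYv Oq); congr (ip A _ _).
  by apply: (eq_pv oO _ Oq) => q' Oq'; rewrite (pvuC oO sY Oq').
by rewrite mulr0 scale0r addr0 mulrN opprK mulrN scaleNr.
Qed.

Lemma polar_du_dv q : O q -> ip A (pu psi q) (pv psi q) = 2 * s * (f1 q * f2 q).
Proof.
move=> Oq; rewrite (polar_du Oq) (polar_dv Oq) !ip_linE (Y00 Oq) (self_dot_du sY Y00 Oq).
rewrite (ipC (pv Y q) _ sA) (self_dot_dv sY Y00 Oq) (ipC (pv Y q) _ sA) (Yuv Oq).
transitivity (s ^+ 2 * (2 * s * (f1 q * f2 q))); first by field.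
by rewrite s2 mul1r.
Qed.

Let sf1 := smooth_hopf_pairing1.
Let sf2 := smooth_hopf_pairing2.

Lemma pu_scal (a : R) f q : smooth_on O f -> O q -> pu (fun q => a * f q) q = a * pu f q.
Proof. by move=> sf Oq; rewrite (puM (smooth_cst O a) sf Oq) pu_cst mul0r add0r. Qed.

Lemma pv_scal (a : R) f q : smooth_on O f -> O q -> pv (fun q => a * f q) q = a * pv f q.
Proof. by move=> sf Oq; rewrite (pvM (smooth_cst O a) sf Oq) pv_cst mul0r add0r. Qed.

Lemma polar_duu q : O q -> pu (pu psi) q =
  (2 * s) *: (pu (pv f1) q *: Y q + pv f1 q *: pu Y q - pu f1 q *: pv Y q - f1 q *: pv (pu Y) q).
Proof.
move=> Oq; rewrite (eq_pu oO polar_du Oq).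
have t1 : smooth_on O (fun q => 2 * s * pv f1 q).
  exact: (smoothM oO (smooth_cst O (2 * s)) (smooth_pv sf1)).
have t2 : smooth_on O (fun q => 2 * s * f1 q) by exact: (smoothM oO (smooth_cst O (2 * s)) sf1).
rewrite (puBv (smoothZ oO t1 sY) (smoothZ oO t2 sYv) Oq) (puZ oO t1 sY Oq) (puZ oO t2 sYv Oq).
rewrite (pu_scal _ (smooth_pv sf1) Oq) (pu_scal _ sf1 Oq) -(pvuC oO sY Oq).
by rewrite !scalerDr !scalerN !scalerA opprD !addrA.
Qed.

Lemma polar_dvv q : O q -> pv (pv psi) q =
  (2 * s) *: (pv (pu f2) q *: Y q + pu f2 q *: pv Y q - pv f2 q *: pu Y q - f2 q *: pv (pu Y) q).
Proof.
move=> Oq; rewrite (eq_pv oO polar_dv Oq).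
have t1 : smooth_on O (fun q => 2 * s * pu f2 q).
  exact: (smoothM oO (smooth_cst O (2 * s)) (smooth_pu sf2)).
have t2 : smooth_on O (fun q => 2 * s * f2 q) by exact: (smoothM oO (smooth_cst O (2 * s)) sf2).
rewrite (pvBv (smoothZ oO t1 sY) (smoothZ oO t2 sYu) Oq) (pvZ oO t1 sY Oq) (pvZ oO t2 sYu Oq).
rewrite (pv_scal _ (smooth_pu sf2) Oq) (pv_scal _ sf2 Oq).
by rewrite !scalerDr !scalerN !scalerA opprD !addrA.
Qed.

Lemma polar_duv_Y q : O q -> ip A (Y q) (pv (pu psi) q) = 0.
Proof.
move=> Oq.
have H q' : O q' -> ip A (Y q') (pu psi q') = 0.
  by move=> Oq'; rewrite (ipC _ _ sA) (polar_du_Y Oq').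
apply/eqP; rewrite -oppr_eq0 -(dot_const_dv sY spu H Oq) (polar_du Oq) !ip_linE.
by rewrite (ipC _ (Y q) sA) (self_dot_dv sY Y00 Oq) (Yvv0 Oq) !mulr0 subr0.
Qed.

Lemma polar_duu_dvv q : O q -> let h q := f1 q * f2 q in
  ip A (pu (pu psi) q) (pv (pv psi) q) =
    2 * s * pv (pu h) q + 4 * h q * ip A (pu (pu Y) q) (pv (pv Y) q).
Proof.
move=> Oq h.
have hu q' : O q' -> pu h q' = pu f1 q' * f2 q' + f1 q' * pu f2 q'.
  by move=> Oq'; rewrite (puM sf1 sf2 Oq').
have huv : pv (pu h) q = pv (pu f1) q * f2 q + pu f1 q * pv f2 q + (pv f1 q * pu f2 q + f1 q * pv (pu f2) q).
  rewrite (eq_pv oO hu Oq).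
  rewrite (pvD (smoothM oO (smooth_pu sf1) sf2) (smoothM oO sf1 (smooth_pu sf2)) Oq).
  by rewrite (pvM (smooth_pu sf1) sf2 Oq) (pvM sf1 (smooth_pu sf2) Oq).
rewrite huv (pvuC_real oO sf1 Oq) (polar_duu Oq) (polar_dvv Oq) !ip_linE.
have E1 := self_dot_du sY Y00 Oq; have E2 := self_dot_dv sY Y00 Oq.
have E3 := lift_dot_duv Oq; have E4 := du_dot_duv sY Yuu0 Oq.
have E5 := dv_dot_duv sY Yvv0 Oq.
have e1 := ipC (pu Y q) (Y q) sA; have e2 := ipC (pv Y q) (Y q) sA.
have e3 := ipC (pv (pu Y) q) (Y q) sA; have e4 := ipC (pv (pu Y) q) (pu Y q) sA.
have e5 := ipC (pv (pu Y) q) (pv Y q) sA; have e6 := ipC (pv Y q) (pu Y q) sA.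
rewrite e1 e2 e3 e4 e5 e6 E1 E2 E3 E4 E5 (Y00 Oq) (Yuu0 Oq) (Yvv0 Oq) (Yuv Oq).
rewrite (lift_duv_duv Oq) /h.
set T := ip A _ _.
rewrite (_ : 2 * s * (2 * s * _) = s ^+ 2 * (2 * s * (pu (pv f1) q * f2 q + pu f1 q * pv f2 q +
  (pv f1 q * pu f2 q + f1 q * pv (pu f2) q)) + 4 * (f1 q * f2 q) * T)); last by field.
by rewrite s2 mul1r.
Qed.

(** As <psi_u, psi_v> = 2 s f1 f2, the formula for the metric of a lift that is not
    normalised turns [polar_duu_dvv] into the metric of [Y] plus half the mixed derivative
    of log |f1 f2|. *)
Lemma polar_metric q : (forall q, O q -> f1 q * f2 q != 0) -> O q ->
  let h q := f1 q * f2 q in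
  let b q := ip A (pu psi q) (pv psi q) in
  (ip A (pu (pu psi) q) (pv (pv psi) q) - pu b q * pv b q / b q) / (2 * b q) =
    s * ip A (pu (pu Y) q) (pv (pv Y) q)
    + (pv (pu h) q / h q - pu h q * pv h q / h q ^+ 2) / 2.
Proof.
move=> h0 Oq h b.
have bE q' : O q' -> b q' = 2 * s * h q' by exact: polar_du_dv.
have sh : smooth_on O h by exact: smoothM.
rewrite (eq_pu oO bE Oq) (eq_pv oO bE Oq) (bE q Oq) (pu_scal _ sh Oq) (pv_scal _ sh Oq).
rewrite (polar_duu_dvv Oq) -/h; have hq : h q != 0 by exact: h0.
set T := ip A _ _; set huv := pv _ q; set hu := pu h q; set hv := pv h q.
have -> : s * T = T / s.
  by apply: (mulIf s0); rewrite divfK// mulrAC -expr2 s2 mul1r.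
by rewrite -/(h q); field; rewrite s0 hq.
Qed.

End Polar.

End LocalGeometry.

(** * The conformal invariant metric *)

Section SignSets.
Context {R : realType}.
Implicit Types (O : set (R * R)) (g : R * R -> R) (q : R * R).

Lemma open_nonvanishing O g : open O -> smooth_on O g -> open [set q | O q /\ g q != 0].
Proof.
move=> oO sg; rewrite openE => q [Oq gq]; rewrite /interior.
have n1 : nbhs q O by exact: open_nbhs_nbhs.
have n2 : nbhs q (g @^-1` [set x | x != 0]).
  by apply: (smooth_continuous sg Oq); apply: open_nbhs_nbhs; split => //; exact: open_neq.
by apply: filterS (filterI n1 n2).
Qed.

(** The set is also that of the points where [g + s / 2] does not vanish. *)
Lemma open_sign_set O g (s : R) : open O -> smooth_on O g -> s ^+ 2 = 1 ->
  (forall q, O q -> `|g q| = 2^-1) -> open [set q | O q /\ g q = s / 2].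
Proof.
move=> oO sg s2 g1.
have -> : [set q | O q /\ g q = s / 2] = [set q | O q /\ g q + s / 2 != 0].
  apply/seteqP; split=> q /= [Oq].
    move=> ->; split => //; rewrite -mulrDl mulf_neq0 ?invr_eq0 ?pnatr_eq0//.
    by rewrite -mulr2n mulrn_eq0 /=; apply: contra_eq_neq s2 => ->; rewrite expr0n eq_sym oner_eq0.
  move=> gs; split => //; apply/eqP; rewrite -subr_eq0.
  have : (g q - s / 2) * (g q + s / 2) == 0.
    rewrite -subr_sqr subr_eq0 -real_normK ?num_real// g1// expr_div_n s2 mul1r.
    by rewrite exprVn.
  by rewrite mulf_eq0 (negbTE gs) orbF.
apply: open_nonvanishing => //; apply: smoothD => //; exact: smooth_cst.
Qed.

Lemma sign_cases (x : R) : `|x| = 2^-1 -> exists s, [/\ s ^+ 2 = 1, x = s / 2 & s = Num.sg x].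
Proof.
move=> x1; exists (Num.sg x); split => //; last by rewrite {1}[x]numEsg x1.
by rewrite sqr_sg -normr_eq0 x1 invr_eq0 pnatr_eq0.
Qed.

End SignSets.

(** The coefficient of the conformal invariant metric in terms of a lift [X] in null
    coordinates that need not satisfy |<X_u, X_v>| = 1/2, see [metric_of_lift]. *)
Definition lift_metric (R : realType) m (B : 'M[R]_m) (X : R * R -> 'rV[R]_m) (q : R * R) : R :=
  let b q := ip B (pu X q) (pv X q) in
  (ip B (pu (pu X) q) (pv (pv X) q) - pu b q * pv b q / b q) / (2 * b q).

Section Metric.
Context {R : realType} {M : topologicalType} (S : oriented_surface R M).
Context {m : nat} (B : 'M[R]_m) (z : M -> 'M[R]_m) (k : chart R M).
Hypotheses (sB : B^T = B) (ck : is_chart k).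
Implicit Types (X Z : R * R -> 'rV[R]_m) (q : R * R).

Let oI : open (chart_img k). Proof. by case: ck. Qed.

Definition conformal_lift X :=
  is_lift B z k X /\ forall q, chart_img k q ->
    [/\ ip B (pu X q) (pu X q) = 0, ip B (pv X q) (pv X q) = 0 & ip B (pu X q) (pv X q) != 0].

Lemma null_liftP Z : null_lift B z k Z <->
  is_lift B z k Z /\ forall q, chart_img k q ->
    [/\ ip B (pu Z q) (pu Z q) = 0, ip B (pv Z q) (pv Z q) = 0 &
        `|ip B (pu Z q) (pv Z q)| = 2^-1].
Proof.
by split=> -[lZ hZ]; split => // q kq; have := hZ q kq; rewrite -!puE -!pvE -!ipE.
Qed.

Lemma null_lift_conformal Z : null_lift B z k Z -> conformal_lift Z.
Proof.
move=> /null_liftP[lZ hZ]; split => // q kq; have [h1 h2 h3] := hZ q kq.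
split; [exact: h1|exact: h2|].
by rewrite -normr_eq0 h3 invr_eq0 pnatr_eq0.
Qed.

Lemma conformal_liftE X : conformal_lift X ->
  [/\ smooth_on (chart_img k) X, forall q, chart_img k q -> ip B (X q) (X q) = 0,
      forall q, chart_img k q -> ip B (pu X q) (pu X q) = 0,
      forall q, chart_img k q -> ip B (pv X q) (pv X q) = 0 &
      forall q, chart_img k q -> ip B (pu X q) (pv X q) != 0].
Proof.
move=> [[sX hX] cX]; split => // q kq; rewrite -?ipE; first by case: (hX q kq).
all: by have := cX q kq; rewrite ipE => -[].
Qed.

Lemma null_lift_local Z q : null_lift B z k Z -> chart_img k q ->
  exists (s : R) (P : set (R * R)), [/\ s ^+ 2 = 1, s = Num.sg (ip B (pu Z q) (pv Z q)),
    open P /\ P q, P `<=` chart_img k &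
    forall q', P q' -> ip B (pu Z q') (pv Z q') = s / 2].
Proof.
move=> nl kq; have [sZ _ _ _ _] := conformal_liftE (null_lift_conformal nl).
have /null_liftP[_ h] := nl; have [_ _ hq] := h q kq.
have [s [s2 E sE]] := sign_cases hq.
exists s, [set q | chart_img k q /\ ip B (pu Z q) (pv Z q) = s / 2]; split => //.
- split => //.
  apply: (open_sign_set oI (smooth_ip oI B (smooth_pu sZ) (smooth_pv sZ)) s2).
  by move=> q' /h[].
- by move=> q' [].
- by move=> q' [].
Qed.

Lemma hopf_dot (F : frame R m) q : null_lift B z k (frame_lift F) -> hopf_schwarz B k F ->
  chart_img k q -> dot B (hopf1 F q) (hopf2 F q) =
    ip B (pu (pu (frame_lift F)) q) (pv (pv (frame_lift F)) q).
Proof.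
move=> nl hs kq; have [sZ Z00 Zu0 Zv0 _] := conformal_liftE (null_lift_conformal nl).
have [_ _] := hs q kq; rewrite !puE !pvE.
set Z := frame_lift F in sZ Z00 Zu0 Zv0 * => e1 e2; rewrite ipE.
have -> : hopf1 F q = pu (pu Z) q + (schw1 F q / 2) *: Z q.
  by rewrite e1 scaleNr addrAC addNr add0r.
have -> : hopf2 F q = pv (pv Z) q + (schw2 F q / 2) *: Z q.
  by rewrite e2 scaleNr addrAC addNr add0r.
rewrite !ip_linE (ipC (pu (pu Z) q) (Z q) sB) (self_dot_duu sB oI sZ Z00 Zu0 kq).
by rewrite (self_dot_dvv sB oI sZ Z00 Zv0 kq) (Z00 q kq) !(mulr0, addr0).
Qed.

(** [Z_uu] and [Z_vv] are already orthogonal to [Z], [Z_u] and [Z_v]; a multiple of [Z] makes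
    them orthogonal to [Z_uv] as well, which determines the Schwarzians. *)
Lemma hopf_schwarz_exists Z : null_lift B z k Z ->
  exists F, frame_lift F = Z /\ hopf_schwarz B k F.
Proof.
move=> nl; have [sZ Z00 Zu0 Zv0 b0] := conformal_liftE (null_lift_conformal nl).
pose c1 q := - ip B (pu (pu Z) q) (pv (pu Z) q) / ip B (pu Z q) (pv Z q).
pose c2 q := - ip B (pv (pv Z) q) (pv (pu Z) q) / ip B (pu Z q) (pv Z q).
exists (Frame Z (fun q => - (2 * c1 q)) (fun q => - (2 * c2 q))
  (fun q => pu (pu Z) q - c1 q *: Z q) (fun q => pv (pv Z) q - c2 q *: Z q)).
split=> // q kq.
have [s [P [s2 _ [oP Pq] PI Puv]]] := null_lift_local nl kq.
have sZP := smooth_sub PI sZ.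
have Z00P q' (Pq' : P q') := Z00 q' (PI q' Pq').
have Zu0P q' (Pq' : P q') := Zu0 q' (PI q' Pq').
have Zv0P q' (Pq' : P q') := Zv0 q' (PI q' Pq').
have E1 := self_dot_du sB oP sZP Z00P Pq; have E2 := self_dot_dv sB oP sZP Z00P Pq.
have E3 := self_dot_duv sB oP sZP Z00P Pq.
have E4 := self_dot_duu sB oP sZP Z00P Zu0P Pq; have E5 := self_dot_dvv sB oP sZP Z00P Zv0P Pq.
have E6 := du_dot_duu sB oP sZP Zu0P Pq; have E7 := dv_dot_dvv sB oP sZP Zv0P Pq.
have E8 := lift_duu_dv sB oP sZP Zu0P Puv Pq; have E9 := lift_dvv_du sB oP sZP Zv0P Puv Pq.
have bq := b0 q kq.
have h2 (c : R) : - (- (2 * c) / 2) = c by field.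
rewrite /= !puE !pvE !h2; split.
- apply/conf_normalP; rewrite !puE !pvE !ipE !ip_linE.
  rewrite !(ipC (pu (pu Z) q) _ sB) E3 E4 (Z00 q kq) E1 E2 E6 -(ipC (pu (pu Z) q) _ sB) E8.
  split; [by ring|by ring|by ring|].
  by rewrite /c1 -(ipC (pu (pu Z) q) _ sB); field.
- apply/conf_normalP; rewrite !puE !pvE !ipE !ip_linE.
  rewrite !(ipC (pv (pv Z) q) _ sB) E3 E5 (Z00 q kq) E1 E2 E7 -(ipC (pv (pv Z) q) _ sB) E9.
  split; [by ring|by ring|by ring|].
  by rewrite /c2 -(ipC (pv (pv Z) q) _ sB); field.
- by rewrite addrC subrK.
- by rewrite addrC subrK.
Qed.

(** The lift [X] is normalised by the smooth factor (2 |<X_u, X_v>|)^(-1/2). *)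
Lemma conf_metric_exists X G : conformal_lift X ->
  (forall q, chart_img k q -> G q = lift_metric B X q) -> conf_metric B z k G.
Proof.
move=> cX hG; have [sX X00 Xu0 Xv0 b0] := conformal_liftE cX.
pose b q := ip B (pu X q) (pv X q).
have sb : smooth_on (chart_img k) b by exact: (smooth_ip oI B (smooth_pu sX) (smooth_pv sX)).
pose rho q := (Num.sqrt (2 * Num.sqrt (b q * b q)))^-1.
have bb q : chart_img k q -> 0 < b q * b q.
  by move=> kq; rewrite -expr2 lt_neqAle sqr_ge0 eq_sym sqrf_eq0 b0.
have sbb q : chart_img k q -> 0 < 2 * Num.sqrt (b q * b q).
  by move=> kq; rewrite mulr_gt0// sqrtr_gt0 bb.
have rho0 q : chart_img k q -> rho q != 0.
  by move=> kq; rewrite invr_eq0 gt_eqF// sqrtr_gt0 sbb.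
have sr : smooth_on (chart_img k) rho.
  apply: (smoothV oI); first by move=> q kq; rewrite gt_eqF// sqrtr_gt0 sbb.
  apply: (smooth_sqrt oI) => //.
  apply: (smoothM oI (smooth_cst _ (2 : R))).
  by apply: (smooth_sqrt oI bb); exact: smoothM.
have rr q : chart_img k q -> rho q * rho q * b q = Num.sg (b q) / 2.
  move=> kq; rewrite -invfM -expr2 sqr_sqrtr ?ltW ?sbb// -expr2 sqrtr_sqr.
  rewrite {2}[b q]numEsg; have n0 : `|b q| != 0 by rewrite normr_eq0 b0.
  by field.
pose Z q := rho q *: X q.
have sZ : smooth_on (chart_img k) Z by exact: smoothZ.
have Zu q : chart_img k q -> pu Z q = pu rho q *: X q + rho q *: pu X q.
  by move=> kq; rewrite (puZ oI sr sX kq).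
have Zv q : chart_img k q -> pv Z q = pv rho q *: X q + rho q *: pv X q.
  by move=> kq; rewrite (pvZ oI sr sX kq).
have nl : null_lift B z k Z.
  apply/null_liftP; split.
    split => // q kq; have [X0 Xn Xz] := cX.1.2 q kq; split.
    - by rewrite scaler_eq0 (negbTE (rho0 q kq)).
    - by rewrite dotZl dotZr Xn !mulr0.
    - rewrite -Xz; apply/genmxP; apply/eqmxP; exact: eqmx_scale (rho0 q kq).
  move=> q kq; have E1 := self_dot_du sB oI sX X00 kq; have E2 := self_dot_dv sB oI sX X00 kq.
  rewrite (Zu q kq) (Zv q kq) !ip_linE (X00 q kq) (ipC (pu X q) (X q) sB) (ipC (pv X q) (X q) sB).
  rewrite E1 E2 (Xu0 q kq) (Xv0 q kq); split; [by ring|by ring|].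
  rewrite (_ : _ + _ = rho q * rho q * b q); last by rewrite /b; ring.
  by rewrite (rr q kq) normrM normr_sg b0// mul1r ger0_norm// invr_ge0.
have [F [FZ hs]] := hopf_schwarz_exists nl; exists F; rewrite FZ; split => // q kq.
have nl' : null_lift B z k (frame_lift F) by rewrite FZ.
rewrite (hopf_dot nl' hs kq) FZ hG//.
have [s [P [s2 sE [oP Pq] PI Puv]]] := null_lift_local nl kq.
rewrite puE pvE ipE -sE.
rewrite (metric_of_lift sB oP (smooth_sub PI sX) (smooth_sub PI sZ) (smooth_sub PI sr) s2 _ _ _ _ Puv Pq) //.
- by move=> q' /PI/X00.
- by move=> q' /PI/Xu0.
- by move=> q' /PI/Xv0.
Qed.

(** The lift of the frame and [X] are proportional by [lift_change], and near each point
    the sign of <Z_u, Z_v> is constant, so that [metric_of_lift] applies. *)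
Lemma conf_metric_unique X G : local_coords S k -> conformal_lift X -> conf_metric B z k G ->
  forall q, chart_img k q -> G q = lift_metric B X q.
Proof.
move=> lk cX [F [nl hs hG]] q kq; rewrite hG//.
rewrite (hopf_dot nl hs kq) puE pvE ipE.
have [sX X00 Xu0 Xv0 b0] := conformal_liftE cX.
have [sZ _ _ _ _] := conformal_liftE (null_lift_conformal nl).
have [s [P [s2 sE [oP Pq] PI Puv]]] := null_lift_local nl kq; rewrite -sE.
have kk := overlap_self ck kq.
have [W [rho [oW Wq WO sr hr]]] := lift_change lk lk nl.1 cX.1 kk.
have oPW : open (P `&` W) by exact: openI.
have tk q' : chart_img k q' -> transition k k q' = q'.
  by move=> kq'; rewrite transitionE; case: (chart_param_dom ck kq').
have PWI : P `&` W `<=` chart_img k by move=> q' [/PI].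
rewrite (metric_of_lift sB oPW (smooth_sub PWI sX) (smooth_sub PWI sZ)
  (smooth_sub (@subIsetr _ P W) sr) s2 _ _ _ _ _ (conj Pq Wq)) //.
- by move=> q' [Pq' Wq']; have [_ ->] := hr q' Wq'; rewrite (tk q' (PI q' Pq')).
- by move=> q' /PWI/X00.
- by move=> q' /PWI/Xu0.
- by move=> q' /PWI/Xv0.
- by move=> q' [Pq' _]; exact: Puv.
Qed.

End Metric.

(** * Null coordinates of either sign *)

Section Flip.
Context {R : realType} {M : topologicalType} (S : oriented_surface R M).
Implicit Types (k l : chart R M) (q : R * R).

Definition flip q : R * R := (q.1, - q.2).

(** Polar transforms are defined by conditions on canonical lifts only; a lift with
    <Y_u, Y_v> = - 1/2 becomes canonical in these coordinates. *)
Definition flip_chart k : chart R M :=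
  Chart (chart_dom k) (fun p => flip (chart_coord k p)) (fun q => chart_param k (flip q)).

Lemma flipK q : flip (flip q) = q.
Proof. by case: q => a b; rewrite /flip /= opprK. Qed.

Lemma chart_img_flip k q : chart_img (flip_chart k) q <-> chart_img k (flip q).
Proof.
split; first by move=> [p dp <-] /=; rewrite flipK; exists p.
by move=> [p dp E]; exists p => //=; rewrite E flipK.
Qed.

Lemma flip_continuous q : {for q, continuous flip}.
Proof.
have c1 : {for q, continuous (fun q : R * R => q.1)} by exact: cvg_fst.
have c2 : {for q, continuous (fun q : R * R => - q.2)}.
  by apply: continuousN; exact: continuous_snd_at.
exact: (cvg_pair c1 c2).
Qed.

Lemma open_flip (O : set (R * R)) : open O -> open (flip @^-1` O).
Proof.
by move=> oO; apply: open_comp => // q _; exact: flip_continuous.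
Qed.

Lemma is_chart_flip k : is_chart k -> is_chart (flip_chart k).
Proof.
move=> [oD oI pK cc cp]; split => //=.
- rewrite (_ : chart_img _ = flip @^-1` chart_img k); first exact: open_flip.
  by apply/seteqP; split=> q; [move/chart_img_flip|move=> H; apply/chart_img_flip].
- by move=> p dp; rewrite flipK pK.
- move=> p dp; apply: (@continuous_comp _ _ _ (chart_coord k) flip); first exact: cc.
  exact: flip_continuous.
- move=> q /chart_img_flip kq; apply: (@continuous_comp _ _ _ flip (chart_param k)).
    exact: flip_continuous.
  exact: cp.
Qed.

Lemma smooth_flip1 (U : set (R * R)) : open U -> smooth_on U (fun q => q.1).
Proof. by move=> oU; exact: smooth_fst. Qed.

Lemma smooth_flip2 (U : set (R * R)) : open U -> smooth_on U (fun q => - q.2).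
Proof. by move=> oU; apply: (smoothN oU); exact: smooth_snd. Qed.

Lemma pu_flip m (U : set (R * R)) (F : R * R -> 'rV[R]_m) q : open U -> smooth_on U F ->
  U (flip q) -> pu (fun q => F (flip q)) q = pu F (flip q).
Proof.
move=> oU sF Uq; have oV := open_flip oU.
rewrite (pu_compv oU oV (fun q H => H) sF (smooth_flip1 oV) (smooth_flip2 oV) Uq).
rewrite (puN (smooth_snd oV) Uq) -!puE -![du _ _]/(pd true _ _) pd_fst pd_snd.
by rewrite oppr0 scale0r addr0 scale1r.
Qed.

Lemma pv_flip m (U : set (R * R)) (F : R * R -> 'rV[R]_m) q : open U -> smooth_on U F ->
  U (flip q) -> pv (fun q => F (flip q)) q = - pv F (flip q).
Proof.
move=> oU sF Uq; have oV := open_flip oU.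
rewrite (pv_compv oU oV (fun q H => H) sF (smooth_flip1 oV) (smooth_flip2 oV) Uq).
rewrite (pvN (smooth_snd oV) Uq) -!pvE -![dv _ _]/(pd false _ _) pd_fst pd_snd.
by rewrite scale0r add0r scaleN1r.
Qed.

Lemma smooth_flip m (U : set (R * R)) (F : R * R -> 'rV[R]_m) : open U -> smooth_on U F ->
  smooth_on (flip @^-1` U) (fun q => F (flip q)).
Proof.
move=> oU sF; have oV := open_flip oU.
exact: (smooth_comp oU oV (fun q H => H) sF (smooth_flip1 oV) (smooth_flip2 oV)).
Qed.

Lemma smooth_flip_real (U : set (R * R)) (f : R * R -> R) : open U -> smooth_on U f ->
  smooth_on (flip @^-1` U) (fun q => f (flip q)).
Proof.
move=> oU sF; have oV := open_flip oU.
exact: (smooth_comp_real oU oV (fun q H => H) sF (smooth_flip1 oV) (smooth_flip2 oV)).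
Qed.

Lemma local_coords_flip k : local_coords S k -> local_coords S (flip_chart k).
Proof.
move=> [ck sk]; split; first exact: is_chart_flip.
move=> l Sl; have [[s1 s2] [s3 s4]] := sk l Sl; have cl := atlas_chart Sl.
have okl := overlap_open ck cl; have olk := overlap_open cl ck.
have E1 : overlap (flip_chart k) l = flip @^-1` overlap k l.
  apply/seteqP; split=> q; first by move=> [p dp <-]; exists p => //=; rewrite flipK.
  by move=> [p dp E]; exists p => //=; rewrite E flipK.
rewrite /smooth_trans E1; split; split.
- exact: (smooth_flip_real okl s1).
- exact: (smooth_flip_real okl s2).
- exact: s3.
- exact: (smoothN olk s4).
Qed.

End Flip.

Section PolarCharts.
Context {R : realType} {M : topologicalType} (S : oriented_surface R M).
Context {m : nat} (A : 'M[R]_m) (y : M -> 'M[R]_m) (c : R) (psi : M -> 'rV[R]_m).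
Hypotheses (sA : A^T = A) (uA : A \in unitmx).
Implicit Types (k : chart R M) (Y : R * R -> 'rV[R]_m) (q : R * R).

Lemma conf_span_nondegenerate k Y q : is_chart k -> null_lift A y k Y -> chart_img k q ->
  nondegenerate_on A (conf_span Y q).
Proof.
move=> ck nl kq u /conf_spanP us /conf_normalP; rewrite !puE !pvE !ipE => -[h1 h2 h3 h4].
have [s [P [s2 sE [oP Pq] PI Puv]]] := null_lift_local ck nl kq.
have [sY Y00 Yu0 Yv0 _] := conformal_liftE (null_lift_conformal nl).
have sYP := smooth_sub PI sY.
have Y00P q' (Pq' : P q') := Y00 q' (PI q' Pq').
have Yu0P q' (Pq' : P q') := Yu0 q' (PI q' Pq').
have Yv0P q' (Pq' : P q') := Yv0 q' (PI q' Pq').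
rewrite !puE !pvE in us.
rewrite (polar_coef sA oP s2 sYP Y00P Yu0P Yv0P Puv Pq h1 us) h2 h3 h4.
by rewrite !mulr0 oppr0 !scale0r !addr0.
Qed.

Hypothesis polar : polar_transform S A y c psi.

Lemma polar_canonical k Y q : local_coords S k -> canonical_lift A y k Y -> chart_img k q ->
  let X q := psi (chart_param k q) in
  [/\ (X q <= conf_normal A Y q)%MS, (du X q <= conf_span Y q)%MS & (dv X q <= conf_span Y q)%MS].
Proof.
move=> lk cY kq X; have [_ _ _ /(_ k Y lk cY q kq)[h1 h2 h3]] := polar.
have ck : is_chart k by case: lk.
have nd := conf_span_nondegenerate ck cY.1 kq.
by split => //; exact: (oproj0_sub uA nd).
Qed.

Lemma is_lift_restr k Y W : is_chart k -> is_lift A y k Y -> is_lift A y (chart_restr k W) Y.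
Proof.
move=> ck [sY hY]; have sub := @chart_img_restr _ _ k W ck.
by split; [exact: smooth_sub sub sY|move=> q /sub/hY].
Qed.

(** Where <Y_u, Y_v> = - 1/2 the flipped chart is canonical, and the span of Y, Y_u, Y_v,
    Y_uv is the same. *)
Lemma polar_null_lift k Y q : local_coords S k -> null_lift A y k Y -> chart_img k q ->
  let X q := psi (chart_param k q) in
  [/\ (X q <= conf_normal A Y q)%MS, (du X q <= conf_span Y q)%MS & (dv X q <= conf_span Y q)%MS].
Proof.
move=> lk nl kq X; have [ck sk] := lk.
have oI : open (chart_img k) by case: ck.
have [sY Y00 Yu0 Yv0 _] := conformal_liftE (null_lift_conformal nl).
have [s [P [s2 sE [oP Pq] PI Puv]]] := null_lift_local ck nl kq.
pose W := chart_param k @` P.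
have domW p : chart_dom k p -> (W p <-> P (chart_coord k p)).
  have [_ _ pK _ _] := ck.
  move=> dp; split=> [[q' Pq' E]|Pp].
    by rewrite -E (chart_param_dom ck (PI _ Pq')).2.
  by exists (chart_coord k p) => //; exact: pK.
have oW : open (chart_dom k `&` W).
  rewrite openE => p [dp Wp]; rewrite /interior; have [oD _ _ cc _] := ck.
  have n1 : nbhs p (chart_dom k) by exact: open_nbhs_nbhs.
  have n2 : nbhs p (chart_coord k @^-1` P).
    apply: (cc p dp); apply: open_nbhs_nbhs; split => //; exact/(domW p dp).
  by apply: filterS (filterI n1 n2) => p' [dp' Pp']; split => //; exact/domW.
have imgW q' : chart_img (chart_restr k W) q' <-> P q'.
  split; first by move=> [p [dp Wp] <-]; exact/domW.
  move=> Pq'; apply/(chart_imageE _ _ ck); split; first exact: PI.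
  by exists q'.
have lW := local_coords_restr lk oW.
have s1 : s = 1 \/ s = -1.
  have : (s - 1) * (s + 1) == 0 by rewrite -subr_sqr s2 expr1n subrr.
  by rewrite mulf_eq0 => /orP[]; rewrite ?subr_eq0 ?addr_eq0 => /eqP; [left|right].
case: s1 => s1.
  have cY : canonical_lift A y (chart_restr k W) Y.
    split; first by split; [exact: is_lift_restr nl.1|move=> q' /imgW/PI; exact: nl.2].
    by move=> q' /imgW Pq'; rewrite puE pvE ipE Puv// s1 mul1r.
  exact: (polar_canonical lW cY ((imgW q).2 Pq)).
have lF := local_coords_flip lW.
pose Y' q := Y (flip q); pose k' := flip_chart (chart_restr k W).
have sX : smooth_on (chart_img k) X by case: polar => sp _ _ _; exact: smooth_fun_param sp lk.
have sYP := smooth_sub PI sY; have sXP := smooth_sub PI sX.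
have img' q' : chart_img k' q' <-> P (flip q').
  by split=> [/chart_img_flip/imgW|Pq']; last exact/chart_img_flip/imgW.
have oP' := open_flip oP.
have Y'u q' : P (flip q') -> pu Y' q' = pu Y (flip q') by exact: pu_flip oP sYP.
have Y'v q' : P (flip q') -> pv Y' q' = - pv Y (flip q') by exact: pv_flip oP sYP.
have Y'uv q' : P (flip q') -> pv (pu Y') q' = - pv (pu Y) (flip q').
  move=> Pq'; rewrite (eq_pv oP' Y'u Pq').
  exact: (pv_flip oP (smooth_pu sYP) Pq').
have cY : canonical_lift A y k' Y'.
  split; last first.
    move=> q' /img' Pq'; rewrite puE pvE ipE Y'u// Y'v// !ip_linE (Puv _ Pq') s1.
    by rewrite mulN1r opprK.
  apply/null_liftP; split; last first.
    move=> q' /img' Pq'; rewrite (Y'u q' Pq') (Y'v q' Pq') !ip_linE.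
    rewrite (Yu0 _ (PI _ Pq')) (Yv0 _ (PI _ Pq')) !oppr0 (Puv _ Pq') s1.
    by split; [reflexivity|reflexivity|rewrite mulN1r opprK ger0_norm// invr_ge0].
  split.
    rewrite (_ : chart_img k' = flip @^-1` P); last first.
      by apply/seteqP; split=> q' /img'.
    exact: (smooth_flip oP sYP).
  by move=> q' /img' Pq'; exact: (nl.1.2 _ (PI _ Pq')).
have Pfq : P (flip (flip q)) by rewrite flipK.
have [h1 h2 h3] := polar_canonical lF cY ((img' _).2 Pfq).
rewrite /= in h1 h2 h3.
have X'u : pu (fun q => X (flip q)) (flip q) = pu X q.
  by rewrite (pu_flip oP sXP Pfq) flipK.
have X'v : pv (fun q => X (flip q)) (flip q) = - pv X q.
  by rewrite (pv_flip oP sXP Pfq) flipK.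
rewrite !puE !pvE in h2 h3 *; rewrite X'u in h2; rewrite X'v in h3.
have spanE (x : 'rV[R]_m) : (x <= conf_span Y' (flip q))%MS -> (x <= conf_span Y q)%MS.
  move=> /conf_spanP[a [b [cc [d ->]]]]; apply/conf_spanP.
  rewrite !puE !pvE (Y'u _ Pfq) (Y'v _ Pfq) (Y'uv _ Pfq) /Y' !flipK.
  by exists a, b, (- cc), (- d); rewrite !scalerN !scaleNr.
split.
- apply/conf_normalP; move/conf_normalP: h1.
  rewrite !puE !pvE (Y'u _ Pfq) (Y'v _ Pfq) (Y'uv _ Pfq) /Y' !flipK !ipE !ip_linE.
  by move=> [-> -> /eqP + /eqP]; rewrite !oppr_eq0 => /eqP -> /eqP ->.
- exact: spanE.
- by rewrite -(eqmx_opp (pv X q)); exact: spanE.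
Qed.

End PolarCharts.

(** * Polar transforms in null coordinates of a surface *)

Section PolarPointwise.
Context {R : realType} {M : topologicalType} (S : oriented_surface R M).
Context {m : nat} (A : 'M[R]_m) (y : M -> 'M[R]_m) (c : R) (psi : M -> 'rV[R]_m).
Hypotheses (sA : A^T = A) (uA : A \in unitmx) (polar : polar_transform S A y c psi).
Variables (k : chart R M) (Y : R * R -> 'rV[R]_m).
Hypotheses (lk : local_coords S k) (nl : null_lift A y k Y).
Implicit Types (q : R * R).

Let X q := psi (chart_param k q).
Let sigma q := Num.sg (ip A (pu Y q) (pv Y q)).
Local Notation f1 := (hopf_pairing1 A Y X).
Local Notation f2 := (hopf_pairing2 A Y X).
Local Notation U := (chart_img k).

Let ck : is_chart k. Proof. by case: lk. Qed.
Let oI : open U. Proof. by case: ck. Qed.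

Lemma smooth_polar : smooth_on U X.
Proof. by case: polar => sp _ _ _; exact: smooth_fun_param sp lk. Qed.

Lemma smooth_pairings : smooth_on U f1 /\ smooth_on U f2.
Proof.
have [sY _ _ _ _] := conformal_liftE (null_lift_conformal nl).
by split; [exact: smooth_hopf_pairing1 smooth_polar|exact: smooth_hopf_pairing2 smooth_polar].
Qed.

Lemma polar_orthogonal q : U q ->
  [/\ ip A (X q) (Y q) = 0, ip A (X q) (pu Y q) = 0, ip A (X q) (pv Y q) = 0 &
      ip A (X q) (pv (pu Y) q) = 0].
Proof.
move=> kq; have [/conf_normalP h _ _] := polar_null_lift sA uA polar lk nl kq.
by move: h; rewrite !puE !pvE !ipE.
Qed.

Lemma polar_tangent q : U q ->
  (exists a b c d, pu X q = a *: Y q + b *: pu Y q + c *: pv Y q + d *: pv (pu Y) q) /\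
  (exists a b c d, pv X q = a *: Y q + b *: pu Y q + c *: pv Y q + d *: pv (pu Y) q).
Proof.
move=> kq; have [_ /conf_spanP h1 /conf_spanP h2] := polar_null_lift sA uA polar lk nl kq.
by move: h1 h2; rewrite !puE !pvE.
Qed.

(** The sign of <Y_u, Y_v> is constant near each point, where the formulas for an open
    subset of the plane apply. *)
Lemma polar_pointwise q : U q ->
  [/\ pu X q = (2 * sigma q * pv f1 q) *: Y q - (2 * sigma q * f1 q) *: pv Y q,
      pv X q = (2 * sigma q * pu f2 q) *: Y q - (2 * sigma q * f2 q) *: pu Y q,
      ip A (pu X q) (pv X q) = 2 * sigma q * (f1 q * f2 q),
      ip A (pv X q) (pu (pu Y) q) = 0 /\ ip A (Y q) (pv (pu X) q) = 0 &
      f1 q * f2 q != 0 -> let h q := f1 q * f2 q in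
        lift_metric A X q = sigma q * ip A (pu (pu Y) q) (pv (pv Y) q)
          + (pv (pu h) q / h q - pu h q * pv h q / h q ^+ 2) / 2].
Proof.
move=> kq; have [s [P [s2 sE [oP Pq] PI Puv]]] := null_lift_local ck nl kq.
have [sY Y00 Yu0 Yv0 _] := conformal_liftE (null_lift_conformal nl).
have sYP := smooth_sub PI sY; have sXP := smooth_sub PI smooth_polar.
have Y00P q' (Pq' : P q') := Y00 q' (PI q' Pq').
have Yu0P q' (Pq' : P q') := Yu0 q' (PI q' Pq').
have Yv0P q' (Pq' : P q') := Yv0 q' (PI q' Pq').
have p1 q' : P q' -> ip A (X q') (Y q') = 0 by move=> /PI/polar_orthogonal[].
have p2 q' : P q' -> ip A (X q') (pu Y q') = 0 by move=> /PI/polar_orthogonal[].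
have p3 q' : P q' -> ip A (X q') (pv Y q') = 0 by move=> /PI/polar_orthogonal[].
have p4 q' : P q' -> ip A (X q') (pv (pu Y) q') = 0 by move=> /PI/polar_orthogonal[].
have t1 q' (Pq' : P q') := (polar_tangent (PI q' Pq')).1.
have t2 q' (Pq' : P q') := (polar_tangent (PI q' Pq')).2.
rewrite /sigma -sE; split.
- exact: (polar_du sA oP s2 sYP sXP Y00P Yu0P Yv0P Puv p1 p2 p3 p4 t1 t2 Pq).
- exact: (polar_dv sA oP s2 sYP sXP Y00P Yu0P Yv0P Puv p1 p2 p3 p4 t1 t2 Pq).
- exact: (polar_du_dv sA oP s2 sYP sXP Y00P Yu0P Yv0P Puv p1 p2 p3 p4 t1 t2 Pq).
- split.
    exact: (polar_dv_duu sA oP s2 sYP sXP Y00P Yu0P Yv0P Puv p1 p3 t2 Pq).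
  exact: (polar_duv_Y sA oP s2 sYP sXP Y00P Yu0P Yv0P Puv p1 p2 p3 p4 t1 t2 Pq).
- move=> h0; pose h q := f1 q * f2 q.
  have [sf1 sf2] := smooth_pairings.
  have sh : smooth_on P h.
    by apply: smoothM => //; exact: smooth_sub PI _.
  pose P' := [set q | P q /\ h q != 0].
  have oP' : open P' by exact: open_nonvanishing.
  have P'P : P' `<=` P by move=> q' [].
  have hn q' : P' q' -> f1 q' * f2 q' != 0 by move=> [].
  exact: (polar_metric sA oP' s2 (smooth_sub P'P sYP) (smooth_sub P'P sXP)
    (fun q' H => Y00P q' (P'P q' H)) (fun q' H => Yu0P q' (P'P q' H))
    (fun q' H => Yv0P q' (P'P q' H)) (fun q' H => Puv q' (P'P q' H))
    (fun q' H => p1 q' (P'P q' H)) (fun q' H => p2 q' (P'P q' H))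
    (fun q' H => p3 q' (P'P q' H)) (fun q' H => p4 q' (P'P q' H))
    (fun q' H => t1 q' (P'P q' H)) (fun q' H => t2 q' (P'P q' H)) hn (conj Pq h0)).
Qed.

Lemma polar_null q : U q ->
  [/\ ip A (pu X q) (pu X q) = 0, ip A (pv X q) (pv X q) = 0 &
      ip A (pu X q) (Y q) = 0].
Proof.
move=> kq; have [e1 e2 _ _ _] := polar_pointwise kq.
have [sY Y00 Yu0 Yv0 _] := conformal_liftE (null_lift_conformal nl).
have E1 := self_dot_du sA oI sY Y00 kq; have E2 := self_dot_dv sA oI sY Y00 kq.
rewrite e1 e2 !ip_linE !(ipC (pu Y q) (Y q) sA) !(ipC (pv Y q) (Y q) sA) E1 E2.
rewrite (Y00 q kq) (Yu0 q kq) (Yv0 q kq); split; ring.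
Qed.

(** The pairings with the Hopf differentials become products of first derivatives, whose
    behaviour under a change of coordinates is immediate. *)
Lemma pairing_first_order q : U q ->
  f1 q = - ip A (pu X q) (pu Y q) /\ f2 q = - ip A (pv X q) (pv Y q).
Proof.
move=> kq; have [sY _ _ _ _] := conformal_liftE (null_lift_conformal nl).
have p2 q' : U q' -> ip A (X q') (pu Y q') = 0 by move=> /polar_orthogonal[].
have p3 q' : U q' -> ip A (X q') (pv Y q') = 0 by move=> /polar_orthogonal[].
rewrite (dot_const_du oI smooth_polar (smooth_pu sY) p2 kq).
by rewrite (dot_const_dv oI smooth_polar (smooth_pv sY) p3 kq) !opprK.
Qed.

End PolarPointwise.

Section ConfOf.
Context {R : realType} {M : topologicalType} {m : nat} (A : 'M[R]_m).
Variables (c : R) (psi : M -> 'rV[R]_m).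
Hypotheses (sA : A^T = A) (psi0 : forall p, psi p != 0)
  (psic : forall p, dot A (psi p) (psi p) = c).
Implicit Types (k : chart R M) (q : R * R).

Lemma conf_of_imp (P Q : forall m' : nat, 'M[R]_m' -> (M -> 'M[R]_m') -> Prop) :
  (forall m' B z, P m' B z -> Q m' B z) -> conf_of A c psi P -> conf_of A c psi Q.
Proof. by move=> PQ; rewrite /conf_of; case: ifP => _; exact: PQ. Qed.

Definition null_immersed_on k := let X q := psi (chart_param k q) in
  smooth_on (chart_img k) X /\ forall q, chart_img k q ->
    [/\ ip A (pu X q) (pu X q) = 0, ip A (pv X q) (pv X q) = 0 & ip A (pu X q) (pv X q) != 0].

Lemma smooth_row_mx (O : set (R * R)) (X : R * R -> 'rV[R]_m) (t : 'rV[R]_1) :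
  open O -> smooth_on O X -> smooth_on O (fun q => row_mx (X q) t).
Proof.
move=> oO sX; apply/(smooth_rVP oO) => j.
rewrite -(splitK j); case: (fintype.split j) => i /=.
  by apply: (smooth_eq oO _ (smooth_coord oO i sX)) => q _; rewrite row_mxEl.
by apply: (smooth_eq oO _ (smooth_cst O (t 0 i))) => q _; rewrite row_mxEr.
Qed.

Lemma pd_row_mx b (O : set (R * R)) (X : R * R -> 'rV[R]_m) (t : 'rV[R]_1) q :
  open O -> smooth_on O X -> O q ->
  pd b (fun q => row_mx (X q) t) q = row_mx (pd b X q) 0.
Proof.
move=> oO sX Oq; apply/rowP => j.
rewrite (pd_coordE b j (smooth_row_mx t oO sX) Oq).
rewrite -(splitK j); case: (fintype.split j) => i /=.
  rewrite row_mxEl (pd_coordE b i sX Oq); congr (pd b _ q).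
  by apply/funext => q'; rewrite row_mxEl.
rewrite row_mxEr mxE -[RHS](pd_cst b (t 0 i) q); congr (pd b _ q).
by apply/funext => q'; rewrite row_mxEr.
Qed.

(** The lift (psi, 1), resp. psi, has the same products of derivatives as psi, because
    the last coordinate is constant.  All metrics of psi can therefore be computed in the
    ambient space of y. *)
Lemma conf_of_lift : conf_of A c psi (fun m' B z => B^T = B /\
  forall k, is_chart k -> null_immersed_on k -> exists X', conformal_lift B z k X' /\
    forall q, chart_img k q -> lift_metric B X' q = lift_metric A (fun q => psi (chart_param k q)) q).
Proof.
rewrite /conf_of; case: ifPn => c0; split => //.
- move=> k ck [sX hX]; exists (fun q => psi (chart_param k q)); split => //.
  by split; first (split => // q kq; split => //; rewrite psic (eqP c0)).
- exact: ext_gram_sym.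
move=> k ck [sX hX]; set X := fun q => psi (chart_param k q) in sX hX *.
have oI : open (chart_img k) by case: ck.
pose X' q := row_mx (X q) (1%:M : 'M[R]_1).
have sX' : smooth_on (chart_img k) X' by exact: smooth_row_mx.
have X'u q : chart_img k q -> pu X' q = row_mx (pu X q) 0.
  by move=> kq; rewrite -!puE; exact: (pd_row_mx true _ oI sX kq).
have X'v q : chart_img k q -> pv X' q = row_mx (pv X q) 0.
  by move=> kq; rewrite -!pvE; exact: (pd_row_mx false _ oI sX kq).
have X'uu q : chart_img k q -> pu (pu X') q = row_mx (pu (pu X) q) 0.
  by move=> kq; rewrite (eq_pu oI X'u kq) -!puE; exact: (pd_row_mx true 0 oI (smooth_du sX) kq).
have X'vv q : chart_img k q -> pv (pv X') q = row_mx (pv (pv X) q) 0.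
  by move=> kq; rewrite (eq_pv oI X'v kq) -!pvE; exact: (pd_row_mx false 0 oI (smooth_dv sX) kq).
have ip0 (u v : 'rV[R]_m) (a : 'rV[R]_1) :
    ip (ext_gram A c) (row_mx u a) (row_mx v 0) = ip A u v.
  by rewrite -!ipE dot_ext [X in a 0 0 * X]mxE mulr0 mulr0 subr0.
exists X'; split; last first.
  move=> q kq; rewrite /lift_metric.
  have bE q' : chart_img k q' -> ip (ext_gram A c) (pu X' q') (pv X' q') = ip A (pu X q') (pv X q').
    by move=> kq'; rewrite (X'u q' kq') (X'v q' kq') ip0.
  by rewrite (eq_pu oI bE kq) (eq_pv oI bE kq) (bE q kq) (X'uu q kq) (X'vv q kq) ip0.
split; last first.
  by move=> q kq; rewrite (X'u q kq) (X'v q kq) !ip0; exact: hX.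
split => // q kq; split => //.
  by rewrite /X' row_mx_eq0 negb_and psi0.
by rewrite dot_ext psic !mxE/= !mulr1 subrr.
Qed.

End ConfOf.

(** * Polar transforms in adapted coordinates *)

Lemma open_coord_preimage (R : realType) (M : topologicalType) (k : chart R M) (P : set (R * R)) :
  is_chart k -> open P -> open (chart_dom k `&` (chart_coord k @^-1` P)).
Proof.
move=> ck oP; rewrite openE => p [dp Pp]; rewrite /interior; have [oD _ _ cc _] := ck.
have n1 : nbhs p (chart_dom k) by exact: open_nbhs_nbhs.
have n2 : nbhs p (chart_coord k @^-1` P) by apply: (cc p dp); exact: open_nbhs_nbhs.
by apply: filterS (filterI n1 n2).
Qed.

Section Adapted.
Context {R : realType} {M : topologicalType} (S : oriented_surface R M).
Context {m : nat} (A : 'M[R]_m) (y : M -> 'M[R]_m) (c : R) (psi : M -> 'rV[R]_m) (e : bool).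
Hypotheses (sA : A^T = A) (uA : A \in unitmx) (polar : polar_transform S A y c psi).
Variables (k : chart R M) (F : frame R m).
Hypothesis adF : adapted S A y e k F.
Implicit Types (q : R * R).

Let Y := frame_lift F.
Let X q := psi (chart_param k q).
Local Notation f1 := (hopf_pairing1 A Y X).
Local Notation f2 := (hopf_pairing2 A Y X).
Local Notation U := (chart_img k).
Local Notation eps := ((-1) ^+ e : R).

Let lk : local_coords S k. Proof. by case: adF. Qed.
Let ck : is_chart k. Proof. by case: lk. Qed.
Let oI : open U. Proof. by case: ck. Qed.
Let nl : null_lift A y k Y. Proof. by case: adF => _ []. Qed.
Let hs : hopf_schwarz A k F. Proof. by case: adF. Qed.
Let sX : smooth_on U X. Proof. exact: smooth_polar polar _ lk. Qed.

Let Yuv q : U q -> ip A (pu Y q) (pv Y q) = 1 / 2.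
Proof. by move=> kq; case: adF => _ [_ /(_ q kq)] + _ _; rewrite puE pvE ipE mul1r. Qed.

Lemma adapted_sign q : U q -> Num.sg (ip A (pu Y q) (pv Y q)) = 1.
Proof. by move=> kq; rewrite Yuv// gtr0_sg. Qed.

Lemma adapted_pairing q : U q ->
  [/\ dot A (X q) (hopf1 F q) = f1 q, dot A (X q) (hopf2 F q) = f2 q & f2 q = eps * f1 q].
Proof.
move=> kq; have [_ _ h1 h2] := hs kq; have [XY _ _ _] := polar_orthogonal sA uA polar lk nl kq.
rewrite !puE in h1; rewrite !pvE in h2.
have E1 : dot A (X q) (hopf1 F q) = f1 q.
  rewrite ipE /hopf_pairing1 [in RHS]h1 ipDr ipZr XY mulr0 add0r; exact: erefl.
have E2 : dot A (X q) (hopf2 F q) = f2 q.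
  rewrite ipE /hopf_pairing2 [in RHS]h2 ipDr ipZr XY mulr0 add0r; exact: erefl.
split => //; rewrite -E1 -E2; have [_ _ _ /(_ q kq) ->] := adF.
by rewrite dotZr mulrA -expr2 sqrr_sign mul1r.
Qed.

Let f1s : smooth_on U f1. Proof. by case: (smooth_pairings polar lk nl). Qed.

Lemma adapted_du q : U q -> pu X q = (2 * pv f1 q) *: Y q - (2 * f1 q) *: pv Y q.
Proof.
move=> kq; have [-> _ _ _ _] := polar_pointwise sA uA polar lk nl kq.
by rewrite (adapted_sign kq) mulr1.
Qed.

Lemma pairing2E q : U q -> f2 q = eps * f1 q.
Proof. by case/adapted_pairing. Qed.

Lemma pu_f2 q : U q -> pu f2 q = eps * pu f1 q.
Proof.
move=> kq; rewrite (eq_pu oI pairing2E kq).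
by rewrite (puM (smooth_cst U eps) f1s kq) pu_cst mul0r add0r.
Qed.

Lemma adapted_dv q : U q -> pv X q = eps *: ((2 * pu f1 q) *: Y q - (2 * f1 q) *: pu Y q).
Proof.
move=> kq; have [_ -> _ _ _] := polar_pointwise sA uA polar lk nl kq.
rewrite (adapted_sign kq) mulr1 (pu_f2 kq); have [_ _ ->] := adapted_pairing kq.
rewrite scalerBr !scalerA; congr (_ *: _ - _ *: _); ring.
Qed.

Lemma adapted_du_dv q : U q -> ip A (pu X q) (pv X q) = 2 * eps * f1 q ^+ 2.
Proof.
move=> kq; have [_ _ -> _ _] := polar_pointwise sA uA polar lk nl kq.
by rewrite (adapted_sign kq); have [_ _ ->] := adapted_pairing kq; ring.
Qed.

Lemma adapted_duu_dvv q : U q -> pu (pu X) q - eps *: pv (pv X) q =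
  4 *: (pv f1 q *: pu Y q - pu f1 q *: pv Y q).
Proof.
move=> kq; have [sY Y00 Yu0 Yv0 _] := conformal_liftE (null_lift_conformal nl).
have t1 : smooth_on U (fun q => 2 * pv f1 q).
  exact: (smoothM oI (smooth_cst U (2 : R)) (smooth_pv f1s)).
have t2 : smooth_on U (fun q => 2 * f1 q) by exact: (smoothM oI (smooth_cst U (2 : R)) f1s).
have t3 : smooth_on U (fun q => 2 * pu f1 q).
  exact: (smoothM oI (smooth_cst U (2 : R)) (smooth_pu f1s)).
have sYu := smooth_pu sY; have sYv := smooth_pv sY.
have c2u (g : R * R -> R) : smooth_on U g -> pu (fun q => 2 * g q) q = 2 * pu g q.
  by move=> sg; rewrite (puM (smooth_cst U (2 : R)) sg kq) pu_cst mul0r add0r.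
have c2v (g : R * R -> R) : smooth_on U g -> pv (fun q => 2 * g q) q = 2 * pv g q.
  by move=> sg; rewrite (pvM (smooth_cst U (2 : R)) sg kq) pv_cst mul0r add0r.
rewrite (eq_pu oI adapted_du kq) (eq_pv oI adapted_dv kq).
rewrite (pvZ oI (smooth_cst U eps) (smoothBv oI (smoothZ oI t3 sY) (smoothZ oI t2 sYu)) kq).
rewrite pv_cst scale0r add0r scalerA -expr2 sqrr_sign scale1r.
rewrite (puBv (smoothZ oI t1 sY) (smoothZ oI t2 sYv) kq) (puZ oI t1 sY kq) (puZ oI t2 sYv kq).
rewrite (pvBv (smoothZ oI t3 sY) (smoothZ oI t2 sYu) kq) (pvZ oI t3 sY kq) (pvZ oI t2 sYu kq).
rewrite (c2u _ (smooth_pv f1s)) (c2u _ f1s) (c2v _ (smooth_pu f1s)) (c2v _ f1s).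
rewrite -(pvuC oI sY kq) -(pvuC_real oI f1s kq).
set a := pv (pu f1) q; set yy := pv (pu Y) q.
apply/rowP => j; rewrite !mxE; ring.
Qed.

Section Nonvanishing.
Variable q : R * R.
Hypotheses (kq : U q) (f0 : f1 q != 0).

Lemma adapted_metric_neq0 : ip A (pu X q) (pv X q) != 0.
Proof.
by rewrite (adapted_du_dv kq) !mulf_neq0 ?signr_eq0 ?pnatr_eq0// ?expf_neq0.
Qed.

(** In the basis X, X_u, X_v the only nonzero products are <X, X> = c and <X_u, X_v>. *)
Lemma pc_span_nondegenerate : c != 0 -> nondegenerate_on A (pc_span X q).
Proof.
move=> c0 u /pc_spanP [a [b [d ->]]] /pc_normalP; rewrite !puE !pvE !ipE.
have [_ _ Xc _] := polar; have X00 q' : U q' -> ip A (X q') (X q') = c by rewrite -ipE => _; exact: Xc.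
have [Xu0 Xv0 _] := polar_null sA uA polar lk nl kq.
have E1 := dot_const_du oI sX sX X00 kq; have E2 := dot_const_dv oI sX sX X00 kq.
rewrite (ipC _ (X q) sA) in E1; rewrite (ipC _ (X q) sA) in E2.
have {}E1 : ip A (X q) (pu X q) = 0.
  by move/eqP: E1; rewrite -addr_eq0 -mulr2n mulrn_eq0 /= => /eqP.
have {}E2 : ip A (X q) (pv X q) = 0.
  by move/eqP: E2; rewrite -addr_eq0 -mulr2n mulrn_eq0 /= => /eqP.
have b0 := adapted_metric_neq0.
rewrite !ip_linE !(ipC (pu X q) (X q) sA) !(ipC (pv X q) (X q) sA) E1 E2 (X00 q kq).
rewrite [ip A (pu X q) (pu X q)]Xu0 [ip A (pv X q) (pv X q)]Xv0 (ipC (pv X q) (pu X q) sA).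
rewrite !mulr0 !addr0 !add0r => -[/eqP + /eqP + /eqP]; rewrite !mulf_eq0 (negbTE c0) (negbTE b0) !orbF.
by move=> /eqP -> /eqP -> /eqP ->; rewrite !scale0r !addr0.
Qed.

(** By [adapted_duu_dvv] the vector X_uu - eps X_vv is a combination of Y_u and Y_v, and
    the coefficients are such that it is tangent. *)
Lemma adapted_Omega : c != 0 -> Omega1 A X q = eps *: Omega2 A X q.
Proof.
move=> c0; have nd := pc_span_nondegenerate c0.
apply/eqP; rewrite -subr_eq0; apply/eqP.
rewrite /Omega1 /Omega2 -oprojZ.
have -> : oproj A (pc_span X q) (du (du X) q) - oproj A (pc_span X q) (eps *: dv (dv X) q) =
    oproj A (pc_span X q) (du (du X) q - eps *: dv (dv X) q).
  by rewrite oprojD -scaleN1r -oprojZ scaleN1r.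
apply: (oproj_in uA nd); rewrite !puE !pvE adapted_duu_dvv//; apply/pc_spanP.
rewrite !puE !pvE (adapted_du kq) (adapted_dv kq).
exists 0, (2 * pu f1 q / f1 q), (- (2 * eps * pv f1 q / f1 q)).
have ee : eps * eps = 1 by rewrite -expr2 sqrr_sign.
have f0' := f0; set a := pu f1 q; set b := pv f1 q; set f := f1 q in f0' *.
apply/rowP => j; rewrite !mxE.
set y0 := Y q 0 j; set yu := pu Y q 0 j; set yv := pv Y q 0 j.
transitivity (0 * X q 0 j + 2 * a / f * (2 * b * y0 - 2 * f * yv)
  - (eps * eps) * (2 * b / f * (2 * a * y0 - 2 * f * yu))); last by ring.
by rewrite ee; field.
Qed.

End Nonvanishing.

(** The factor makes the derivatives parallel to those of psi: in (Y / f1)_u the component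
    along Y is - (f1)_u / f1^2, as needed for psi_v. *)
Definition dual_lift q := (f1 q)^-1 *: Y q.

Lemma dual_lift_du q : U q -> f1 q != 0 ->
  pu dual_lift q = (- (eps / (2 * f1 q ^+ 2))) *: pv X q /\
  pv dual_lift q = (- (2 * f1 q ^+ 2)^-1) *: pu X q.
Proof.
move=> kq f0; have [sY _ _ _ _] := conformal_liftE (null_lift_conformal nl).
pose P := [set q | U q /\ f1 q != 0].
have oP : open P by exact: open_nonvanishing.
have PU : P `<=` U by move=> q' [].
have Pq : P q by [].
have sf := smooth_sub PU f1s.
have sfi : smooth_on P (fun q => (f1 q)^-1) by apply: (smoothV oP) => // q' [].
have sYP := smooth_sub PU sY.
rewrite (puZ oP sfi sYP Pq) (pvZ oP sfi sYP Pq) (puV sf Pq f0) (pvV sf Pq f0).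
rewrite (adapted_du kq) (adapted_dv kq) scalerA.
have -> : - (eps / (2 * f1 q ^+ 2)) * eps = - (2 * f1 q ^+ 2)^-1.
  by rewrite mulNr mulrAC -expr2 sqrr_sign mul1r.
by split; rewrite scalerBr !scalerA -scaleNr; congr (_ *: _ + _ *: _); field.
Qed.

(** As f2 = eps f1, half of log |f1 f2| is log |f1|. *)
Lemma adapted_lift_metric q : U q -> f1 q != 0 ->
  lift_metric A X q = dot A (hopf1 F q) (hopf2 F q)
    + dv (fun q' => dot A (X q') (Du A Y (hopf1 F) q') / dot A (X q') (hopf1 F q')) q.
Proof.
move=> kq f0; have [sY Y00 Yu0 Yv0 _] := conformal_liftE (null_lift_conformal nl).
pose P := [set q | U q /\ f1 q != 0].
have oP : open P by exact: open_nonvanishing.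
have PU : P `<=` U by move=> q' [].
have Pq : P q by [].
have [_ _ _ _ H] := polar_pointwise sA uA polar lk nl kq.
have [_ _ E2] := adapted_pairing kq.
rewrite H ?E2 ?mulf_neq0 ?signr_eq0// (adapted_sign kq) mul1r (hopf_dot sA ck nl hs kq).
congr (_ + _).
(* kappa_1 is smooth since the Schwarzian is determined by <kappa_1, Y_uv> = 0. *)
pose kap q := pu (pu Y) q + (2 * ip A (pu (pu Y) q) (pv (pu Y) q)) *: Y q.
have skap : smooth_on U kap.
  apply: (smoothD oI); first exact: smooth_pu (smooth_pu sY).
  apply: (smoothZ oI) => //; apply: (smoothM oI (smooth_cst U (2 : R))).
  by apply: (smooth_ip oI); [exact: smooth_pu (smooth_pu sY)|exact: smooth_pv (smooth_pu sY)].
have kapE q' : U q' -> hopf1 F q' = kap q'.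
  move=> kq'; have [/conf_normalP[_ _ _ +] _ + _] := hs kq'; rewrite !puE !pvE ipE -/Y => h4 h.
  have h' : hopf1 F q' = pu (pu Y) q' + (schw1 F q' / 2) *: Y q'.
    by rewrite h scaleNr addrAC addNr add0r.
  rewrite h' /kap; congr (_ + _ *: _).
  have E := self_dot_duv sA oI sY Y00 kq'; rewrite (Yuv kq') in E.
  move: h4; rewrite h' !ip_linE E => h4.
  transitivity (2 * (ip A (pu (pu Y) q') (pv (pu Y) q')
    - (ip A (pu (pu Y) q') (pv (pu Y) q') + schw1 F q' / 2 * - (1 / 2)))); first by field.
  by rewrite h4 subr0.
have num q' : U q' -> dot A (X q') (Du A Y (hopf1 F) q') = pu f1 q'.
  move=> kq'; have [Xn _ _] := polar_null_lift sA uA polar lk nl kq'.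
  have nd := conf_span_nondegenerate sA ck nl kq'.
  rewrite /Du (dot_oproj uA _ nd Xn) puE ipE (eq_pu oI kapE kq').
  have f1E q0 : U q0 -> f1 q0 = ip A (X q0) (kap q0).
    by move=> kq0; have [<- _ _] := adapted_pairing kq0; rewrite ipE kapE.
  rewrite (eq_pu oI f1E kq') (pu_ip oI A sX skap kq').
  have [Xu0 _ XuY] := polar_null sA uA polar lk nl kq'.
  have -> : ip A (pu X q') (kap q') = 0; last by rewrite add0r.
  rewrite /kap ipDr ipZr [ip A (pu X q') (Y q')]XuY mulr0 addr0 (adapted_du kq') !ip_linE.
  rewrite (self_dot_duu sA oI sY Y00 Yu0 kq') (ipC (pv Y q') _ sA).
  by rewrite (lift_duu_dv sA oI sY Yu0 Yuv kq') !mulr0 subr0.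
have quot q' : P q' -> dot A (X q') (Du A Y (hopf1 F) q') / dot A (X q') (hopf1 F q') =
    pu f1 q' / f1 q'.
  by move=> [kq' _]; rewrite (num q' kq'); have [-> _ _] := adapted_pairing kq'.
rewrite pvE (eq_pv oP quot Pq).
have sf := smooth_sub PU f1s.
rewrite (pv_div oP (smooth_pu sf) sf (fun q' (h : P q') => h.2) Pq).
have hE q' : U q' -> f1 q' * f2 q' = eps * (f1 q' * f1 q').
  by move=> kq'; have [_ _ ->] := adapted_pairing kq'; ring.
have hu q' : U q' -> pu (fun q => f1 q * f2 q) q' = eps * (2 * (f1 q' * pu f1 q')).
  move=> kq'; rewrite (eq_pu oI hE kq') (puM (smooth_cst U eps) (smoothM oI f1s f1s) kq').
  by rewrite pu_cst (puM f1s f1s kq'); ring.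
have hv q' : U q' -> pv (fun q => f1 q * f2 q) q' = eps * (2 * (f1 q' * pv f1 q')).
  move=> kq'; rewrite (eq_pv oI hE kq') (pvM (smooth_cst U eps) (smoothM oI f1s f1s) kq').
  by rewrite pv_cst (pvM f1s f1s kq'); ring.
have s1 := smooth_pu f1s; have s2 := smoothM oI f1s s1.
have huv : pv (pu (fun q => f1 q * f2 q)) q =
    eps * (2 * (pv f1 q * pu f1 q + f1 q * pv (pu f1) q)).
  rewrite (eq_pv oI hu kq) (pvM (smooth_cst U eps) (smoothM oI (smooth_cst U (2 : R)) s2) kq).
  by rewrite pv_cst (pvM (smooth_cst U (2 : R)) s2 kq) pv_cst (pvM f1s s1 kq); ring.
rewrite huv (hu q kq) (hv q kq).
set a := pu f1 q; set b := pv f1 q; set f := f1 q in f0 *; set g := pv (pu f1) q.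
have e0 : eps != 0 by rewrite signr_eq0.
by field; rewrite e0 f0.
Qed.

End Adapted.

(** * The polar transform as a surface in the space form *)

Lemma mean_curvature_null (R : realType) m (A : 'M[R]_m) (X : R * R -> 'rV[R]_m) q :
  ip A (pu X q) (pu X q) = 0 -> ip A (pv X q) (pv X q) = 0 ->
  exists t, mean_curvature A X q = t *: Omega12 A X q.
Proof.
rewrite /mean_curvature !puE !pvE !ipE => -> ->.
move: (Omega1 A X q) (Omega2 A X q) (Omega12 A X q) (ip A (pu X q) (pv X q)) => w1 w2 w12 b.
rewrite !scale0r addr0 sub0r.
by exists (- ((2 * (0 * 0 - b ^+ 2))^-1 * (2 * b))); rewrite scaleNr scalerN scalerA.
Qed.

Section PolarIsothermic.
Context {R : realType} {M : topologicalType} (S : oriented_surface R M).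
Context {m : nat} (A : 'M[R]_m) (y : M -> 'M[R]_m) (c : R) (psi : M -> 'rV[R]_m) (e : bool).
Hypotheses (sA : A^T = A) (uA : A \in unitmx).
Hypotheses (iso : isothermic S A y e) (polar : polar_transform S A y c psi).
Implicit Types (k l : chart R M) (q : R * R).

Lemma adapted_local_coords k F : adapted S A y e k F -> local_coords S k.
Proof. by case. Qed.

Section Restricted.
Variables (k : chart R M) (F : frame R m) (M0 : set M).
Hypotheses (adF : adapted S A y e k F) (oM0 : open (chart_dom k `&` M0)).
Hypothesis nz : forall q, chart_img (chart_restr k M0) q ->
  dot A (psi (chart_param k q)) (hopf1 F q) != 0.
Let k0 := chart_restr k M0.
Let X q := psi (chart_param k q).
Let lk : local_coords S k. Proof. exact: adapted_local_coords adF. Qed.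
Let ck : is_chart k. Proof. by case: lk. Qed.
Let lk0 : local_coords S k0. Proof. exact: local_coords_restr. Qed.
Let sub : chart_img k0 `<=` chart_img k. Proof. exact: chart_img_restr. Qed.
Let nz1 q : chart_img k0 q -> hopf_pairing1 A (frame_lift F) X q != 0.
Proof.
move=> kq; have := nz kq; have [-> _ _] := adapted_pairing sA uA polar adF (sub kq); exact.
Qed.

Lemma polar_pc_adapted : c != 0 -> pc_adapted S A e k0 psi.
Proof.
move=> c0; split; first exact: lk0.
have nl : null_lift A y k (frame_lift F) by case: adF => _ [].
move=> q kq; have kq' := sub kq; have [Xu0 Xv0 _] := polar_null sA uA polar lk nl kq'.
split; last exact: (adapted_Omega sA uA polar adF kq' (nz1 kq) c0).
  by rewrite puE ipE; exact: Xu0.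
by rewrite pvE ipE; exact: Xv0.
Qed.

Let N := dual_lift A psi k F.

Lemma dual_lift_is_lift : is_lift A y k0 N.
Proof.
have nl : null_lift A y k (frame_lift F) by case: adF => _ [].
have oI0 : open (chart_img k0) by case: lk0 => -[].
have [sY hY] := nl.1; split.
  apply: (smoothZ oI0); last exact: smooth_sub sub sY.
  apply: (smoothV oI0); first by move=> q /nz1.
  have [sf _] := smooth_pairings polar lk nl; exact: smooth_sub sub sf.
move=> q kq; have [Y0 Yn Yy] := hY q (sub kq); split.
- by rewrite scaler_eq0 invr_eq0 (negbTE (nz1 kq)).
- by rewrite dotZl dotZr Yn !mulr0.
- rewrite -Yy; apply/genmxP; apply/eqmxP; apply: eqmx_scale; rewrite invr_eq0; exact: nz1.
Qed.

Lemma dual_lift_tangent q : chart_img k0 q ->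
  (du N q :=: dv X q)%MS /\ (dv N q :=: du X q)%MS.
Proof.
move=> kq; have [e1 e2] := dual_lift_du sA uA polar adF (sub kq) (nz1 kq).
have f0 := nz1 kq.
rewrite !puE !pvE e1 e2; split; apply: eqmx_scale; rewrite oppr_eq0.
  by rewrite mulf_neq0 ?signr_eq0 ?invr_eq0 ?mulf_neq0 ?pnatr_eq0 ?expf_neq0.
by rewrite invr_eq0 ?mulf_neq0 ?pnatr_eq0 ?expf_neq0.
Qed.

(** The derivatives of the dual lift are tangent to psi. *)
Lemma dual_lift_parallel : c != 0 -> parallel_section A X (chart_img k0) N.
Proof.
move=> c0 q kq; have nd := pc_span_nondegenerate sA uA polar adF (sub kq) (nz1 kq) c0.
have [e1 e2] := dual_lift_tangent kq.
have in_span (w : 'rV[R]_m) : (w <= dv X q)%MS \/ (w <= du X q)%MS -> (w <= pc_span X q)%MS.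
  case=> /submx_trans; apply; first exact: addsmxSr.
  by apply: submx_trans (addsmxSl _ _); exact: addsmxSr.
split; apply: (oproj_in uA nd); apply: in_span; [left|right].
  by rewrite e1.
by rewrite e2.
Qed.

Lemma dual_lift_unit_normal : unit_normal A X (chart_img k0) N.
Proof.
have nl : null_lift A y k (frame_lift F) by case: adF => _ [].
have [sN hN] := dual_lift_is_lift; split => //.
- move=> q kq; have kq' := sub kq; apply/pc_normalP; rewrite !puE !pvE !ipE /N /dual_lift !ipZl.
  have [h1 _ _ _] := polar_orthogonal sA uA polar lk nl kq'.
  have [_ _ h2] := polar_null sA uA polar lk nl kq'.
  have [sY Y00 Yu0 _ _] := conformal_liftE (null_lift_conformal nl).
  have oI : open (chart_img k) by case: ck.
  split; rewrite (ipC _ _ sA).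
  + by rewrite [ip A _ _]h1 mulr0.
  + by rewrite [ip A _ _]h2 mulr0.
  + rewrite (adapted_dv sA uA polar adF kq') !ip_linE (Y00 q kq').
    by rewrite (ipC (pu _ _) _ sA) (self_dot_du sA oI sY Y00 kq') !mulr0 subr0 !mulr0.
- by move=> q kq; have [] := hN q kq.
- by exists 0; [rewrite !inE eqxx !orbT|move=> q kq; have [] := hN q kq].
Qed.

(** In null coordinates the mean curvature vector is a multiple of the normal part of
    psi_uv, and <Y, psi_uv> = 0. *)
Lemma dual_lift_minimal : c != 0 -> minimal_section A X (chart_img k0) N.
Proof.
move=> c0; split; first exact: dual_lift_unit_normal.
have nl : null_lift A y k (frame_lift F) by case: adF => _ [].
move=> q kq; have kq' := sub kq.
have nd := pc_span_nondegenerate sA uA polar adF kq' (nz1 kq) c0.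
have [Xu0 Xv0 _] := polar_null sA uA polar lk nl kq'.
have [_ _ _ [_ o] _] := polar_pointwise sA uA polar lk nl kq'.
have [_ Nn _ _] := dual_lift_unit_normal.
have [t ->] := mean_curvature_null Xu0 Xv0.
rewrite dotZr /Omega12 (dot_oproj uA _ nd (Nn q kq)) puE pvE ipE.
by rewrite /N /dual_lift ipZl [ip A _ (pv (pu X) q)]o !mulr0.
Qed.

End Restricted.

(** The determinant of the first fundamental form is that in the adapted chart, which is
    - <X_u, X_v>^2, times the square of the Jacobian. *)
Lemma polar_lorentzian k l F q : local_coords S k -> adapted S A y e l F -> overlap k l q ->
  hopf_pairing1 A (frame_lift F) (fun q => psi (chart_param l q)) (transition k l q) != 0 ->
  lorentzian A (fun q => psi (chart_param k q)) q.
Proof.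
move=> lk adF kl f0; have ll := adapted_local_coords adF.
have ck : is_chart k by case: lk. have cl : is_chart l by case: ll.
have nl : null_lift A y l (frame_lift F) by case: adF => _ [].
set X := fun q => psi (chart_param k q); set Z := fun q => psi (chart_param l q) in f0.
have okl := overlap_open ck cl; have oIl : open (chart_img l) by case: cl.
have sZ : smooth_on (chart_img l) Z := smooth_polar polar ll.
have [s1 s2] := smooth_transition lk ll.
have UO q' : overlap k l q' -> chart_img l (trans1 k l q', trans2 k l q').
  by move=> kl'; have /overlapE[] := transition_overlap ck cl kl'.
have XZ q' : overlap k l q' -> X q' = Z (trans1 k l q', trans2 k l q').
  by move=> kl'; rewrite /X -(param_transition ck cl kl').
have lq := UO q kl.
have [Zu0 Zv0 _] := polar_null sA uA polar ll nl lq.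
have B0 := adapted_metric_neq0 sA uA polar adF lq f0.
have J0 := jacobian_neq0 lk ll kl.
rewrite /lorentzian !puE !pvE !ipE.
rewrite (eq_pu okl XZ kl) (eq_pv okl XZ kl).
rewrite (pu_compv oIl okl UO sZ s1 s2 kl) (pv_compv oIl okl UO sZ s1 s2 kl).
rewrite /Defs.jacobian !puE !pvE in J0.
set q' := (trans1 k l q, trans2 k l q) in lq Zu0 Zv0 B0 *.
rewrite !ip_linE [ip A (pu Z q') (pu Z q')]Zu0 [ip A (pv Z q') (pv Z q')]Zv0.
rewrite (ipC (pv Z q') (pu Z q') sA).
set B := ip A _ _ in B0 *.
set a := pu (trans1 k l) q in J0 *; set b := pv (trans1 k l) q in J0 *.
set a' := pu (trans2 k l) q in J0 *; set b' := pv (trans2 k l) q in J0 *.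
rewrite [X in X < 0](_ : _ = - (B ^+ 2 * (a * b' - b * a') ^+ 2)); last by ring.
by rewrite oppr_lt0 mulr_gt0// lt_neqAle eq_sym sqrf_eq0 sqr_ge0 ?B0 ?J0.
Qed.

Lemma polar_isothermic (M0 : set M) : c != 0 -> open M0 ->
  (forall k F, adapted S A y e k F -> forall q, chart_img (chart_restr k M0) q ->
     dot A (psi (chart_param k q)) (hopf1 F q) != 0) ->
  pc_isothermic S A c e M0 psi.
Proof.
move=> c0 oM0 nz; have [sp _ pc _] := polar.
have oK k : local_coords S k -> open (chart_dom k `&` M0).
  by move=> [ck _]; apply: openI => //; case: ck.
split.
  split => //.
    move=> k Sk; have ck := atlas_chart Sk.
    by apply: smooth_sub (sp k Sk) => q [p [dp _] <-]; exists p.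
  move=> k lk kM q kq; have ck : is_chart k by case: lk.
  have [dq cq] := chart_param_dom ck kq.
  have [_ /(_ (chart_param k q))[l [F [adF lq]]]] := iso.
  have ll := adapted_local_coords adF; have cl : is_chart l by case: ll.
  have kl : overlap k l q by exact/overlapE.
  apply: (polar_lorentzian lk adF kl).
  have lq' : chart_img l (transition k l q).
    by have /overlapE[] := transition_overlap ck cl kl.
  have lq0 : chart_img (chart_restr l M0) (transition k l q).
    by apply/(chart_imageE _ _ cl); split => //; rewrite (param_transition ck cl kl); exact: kM.
  by have := nz l F adF _ lq0; have [-> _ _] := adapted_pairing sA uA polar adF lq'.
move=> p pM0; have [_ /(_ p)[k [F [adF kp]]]] := iso.
exists (chart_restr k M0); split; [|by move=> ? []|by []].
by apply: (polar_pc_adapted adF _ (nz k F adF) c0); exact/oK/(adapted_local_coords adF).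
Qed.

Lemma polar_generalized_H_surface (M0 : set M) k F : c != 0 -> open M0 ->
  adapted S A y e k F ->
  (forall q, chart_img (chart_restr k M0) q ->
     dot A (psi (chart_param k q)) (hopf1 F q) != 0) ->
  let k0 := chart_restr k M0 in
  let X := fun q => psi (chart_param k q) in
  [/\ pc_adapted S A e k0 psi,
      generalized_H_surface A X (chart_img k0) &
      exists Ypsi : R * R -> 'rV[R]_m,
        [/\ is_lift A y k0 Ypsi,
            forall q, chart_img k0 q -> (du Ypsi q :=: dv X q)%MS /\ (dv Ypsi q :=: du X q)%MS,
            minimal_section A X (chart_img k0) Ypsi &
            parallel_section A X (chart_img k0) Ypsi]].
Proof.
move=> c0 oM0 adF nz k0 X.
have [ck _] := adapted_local_coords adF.
have oK : open (chart_dom k `&` M0) by apply: openI => //; case: ck.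
have mn := dual_lift_minimal adF oK nz c0.
have pl := dual_lift_parallel adF nz c0.
split.
- exact: (polar_pc_adapted adF oK nz c0).
- exists (dual_lift A psi k F); split; last exact: pl.
  by case: mn => un mn0; split; [exact: un|exists 0; exact: mn0].
- exists (dual_lift A psi k F); split; [| |exact: mn|exact: pl].
    exact: (dual_lift_is_lift adF oK nz).
  exact: (dual_lift_tangent adF nz).
Qed.

(** [adapted_lift_metric], transferred to the light cone of psi by [conf_of_lift]. *)
Lemma polar_conf_metric k F : adapted S A y e k F ->
  let X := fun q => psi (chart_param k q) in
  let k0 := chart_restr k [set p | dot A (psi p) (hopf1 F (chart_coord k p)) != 0] in
  conf_of A c psi (fun m' B z => conf_metric B z k0 (fun q =>
    dot A (hopf1 F q) (hopf2 F q)
    + dv (fun q' => dot A (X q') (Du A (frame_lift F) (hopf1 F) q')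
                    / dot A (X q') (hopf1 F q')) q)).
Proof.
move=> adF X k0; have lk := adapted_local_coords adF; have [ck _] := lk.
have nl : null_lift A y k (frame_lift F) by case: adF => _ [].
have [_ p0 pc _] := polar.
have [sf _] := smooth_pairings polar lk nl; have oI : open (chart_img k) by case: ck.
have oW : open (chart_dom k `&` [set p | dot A (psi p) (hopf1 F (chart_coord k p)) != 0]).
  have := open_coord_preimage ck (open_nonvanishing oI sf); congr open.
  have [_ _ pK _ _] := ck.
  have E p : chart_dom k p -> dot A (psi p) (hopf1 F (chart_coord k p)) =
      hopf_pairing1 A (frame_lift F) X (chart_coord k p).
    move=> dp; have kq := chart_imgP dp; have [<- _ _] := adapted_pairing sA uA polar adF kq.
    by rewrite /X pK.
  apply/seteqP; split=> p /=; first by move=> [dp [_]]; rewrite E.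
  by move=> [dp]; rewrite E => // f0; split => //; split => //; exact: chart_imgP.
have ck0 : is_chart k0 by exact: is_chart_restr.
have sub : chart_img k0 `<=` chart_img k by exact: chart_img_restr.
have nz q : chart_img k0 q -> hopf_pairing1 A (frame_lift F) X q != 0.
  move=> kq0; have kq := sub q kq0; have /(chart_imageE _ _ ck)[_] := kq0.
  rewrite /= (chart_param_dom ck kq).2.
  by have [-> _ _] := adapted_pairing sA uA polar adF kq.
have im : null_immersed_on A psi k0.
  split; first exact: smooth_sub sub (smooth_polar polar lk).
  move=> q kq0; have kq := sub q kq0; have [h1 h2 _] := polar_null sA uA polar lk nl kq.
  by split; [exact: h1|exact: h2|exact: (adapted_metric_neq0 sA uA polar adF kq (nz q kq0))].
apply: conf_of_imp (conf_of_lift sA p0 pc) => m' B z [sB H].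
have [X' [cX' eX']] := H k0 ck0 im.
apply: (conf_metric_exists sB ck0 cX') => q kq0; rewrite (eX' q kq0).
by rewrite [RHS](adapted_lift_metric sA uA polar adF (sub q kq0) (nz q kq0)).
Qed.

End PolarIsothermic.

(** * Integration over the plane *)

(* On coordinate lines the partial derivatives are derivatives in one variable. *)
Transparent du dv.

Section PlaneIntegral.
Context {R : realType}.
Implicit Types (f : R -> R) (phi : R * R -> R).

Local Notation mu := (@lebesgue_measure R).
Local Notation mu2 := (@lebesgue_measure R \x @lebesgue_measure R)%E.

Lemma prod_normE (q : R * R) : `|q| = Num.max `|q.1| `|q.2|.
Proof. by []. Qed.

(** An open set is the union of the rectangles with rational corners that it contains. *)
Lemma open_measurable_plane (O : set (R * R)) : open O ->
  measurable (O : set (measurableTypeR R * measurableTypeR R)).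
Proof.
move=> oO.
pose box (a : (rat * rat) * (rat * rat)) : set (R * R) :=
  `]ratr a.1.1, ratr a.1.2[%classic `*` `]ratr a.2.1, ratr a.2.2[%classic.
have -> : O = \bigcup_a (if `[<box a `<=` O>] then box a else set0).
  apply/seteqP; split => [q Oq|q [a _]]; last by case: asboolP => // s /s.
  have : nbhs q O by exact: open_nbhs_nbhs.
  case/nbhs_ballP => e e0 bO.
  have [a1 ha1] : exists r : rat, ratr r \in `]q.1 - e, q.1[.
    by apply: rat_in_itvoo; rewrite ltrBlDr ltrDl.
  have [b1 hb1] : exists r : rat, ratr r \in `]q.1, q.1 + e[.
    by apply: rat_in_itvoo; rewrite ltrDl.
  have [a2 ha2] : exists r : rat, ratr r \in `]q.2 - e, q.2[.
    by apply: rat_in_itvoo; rewrite ltrBlDr ltrDl.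
  have [b2 hb2] : exists r : rat, ratr r \in `]q.2, q.2 + e[.
    by apply: rat_in_itvoo; rewrite ltrDl.
  move: ha1 hb1 ha2 hb2; rewrite !in_itv /= => /andP[? ?] /andP[? ?] /andP[? ?] /andP[? ?].
  exists ((a1, b1), (a2, b2)) => //.
  case: asboolP => [_|]; first by split; rewrite /= in_itv /=; apply/andP; split.
  case=> x [] /=; rewrite !in_itv /= => /andP[? ?] /andP[? ?]; apply: bO.
  by split; rewrite /ball /= ltr_norml; apply/andP; split; lra.
apply: countable_bigcupT_measurable; first exact: countableP.
move=> a; case: asboolP => // _.
by apply: measurableX; exact: measurable_itv.
Qed.

Lemma continuous_measurable_plane phi : continuous phi ->
  measurable_fun setT (phi : measurableTypeR R * measurableTypeR R -> R).
Proof.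
move=> cphi; apply: (measurability _ (measurable_realfun.RGenOpens.measurableE R)).
move=> _ [_ [a [b ->] <-]]; rewrite setTI; apply: open_measurable_plane.
by move/continuousP: cphi; apply; exact: interval_open.
Qed.

Lemma le_prod_norm (q : R * R) L : (`|q| <= L) = (`|q.1| <= L) && (`|q.2| <= L).
Proof. by rewrite prod_normE ge_max. Qed.

Definition vanishes_beyond (V : normedModType R) L (f : V -> R) :=
  forall x, L < `|x| -> f x = 0.

Lemma box_norm L : `[- L, L]%classic `*` `[- L, L]%classic = [set q : R * R | `|q| <= L].
Proof.
by apply/seteqP; split => q /=; rewrite le_prod_norm !in_itv /= !ler_norml => /andP.
Qed.

Lemma bounded_of_support phi L : continuous phi -> vanishes_beyond L phi ->
  exists2 C, 0 <= C & forall q, `|phi q| <= C.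
Proof.
move=> cphi sphi.
have cK : compact (`[- L, L]%classic `*` `[- L, L]%classic : set (R * R)).
  by apply: compact_setX; exact: segment_compact.
have : compact (phi @` (`[- L, L]%classic `*` `[- L, L]%classic)).
  by apply: continuous_compact => //; exact: continuous_subspaceT.
move/compact_bounded => [C [_ HC]].
exists (`|C| + 1) => [|q]; first by rewrite addr_ge0.
have [lq|lq] := leP `|q| L.
  apply: HC; first by rewrite (le_lt_trans (ler_norm C)) // ltrDl.
  by exists q => //; rewrite box_norm.
by rewrite sphi // normr0 addr_ge0.
Qed.

Lemma restrict_of_support phi L : vanishes_beyond L phi ->
  phi \_ (`[- L, L]%classic `*` `[- L, L]%classic) = phi.
Proof.
move=> sphi; apply/funext => q; rewrite /patch; case: ifPn => //.
by rewrite box_norm; move/negP; rewrite inE /= => /negP; rewrite -ltNge => /sphi.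
Qed.

Lemma integrable_plane phi L : continuous phi -> vanishes_beyond L phi ->
  mu2.-integrable setT (EFin \o phi).
Proof.
move=> cphi sphi.
have mB : measurable ((`[- L, L]%classic `*` `[- L, L]%classic)
    : set (measurableTypeR R * measurableTypeR R)).
  by apply: measurableX; exact: measurable_itv.
have [C C0 HC] := bounded_of_support cphi sphi.
rewrite -(restrict_of_support sphi) -restrict_EFin.
apply/(integrable_mkcond _ mB); apply: measurable_bounded_integrable => //.
- rewrite [X in (X < _)%E]product_measure1E; [|exact: measurable_itv..].
  by rewrite [X in (X * _)%E]lebesgue_measure_itv [X in (_ * X)%E]lebesgue_measure_itv /=; case: ifP => _; rewrite ?mule0 ?ltry // -EFinM ltry.
- by apply: measurable_funTS; exact: continuous_measurable_plane.
- by exists C; split; [exact: num_real|move=> x Cx y _; exact: le_trans (HC y) (ltW Cx)].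
Qed.

Lemma integrable_line f L : continuous f -> vanishes_beyond L f ->
  mu.-integrable setT (EFin \o f).
Proof.
move=> cf sf; have -> : f = f \_ `[- L, L]%classic.
  apply/funext => x; rewrite /patch; case: ifPn => // /negP.
  by rewrite inE /= in_itv /= -ler_norml => /negP; rewrite -ltNge => /sf.
rewrite -restrict_EFin; have mI : measurable (`[- L, L]%classic : set (measurableTypeR R)) by exact: measurable_itv.
apply/(integrable_mkcond _ mI).
by apply: continuous_compact_integrable; [exact: segment_compact|exact: continuous_subspaceT].
Qed.

Lemma norm_snd_le (q : R * R) : `|q.2| <= `|q|.
Proof. by rewrite prod_normE le_max lexx orbT. Qed.

Lemma continuous_slice phi u : continuous phi -> continuous (fun v => phi (u, v)).
Proof.
move=> cphi v; apply: (@continuous_comp _ _ _ (fun v => (u, v)) phi); last exact: cphi.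
have h : (fun _ : R => u) x @[x --> v] --> u by exact: cvg_cst.
exact: (cvg_pair h cvg_id).
Qed.

Lemma continuous_slice_l phi v : continuous phi -> continuous (fun u => phi (u, v)).
Proof.
move=> cphi u; apply: (@continuous_comp _ _ _ (fun u => (u, v)) phi); last exact: cphi.
have h : (fun _ : R => v) x @[x --> u] --> v by exact: cvg_cst.
exact: (cvg_pair cvg_id h).
Qed.

Lemma vanishes_slice phi L u : vanishes_beyond L phi -> vanishes_beyond L (fun v => phi (u, v)).
Proof. by move=> sphi v Lv; apply: sphi; exact: lt_le_trans Lv (norm_snd_le (u, v)). Qed.

Lemma plane_iterated phi L : continuous phi -> vanishes_beyond L phi ->
  \int[mu2]_q phi q = \int[mu]_u \int[mu]_v phi (u, v).
Proof.
move=> cphi sphi; have iphi := integrable_plane cphi sphi.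
rewrite [LHS]/Rintegral -(integral12_prod_meas1 iphi) [RHS]/Rintegral.
congr fine; apply: eq_integral => u _; rewrite /fubini_F /Rintegral fineK //.
apply: integrable_fin_num => //.
exact: integrable_line (continuous_slice cphi) (vanishes_slice u sphi).
Qed.

Lemma line_restrict f L : vanishes_beyond L f -> \int[mu]_x f x = \int[mu]_(x in `[- L, L]) f x.
Proof.
move=> sf; rewrite [RHS]Rintegral_mkcond; congr Rintegral.
apply/funext => x; rewrite /patch; case: ifPn => // /negP.
by rewrite inE /= in_itv /= -ler_norml => /negP; rewrite -ltNge => /sf.
Qed.

(** Dominated convergence, with a constant bound on the interval that supports all the
    inner integrands. *)
Lemma continuous_inner_integral phi L : continuous phi -> vanishes_beyond L phi ->
  continuous (fun u => \int[mu]_v phi (u, v)).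
Proof.
move=> cphi sphi u0.
have -> : (fun u => \int[mu]_v phi (u, v)) = fun u => \int[mu]_(v in `[- L, L]) phi (u, v).
  by apply/funext => u; exact: line_restrict (vanishes_slice u sphi).
have [C C0 HC] := bounded_of_support cphi sphi.
have mI : measurable (`[- L, L]%classic : set (measurableTypeR R)) by exact: measurable_itv.
have h := @continuity_under_integral R _ (measurableTypeR R) mu (fun u v => phi (u, v)) _ mI
  (u0 - 1) (u0 + 1) _ _ (fun=> C) _ _.
apply: h; last by rewrite inE /= in_itv /=; apply/andP; split; lra.
- move=> u _; apply: continuous_compact_integrable; first exact: segment_compact.
  exact/continuous_subspaceT/continuous_slice.
- by apply: aeW => v _ u _; exact: continuous_slice_l.
- apply: continuous_compact_integrable; first exact: segment_compact.
  by apply: continuous_subspaceT; exact: cst_continuous.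
- by move=> u _; apply: aeW => v _; exact: HC.
Qed.

Lemma integral_derive0 f L : (forall x, derivable f x 1) -> continuous (derive1 f) ->
  vanishes_beyond L f -> \int[mu]_x derive1 f x = 0.
Proof.
move=> df cf sf; pose K := `|L| + 1.
have K0 : 0 < K by rewrite /K ltr_pwDr.
have LK : L < K by rewrite (le_lt_trans (ler_norm L)) // ltrDl.
have sf' : vanishes_beyond K (derive1 f).
  move=> x Kx; rewrite derive1E.
  have -> : 'D_1 f x = 'D_1 (cst 0 : R -> R) x.
    apply: near_eq_derive.
    have : \forall z \near x, L < `|z|.
      by apply: (@cvgr_norm_gt _ _ _ _ _ id x cvg_id); exact: lt_trans Kx.
    by apply: filterS => z /sf.
  exact: derive_cst.
rewrite (line_restrict sf') /Rintegral (@continuous_FTC2 _ _ f).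
- have -> : f K = 0 by apply: sf; rewrite gtr0_norm.
  have -> : f (- K) = 0 by apply: sf; rewrite normrN gtr0_norm.
  by rewrite /= subr0.
- by move: K0; clear; lra.
- exact: continuous_subspaceT.
- have cf0 x : {for x, continuous f} by apply: differentiable_continuous; exact/derivable1_diffP.
  split => [x _| |]; [exact: df|apply: cvg_at_right_filter; exact: cf0|].
  by apply: cvg_at_left_filter; exact: cf0.
- by [].
Qed.

(** The inner integral over v vanishes for every u. *)
Lemma integral_pv0 phi L : (forall q, derivable (fun t => phi (q.1, t)) q.2 1) ->
  continuous (pv phi) -> vanishes_beyond L phi -> vanishes_beyond L (pv phi) ->
  \int[mu2]_q pv phi q = 0.
Proof.
move=> dphi cphi sphi sphi'; rewrite (plane_iterated cphi sphi').
rewrite (_ : (fun u => _) = cst 0); first by rewrite /Rintegral integral0.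
apply/funext => u /=; have -> : (fun v => pv phi (u, v)) = derive1 (fun v => phi (u, v)).
  by apply/funext => v; rewrite -pvE.
apply: (@integral_derive0 _ L).
- by move=> v; exact: (dphi (u, v)).
- have -> : derive1 (fun v => phi (u, v)) = fun v => pv phi (u, v).
    by apply/funext => v; rewrite -pvE.
  exact: continuous_slice.
- exact: vanishes_slice.
Qed.

Lemma same_sign (g : R -> R) a b : a <= b -> {within `[a, b], continuous g} ->
  (forall x, a <= x <= b -> g x != 0) ->
  (forall x, a <= x <= b -> 0 < g x) \/ (forall x, a <= x <= b -> g x < 0).
Proof.
move=> ab cg g0.
have key x y : a <= x <= b -> a <= y <= b -> x <= y -> 0 <= g x * g y.
  move=> /andP[ax xb] /andP[ay yb] xy; rewrite leNgt; apply/negP => neg.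
  have cg' : {within `[x, y], continuous g}.
    by apply: continuous_subspaceW cg; apply: subset_itv; rewrite bnd_simp.
  have [|c] := IVT (v := 0) xy cg'.
    case: (ltgtP (g x) 0) => gx; case: (ltgtP (g y) 0) => gy; rewrite ge_min le_max; first [nra|apply/andP; split; apply/orP; lra].
  rewrite in_itv /= => /andP[xc cy] gc.
  by have := g0 c; rewrite gc eqxx (le_trans ax xc) (le_trans cy yb) => /(_ isT).
have aab : a <= a <= b by rewrite lexx.
have := g0 a aab; rewrite neq_lt => /orP[ga|ga]; [right|left] => x xab;
  have /andP[ax xb] := xab; have := key a x aab xab ax; have := g0 x xab;
  rewrite neq_lt => /orP[]; nra.
Qed.

(** The absolute value of the derivative covers increasing and decreasing [beta] at once. *)
Lemma line_substitution (beta f : R -> R) a b : a < b ->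
  (forall x, a <= x <= b -> derivable beta x 1) ->
  (forall x, a <= x <= b -> {for x, continuous (derive1 beta)}) ->
  (forall x, a <= x <= b -> derive1 beta x != 0) ->
  continuous f ->
  (forall w, (forall x, a <= x <= b -> beta x != w) -> f w = 0) ->
  \int[mu]_x f x = \int[mu]_(x in `[a, b]) (f (beta x) * `|derive1 beta x|).
Proof.
move=> ab db cb' nb cf sf.
have cb x : a <= x <= b -> {for x, continuous beta}.
  by move=> xab; apply: differentiable_continuous; apply/derivable1_diffP; exact: db.
have cbw : {within `[a, b], continuous beta}.
  by apply: continuous_in_subspaceT => x; rewrite inE /= in_itv /=; exact: cb.
have cbw' : {within `[a, b], continuous (derive1 beta)}.
  by apply: continuous_in_subspaceT => x; rewrite inE /= in_itv /=; exact: cb'.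
have oc x : x \in `]a, b[ -> a <= x <= b.
  by rewrite in_itv /= => /andP[ax xb]; rewrite !ltW.
have aab : a <= a <= b by rewrite lexx ltW.
have bab : a <= b <= b by rewrite lexx ltW.
have restr (c d : R) : (forall x, a <= x <= b -> c <= beta x <= d) ->
    \int[mu]_x f x = \int[mu]_(x in `[c, d]) f x.
  move=> H; rewrite [RHS]Rintegral_mkcond; congr Rintegral.
  apply/funext => w; rewrite /patch; case: ifPn => // /negP.
  rewrite inE /= in_itv /= => wcd; apply: sf => x xab; apply/eqP => E.
  by apply: wcd; rewrite -E; exact: H.
have LR : derivable_oo_LRcontinuous beta a b.
  split; [by move=> x /oc; exact: db| |].
  - by apply: cvg_at_right_filter; exact: cb.
  - by apply: cvg_at_left_filter; exact: cb.
have ca : cvg (derive1 beta x @[x --> a^'+]).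
  by apply/cvg_ex; exists (derive1 beta a); apply: cvg_at_right_filter; exact: cb'.
have cvb : cvg (derive1 beta x @[x --> b^'-]).
  by apply/cvg_ex; exists (derive1 beta b); apply: cvg_at_left_filter; exact: cb'.
have ci : {in `]a, b[, continuous (derive1 beta)}.
  by move=> x /oc; exact: cb'.
have [pos|neg] := same_sign (ltW ab) cbw' nb.
- have inc : {in `[a, b] &, {homo beta : x y / x < y}}.
    by apply: gtr0_derive1_lt_cc; [move=> x /oc; exact: db|move=> x /oc; exact: pos|exact: cbw].
  have mono x y : a <= x -> x <= y -> y <= b -> beta x <= beta y.
    move=> ax xy yb; move: xy; rewrite le_eqVlt => /predU1P[-> //|xy].
    by apply/ltW/inc => //; rewrite in_itv /=; apply/andP; split => //; lra.
  rewrite (restr (beta a) (beta b)); last first.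
    by move=> x /andP[ax xb]; rewrite !mono.
  rewrite /Rintegral (integration_by_substitution_increasing (ltW ab) inc ci ca cvb LR); last exact: continuous_subspaceT.
  congr fine; apply: eq_integral => x; rewrite inE /= in_itv /= => /pos x0.
  by rewrite gtr0_norm.
- have dec : {in `[a, b] &, {homo beta : x y /~ x < y}}.
    by apply: ltr0_derive1_lt_cc; [move=> x /oc; exact: db|move=> x /oc; exact: neg|exact: cbw].
  have mono x y : a <= x -> x <= y -> y <= b -> beta y <= beta x.
    move=> ax xy yb; move: xy; rewrite le_eqVlt => /predU1P[-> //|xy].
    by apply/ltW/dec => //; rewrite in_itv /=; apply/andP; split => //; lra.
  rewrite (restr (beta b) (beta a)); last first.
    by move=> x /andP[ax xb]; rewrite !mono.
  rewrite /Rintegral (integration_by_substitution_decreasing (ltW ab) dec ci ca cvb LR); last exact: continuous_subspaceT.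
  congr fine; apply: eq_integral => x; rewrite inE /= in_itv /= => /neg x0.
  by rewrite ltr0_norm.
Qed.

(** Fubini's theorem reduces the map (u, v) |-> (alpha u, beta v) to dimension one. *)
Lemma rectangle_substitution (alpha beta : R -> R) a b c d phi phi' L L' :
  a < b -> c < d ->
  (forall x, a <= x <= b -> derivable alpha x 1) ->
  (forall x, a <= x <= b -> {for x, continuous (derive1 alpha)}) ->
  (forall x, a <= x <= b -> derive1 alpha x != 0) ->
  (forall x, c <= x <= d -> derivable beta x 1) ->
  (forall x, c <= x <= d -> {for x, continuous (derive1 beta)}) ->
  (forall x, c <= x <= d -> derive1 beta x != 0) ->
  continuous phi -> continuous phi' -> vanishes_beyond L phi -> vanishes_beyond L' phi' ->
  (forall u v, ~~ ((a <= u <= b) && (c <= v <= d)) -> phi (u, v) = 0) ->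
  (forall u v, (forall x y, a <= x <= b -> c <= y <= d -> (alpha x, beta y) != (u, v)) ->
     phi' (u, v) = 0) ->
  (forall u v, a <= u <= b -> c <= v <= d ->
     phi (u, v) = `|derive1 alpha u| * `|derive1 beta v| * phi' (alpha u, beta v)) ->
  \int[mu2]_q phi q = \int[mu2]_q phi' q.
Proof.
move=> ab cd da ca na db cb nb cphi cphi' sphi sphi' z z' E.
rewrite (plane_iterated cphi sphi) (plane_iterated cphi' sphi').
have cab : a <= a <= b by rewrite lexx ltW.
rewrite (line_substitution ab da ca na (continuous_inner_integral cphi' sphi')); last first.
  move=> w hw; rewrite (_ : (fun v => _) = cst 0); first by rewrite /Rintegral integral0.
  by apply/funext => v; apply: z' => x y xab _; apply: contra (hw x xab) => /eqP[-> _].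
rewrite [RHS]Rintegral_mkcond.
congr Rintegral; apply/funext => u; rewrite /patch; case: ifPn; last first.
  move/negP; rewrite inE /= in_itv /= => /negP uab.
  rewrite (_ : (fun v => phi (u, v)) = cst 0); first by rewrite /Rintegral integral0.
  by apply/funext => v; apply: z; rewrite (negbTE uab).
rewrite inE /= in_itv /= => uab.
rewrite (line_substitution cd db cb nb (continuous_slice (u := alpha u) cphi')); last first.
  by move=> w hw; apply: z' => x y _ ycd; apply: contra (hw y ycd) => /eqP[_ ->].
rewrite mulrC -RintegralZl //; last first.
  have -> : (fun v => phi' (alpha u, beta v) * `|derive1 beta v|) =
    (fun v => phi' (alpha u, beta v) * `|derive1 beta v|) by [].
  apply: continuous_compact_integrable; first exact: segment_compact.
  apply: continuous_in_subspaceT => v; rewrite inE /= in_itv /= => vcd.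
  apply: cvgM.
    apply: (@continuous_comp _ _ _ beta (fun w => phi' (alpha u, w))).
      by apply: differentiable_continuous; apply/derivable1_diffP; exact: db.
    exact: continuous_slice.
  apply: (@continuous_comp _ _ _ (derive1 beta) (fun w : R => `|w|)); first exact: cb.
  exact: norm_continuous.
rewrite [RHS]Rintegral_mkcond; congr Rintegral.
apply/funext => v; rewrite /patch; case: ifPn.
  by rewrite inE /= in_itv /= => vcd; rewrite E //; ring.
by move/negP; rewrite inE /= in_itv /= => /negP vcd; apply: z; rewrite (negbTE vcd) andbF.
Qed.

End PlaneIntegral.

(** ** Change of variables between null coordinates *)

(* Finite subcovers are stated for pointed spaces. *)
HB.instance Definition _ (R : realType) := Pointed.on (R * R)%type.

Section ChangeOfVariables.
Context {R : realType}.
Implicit Types (phi : R * R -> R) (O : set (R * R)).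

Local Notation mu2 := (@lebesgue_measure R \x @lebesgue_measure R)%E.

Lemma derive0_constant (f : R -> R) a b : a <= b ->
  (forall x, a <= x <= b -> derivable f x 1) ->
  (forall x, a <= x <= b -> derive1 f x = 0) -> f b = f a.
Proof.
move=> ab df f0.
have cf : {within `[a, b], continuous f}.
  by apply: derivable_within_continuous => x; rewrite in_itv /=; exact: df.
have [x|c cab E] := MVT_segment ab (df := derive1 f) _ cf.
  rewrite in_itv /= => /andP[/ltW ax /ltW xb]; rewrite derive1E; apply: DeriveDef => //.
  by apply: df; rewrite ax.
move: cab; rewrite in_itv /= => /f0 c0; move: E; rewrite c0 mul0r => /eqP.
by rewrite subr_eq0 => /eqP.
Qed.

Lemma square_inE (q q0 : R * R) e : (`|q0 - q| <= e) =
  ((q0.1 - e <= q.1 <= q0.1 + e) && (q0.2 - e <= q.2 <= q0.2 + e)).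
Proof.
by rewrite le_prod_norm; congr andb; rewrite -ler_distl distrC.
Qed.

Lemma square_hline (q0 q : R * R) e : `|q0 - q| <= e -> `|q0 - (q.1, q0.2)| <= e.
Proof.
rewrite !le_prod_norm => /andP[h _]; apply/andP; split; first exact: h.
by rewrite [X in `|X|](subrr q0.2) normr0; exact: le_trans h.
Qed.

Lemma square_vline (q0 q : R * R) e : `|q0 - q| <= e -> `|q0 - (q0.1, q.2)| <= e.
Proof.
rewrite !le_prod_norm => /andP[_ h]; apply/andP; split; last exact: h.
by rewrite [X in `|X|](subrr q0.1) normr0; exact: le_trans h.
Qed.

Lemma constant_along_u O (t : R * R -> R) q0 e : smooth_on O t ->
  (forall q, `|q0 - q| <= e -> O q) -> (forall q, O q -> pu t q = 0) ->
  forall u u' v, `|q0 - (u, v)| <= e -> `|q0 - (u', v)| <= e -> t (u, v) = t (u', v).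
Proof.
move=> st sub t0.
have key u u' v : u <= u' -> `|q0 - (u, v)| <= e -> `|q0 - (u', v)| <= e -> t (u', v) = t (u, v).
  move=> uu'; rewrite !square_inE /= => /andP[/andP[h1 h2] h3] /andP[/andP[h4 h5] _].
  have inO x : u <= x <= u' -> O (x, v).
    move=> /andP[ux xu']; apply: sub; rewrite square_inE /= h3 andbT.
    by rewrite (le_trans h1 ux) (le_trans xu' h5).
  apply: (@derive0_constant (fun x => t (x, v))) => // x /inO Ox.
    by apply/(derivable_slice1 t (x, v)); exact: (smooth_derivable (b := true) st Ox).
  by have := t0 _ Ox; rewrite -puE.
by move=> u u' v h h'; have [|/ltW] := leP u u' => uu'; [rewrite (key u u')|rewrite (key u' u)].
Qed.

Lemma constant_along_v O (t : R * R -> R) q0 e : smooth_on O t ->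
  (forall q, `|q0 - q| <= e -> O q) -> (forall q, O q -> pv t q = 0) ->
  forall u v v', `|q0 - (u, v)| <= e -> `|q0 - (u, v')| <= e -> t (u, v) = t (u, v').
Proof.
move=> st sub t0.
have key u v v' : v <= v' -> `|q0 - (u, v)| <= e -> `|q0 - (u, v')| <= e -> t (u, v') = t (u, v).
  move=> vv'; rewrite !square_inE /= => /andP[h3 /andP[h1 h2]] /andP[_ /andP[h4 h5]].
  have inO x : v <= x <= v' -> O (u, x).
    move=> /andP[ux xu']; apply: sub; rewrite square_inE /= h3 /=.
    by rewrite (le_trans h1 ux) (le_trans xu' h5).
  apply: (@derive0_constant (fun x => t (u, x))) => // x /inO Ox.
    by apply/(derivable_slice2 t (u, x)); exact: (smooth_derivable (b := false) st Ox).
  by have := t0 _ Ox; rewrite -pvE.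
by move=> u v v' h h'; have [|/ltW] := leP v v' => vv'; [rewrite (key u v v')|rewrite (key u v' v)].
Qed.

Lemma vanishes_beyond_compact (K : set (R * R)) phi : compact K ->
  (forall q, ~ K q -> phi q = 0) -> exists L, vanishes_beyond L phi.
Proof.
move=> /compact_bounded[L [_ HL]] z; exists (L + 1) => q Lq; apply: z => Kq.
have L1 : L < L + 1 by rewrite ltrDl.
by have /= := HL (L + 1) L1 q Kq; rewrite leNgt Lq.
Qed.

Lemma closed_square_compact (q0 : R * R) e : compact [set q | `|q0 - q| <= e].
Proof.
have -> : [set q | `|q0 - q| <= e] =
    `[q0.1 - e, q0.1 + e]%classic `*` `[q0.2 - e, q0.2 + e]%classic.
  by apply/seteqP; split => q /=; rewrite square_inE !in_itv /= => /andP.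
by apply: compact_setX; exact: segment_compact.
Qed.

Lemma open_square_sub (q0 : R * R) e O : 0 < e -> (forall q, `|q0 - q| <= 2 * e -> O q) ->
  forall q, `|q0 - q| <= e -> O q.
Proof. by move=> e0 H q h; apply: H; lra. Qed.

Section Square.
Variables (O : set (R * R)) (t1 t2 : R * R -> R) (q0 : R * R) (e : R).
Hypotheses (oO : open O) (s1 : smooth_on O t1) (s2 : smooth_on O t2) (e0 : 0 < e).
Hypothesis sub : forall q, `|q0 - q| <= 2 * e -> O q.
Hypotheses (t1v : forall q, O q -> pv t1 q = 0) (t2u : forall q, O q -> pu t2 q = 0).
Hypothesis J0 : forall q, O q -> 0 < pu t1 q * pv t2 q.

(** On a square [t1] depends on u only and [t2] on v only, because [pv t1] and [pu t2]
    vanish there.  The hypotheses hold on a square of twice the size, so that derivatives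
    at the boundary can be compared as well. *)
Lemma square_substitution phi phi' :
  continuous phi -> continuous phi' ->
  (forall q, e < `|q0 - q| -> phi q = 0) ->
  (forall w, (forall q, `|q0 - q| <= e -> (t1 q, t2 q) != w) -> phi' w = 0) ->
  (forall q, `|q0 - q| <= e -> phi q = pu t1 q * pv t2 q * phi' (t1 q, t2 q)) ->
  \int[mu2]_q phi q = \int[mu2]_q phi' q.
Proof.
move=> cphi cphi' z z' E.
have le2 (x : R) : x <= e -> x <= 2 * e by move=> /le_trans; apply; rewrite ler_peMl ?ler1n // ltW.
have sub' := open_square_sub e0 sub.
have E1 q : `|q0 - q| <= 2 * e -> t1 q = t1 (q.1, q0.2).
  move=> hq; rewrite {1}[q]surjective_pairing; apply: (constant_along_v s1 sub t1v).
    by rewrite -surjective_pairing.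
  exact: square_hline.
have E2 q : `|q0 - q| <= 2 * e -> t2 q = t2 (q0.1, q.2).
  move=> hq; rewrite {1}[q]surjective_pairing; apply: (constant_along_u s2 sub t2u).
    by rewrite -surjective_pairing.
  exact: square_vline.
have nbh q : `|q0 - q| <= e -> \forall x \near q, `|q0 - x| <= 2 * e.
  move=> hq; have : nbhs q (ball q e) by exact: nbhsx_ballx.
  apply: filterS => x; rewrite -ball_normE /= => hx.
  have -> : q0 - x = (q0 - q) + (q - x) by rewrite addrA subrK.
  by apply: le_trans (ler_normD _ _) _; lra.
have D1 q : `|q0 - q| <= e -> pu t1 q = pu t1 (q.1, q0.2).
  move=> hq; rewrite -!puE /du /=.
  have -> : derive1 (fun t => t1 (t, q.2)) q.1 = du (fun x => t1 (x.1, q0.2)) q.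
    have h : \near q, t1 q = t1 (q.1, q0.2) by apply: filterS (nbh q hq) => x; exact: E1.
    exact: (near_eq_pd true h).
  by [].
have D2 q : `|q0 - q| <= e -> pv t2 q = pv t2 (q0.1, q.2).
  move=> hq; rewrite -!pvE /dv /=.
  have -> : derive1 (fun t => t2 (q.1, t)) q.2 = dv (fun x => t2 (q0.1, x.2)) q.
    have h : \near q, t2 q = t2 (q0.1, q.2) by apply: filterS (nbh q hq) => x; exact: E2.
    exact: (near_eq_pd false h).
  by [].
have [L sphi] : exists L, vanishes_beyond L phi.
  have zq q : ~ [set q | `|q0 - q| <= e] q -> phi q = 0 by move=> /negP; rewrite -ltNge => /z.
  exact: (vanishes_beyond_compact (@closed_square_compact q0 e) zq).
have [L' sphi'] : exists L', vanishes_beyond L' phi'.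
  have cK : compact ((fun q => (t1 q, t2 q)) @` [set q | `|q0 - q| <= e]).
    apply: continuous_compact; last exact: closed_square_compact.
    apply: continuous_in_subspaceT => q; rewrite inE /= => /sub' Oq.
    exact: (cvg_pair (smooth_continuous s1 Oq) (smooth_continuous s2 Oq)).
  apply: (vanishes_beyond_compact cK _) => w Kw; apply: z' => q hq.
  by apply/eqP => E'; apply: Kw; exists q.
have line1 x : q0.1 - e <= x <= q0.1 + e -> O (x, q0.2).
  by move=> hx; apply: sub'; rewrite square_inE /= hx /=; apply/andP; split; lra.
have line2 x : q0.2 - e <= x <= q0.2 + e -> O (q0.1, x).
  by move=> hx; apply: sub'; rewrite square_inE /= hx andbT; apply/andP; split; lra.
have d1E : derive1 (fun x => t1 (x, q0.2)) = fun x => pu t1 (x, q0.2).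
  by apply/funext => x; rewrite -puE.
have d2E : derive1 (fun x => t2 (q0.1, x)) = fun x => pv t2 (q0.1, x).
  by apply/funext => x; rewrite -pvE.
apply: (@rectangle_substitution R (fun x => t1 (x, q0.2)) (fun x => t2 (q0.1, x))
  (q0.1 - e) (q0.1 + e) (q0.2 - e) (q0.2 + e) phi phi' L L') => //.
- by rewrite ltrBlDr -addrA ltrDl addr_gt0.
- by rewrite ltrBlDr -addrA ltrDl addr_gt0.
- by move=> x /line1 Ox; apply/(derivable_slice1 t1 (x, q0.2)); exact: (smooth_derivable (b := true) s1 Ox).
- move=> x /line1 Ox; rewrite d1E.
  have c : {for (x, q0.2), continuous (pu t1)} by exact: (smooth_continuous (smooth_pu s1) Ox).
  apply: (@continuous_comp _ _ _ (fun x => (x, q0.2)) (pu t1)); last exact: c.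
  have h : (fun _ : R => q0.2) z @[z --> x] --> q0.2 by exact: cvg_cst.
  exact: (cvg_pair cvg_id h).
- by move=> x /line1 /J0; rewrite d1E; apply: contraTneq => ->; rewrite mul0r ltxx.
- by move=> x /line2 Ox; apply/(derivable_slice2 t2 (q0.1, x)); exact: (smooth_derivable (b := false) s2 Ox).
- move=> x /line2 Ox; rewrite d2E.
  have c : {for (q0.1, x), continuous (pv t2)} by exact: (smooth_continuous (smooth_pv s2) Ox).
  apply: (@continuous_comp _ _ _ (fun x => (q0.1, x)) (pv t2)); last exact: c.
  have h : (fun _ : R => q0.1) z @[z --> x] --> q0.1 by exact: cvg_cst.
  exact: (cvg_pair h cvg_id).
- by move=> x /line2 /J0; rewrite d2E; apply: contraTneq => ->; rewrite mulr0 ltxx.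
- by move=> u v h; apply: z; rewrite ltNge square_inE.
- move=> u v h; apply: z' => q hq.
  have h2 := le2 _ hq.
  rewrite (E1 q h2) (E2 q h2); apply: h.
    by move: hq; rewrite square_inE => /andP[].
  by move: hq; rewrite square_inE => /andP[].
- move=> u v hu hv; have h : `|q0 - (u, v)| <= e by rewrite square_inE /= hu hv.
  have h2 := le2 _ h.
  rewrite (E _ h) d1E d2E -(D1 _ h) -(D2 _ h) -normrM (gtr0_norm (J0 (sub' _ h))).
  by rewrite {1}(E1 _ h2) {1}(E2 _ h2).
Qed.

End Square.

Lemma continuous_off_compact (K : set (R * R)) phi : compact K ->
  (forall q, ~ K q -> phi q = 0) -> (forall q, K q -> {for q, continuous phi}) ->
  continuous phi.
Proof.
move=> cK z cphi q; have [Kq|nKq] := pselect (K q); first exact: cphi.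
have oK : open (~` K).
  by apply: closed_openC; apply: compact_closed cK; exact: norm_hausdorff.
apply: (@near_cst_continuous _ _ 0).
by have : nbhs q (~` K) by [exact: open_nbhs_nbhs]; apply: filterS => x /z.
Qed.

Lemma plane_integral_sum (I : eqType) (s : seq I) (phi : I -> R * R -> R) :
  (forall i, i \in s -> continuous (phi i)) ->
  (forall i, i \in s -> exists L, vanishes_beyond L (phi i)) ->
  \int[mu2]_q (\sum_(i <- s) phi i q) = \sum_(i <- s) \int[mu2]_q phi i q.
Proof.
move=> cphi sphi.
have int i : i \in s -> mu2.-integrable setT (EFin \o phi i).
  by move=> si; have [L h] := sphi i si; exact: integrable_plane (cphi i si) h.
elim: s int {cphi sphi} => [|i s IH] int.
  rewrite big_nil (_ : (fun q => _) = cst 0); first by rewrite /Rintegral integral0.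
  by apply/funext => q; rewrite big_nil.
rewrite big_cons -IH; last by move=> j sj; apply: int; rewrite in_cons sj orbT.
rewrite -RintegralD //.
- by congr Rintegral; apply/funext => q; rewrite big_cons.
- by apply: int; rewrite mem_head.
- rewrite (_ : _ \o _ = fun q => (\sum_(j <- s) (phi j q)%:E)%E); last first.
    by apply/funext => q; rewrite /= sumEFin.
  have -> : (fun q => (\sum_(j <- s) (phi j q)%:E)%E) =
      (fun q => (\sum_(j <- s | j \in s) (phi j q)%:E)%E).
    by apply/funext => q; rewrite [LHS]big_seq.
  by apply: integrable_sum => // j sj; apply: int; rewrite in_cons sj orbT.
Qed.

(** Finitely many squares in the open set cover the support of the integrand.  Continuous
    bumps, divided by their sum, split the integrand into pieces to which
    [square_substitution] applies. *)
Lemma null_substitution O (t s : R * R -> R * R) (K : set (R * R)) phi phi' :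
  let t1 q := (t q).1 in let t2 q := (t q).2 in
  open O -> smooth_on O t1 -> smooth_on O t2 ->
  (forall q, O q -> pv t1 q = 0) -> (forall q, O q -> pu t2 q = 0) ->
  (forall q, O q -> 0 < pu t1 q * pv t2 q) ->
  (forall q, O q -> s (t q) = q) -> compact K ->
  (forall w, K w -> [/\ O (s w), t (s w) = w & {for w, continuous s}]) ->
  (forall w, K w -> {for w, continuous phi'}) -> (forall w, ~ K w -> phi' w = 0) ->
  (forall q, O q -> phi q = pu t1 q * pv t2 q * phi' (t q)) ->
  (forall q, ~ O q -> phi q = 0) ->
  \int[mu2]_q phi q = \int[mu2]_q phi' q.
Proof.
move=> t1 t2 oO s1 s2 t1v t2u J0 st cK Ks cphi' z' E z.
pose H := s @` K.
have cH : compact H.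
  apply: continuous_compact cK; apply: continuous_in_subspaceT => w.
  by rewrite inE => /Ks[].
have HO q : H q -> O q by case=> w /Ks[? _ _] <-.
have tH q : O q -> K (t q) -> H q by move=> Oq Kq; exists (t q) => //; exact: st.
have zH q : ~ H q -> phi q = 0.
  move=> nHq; have [Oq|/z //] := pselect (O q).
  by rewrite E // z' ?mulr0 // => /(tH _ Oq).
have ct q : O q -> {for q, continuous t}.
  move=> Oq; have -> : t = fun q => (t1 q, t2 q).
    by apply/funext => x; rewrite -surjective_pairing.
  exact: (cvg_pair (smooth_continuous s1 Oq) (smooth_continuous s2 Oq)).
have KtH q : H q -> K (t q) by case=> w Kw <-; have [_ -> _] := Ks w Kw.
have cphi : continuous phi.
  apply: (continuous_off_compact cH zH) => q Hq; have Oq := HO q Hq.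
  have nE : \near q, pu t1 q * pv t2 q * phi' (t q) = phi q.
    by have : nbhs q O by [exact: open_nbhs_nbhs]; apply: filterS => x /E ->.
  apply: (near_eq_continuous nE); apply: cvgM.
    apply: cvgM; first exact: smooth_continuous (smooth_pu s1) q Oq.
    exact: smooth_continuous (smooth_pv s2) q Oq.
  by apply: (@continuous_comp _ _ _ t phi'); [exact: ct|apply: cphi'; exact: KtH].
have cphi'T : continuous phi' by exact: continuous_off_compact cK z' cphi'.
have rad q : exists e, 0 < e /\ (H q -> forall x, `|q - x| <= 2 * e -> O x).
  have [Hq|nHq] := pselect (H q); last by exists 1; split.
  have : nbhs q O by apply: open_nbhs_nbhs; split => //; exact: HO.
  case/nbhs_ballP => d /= d0 dO; exists (d / 3); split; first by rewrite divr_gt0.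
  by move=> _ x hx; apply: dO; rewrite -ball_normE /=; apply: le_lt_trans hx _; lra.
have [e he] := choice rad.
have [D DH cov] : exists2 D : seq (R * R), (forall i, i \in D -> H i) &
    forall q, H q -> exists2 i, i \in D & `|i - q| < e i.
  have := cH; rewrite (@compact_cover (R * R)%type).
  move=> /(_ _ H (fun q => ball q (e q))) [|q Hq|D DH cov].
  - by move=> q _; have [e0 _] := he q; exact: ball_open.
  - by exists q => //; apply: ballxx; have [] := he q.
  exists (finmap.enum_fset D) => [i iD|q /cov[i iD]]; first by apply/set_mem; exact: DH.
  by rewrite -ball_normE /=; exists i.
pose psi i q := Num.max 0 (e i - `|i - q|).
pose sg q := \sum_(i <- D) psi i q.
have psi0 i q : 0 <= psi i q by rewrite le_max lexx.
have cpsi i : continuous (psi i).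
  move=> q; apply: (@continuous_max _ _ (fun=> 0) (fun q => e i - `|i - q|)).
    exact: cst_continuous.
  apply: cvgB; first exact: cvg_cst.
  by apply: cvg_norm; apply: cvgB; [exact: cvg_cst|exact: cvg_id].
have csg : continuous sg.
  rewrite /sg; elim: D {DH cov sg} => [|i D IH] q.
    by rewrite (_ : (fun q => _) = cst 0); [exact: cst_continuous|apply/funext => x; rewrite big_nil].
  rewrite (_ : (fun q => _) = fun q => psi i q + \sum_(j <- D) psi j q); last first.
    by apply/funext => x; rewrite big_cons.
  by apply: cvgD; [exact: cpsi|exact: IH].
have sg0 q : H q -> 0 < sg q.
  move=> /cov[i Di hi].
  rewrite /sg (big_rem i) //= ltr_wpDr ?sumr_ge0 // /psi.
  by rewrite lt_max subr_gt0 hi orbT.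
pose chi i q := phi q * (psi i q / sg q).
pose chi' i w := phi' w * (psi i (s w) / sg (s w)).
have sum1 q : H q -> \sum_(i <- D) psi i q / sg q = 1.
  by move=> /sg0 h; rewrite -mulr_suml divff // gt_eqF.
have zchi i q : ~ H q -> chi i q = 0 by rewrite /chi => /zH ->; rewrite mul0r.
have zchi' i w : ~ K w -> chi' i w = 0 by rewrite /chi' => /z' ->; rewrite mul0r.
have cchi i : continuous (chi i).
  apply: (continuous_off_compact cH (zchi i)) => q Hq; apply: cvgM; first exact: cphi.
  by apply: cvgM; [exact: cpsi|apply: cvgV; [rewrite gt_eqF // sg0|exact: csg]].
have cchi' i : continuous (chi' i).
  apply: (continuous_off_compact cK (zchi' i)) => w Kw; apply: cvgM; first exact: cphi'T.
  have [_ _ cs] := Ks w Kw.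
  apply: cvgM; first by apply: (@continuous_comp _ _ _ s (psi i)) => //; exact: cpsi.
  apply: cvgV; first by rewrite gt_eqF // sg0 //; exists w.
  by apply: (@continuous_comp _ _ _ s sg) => //; exact: csg.
have -> : \int[mu2]_q phi q = \int[mu2]_q (\sum_(i <- D) chi i q).
  congr Rintegral; apply/funext => q; rewrite /chi -mulr_sumr.
  by have [/sum1 ->|/zH ->] := pselect (H q); rewrite ?mulr1 ?mul0r.
have -> : \int[mu2]_q phi' q = \int[mu2]_q (\sum_(i <- D) chi' i q).
  congr Rintegral; apply/funext => w; rewrite /chi' -mulr_sumr.
  have [Kw|/z' ->] := pselect (K w); last by rewrite mul0r.
  by rewrite sum1 ?mulr1 //; exists w.
rewrite !plane_integral_sum //; first last.
- by move=> i _; exact: vanishes_beyond_compact cH (zchi i).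
- by move=> i _; exact: vanishes_beyond_compact cK (zchi' i).
rewrite big_seq [RHS]big_seq; apply: eq_bigr => i iD.
have Hi := DH i iD.
have [e0 sub] := he i; have {}sub := sub Hi.
apply: (@square_substitution O t1 t2 i (e i)) => //.
- move=> q hq; rewrite /chi /psi; suff -> : Num.max 0 (e i - `|i - q|) = 0 by rewrite mul0r mulr0.
  by apply/max_idPl; rewrite subr_le0 ltW.
- move=> w hw; have [Kw|] := pselect (K w); last exact: zchi'.
  have [Osw tsw _] := Ks w Kw; rewrite /chi' /psi.
  suff -> : Num.max 0 (e i - `|i - s w|) = 0 by rewrite mul0r mulr0.
  apply/max_idPl; rewrite subr_le0 leNgt; apply/negP => /ltW /hw.
  by rewrite /t1 /t2 -surjective_pairing tsw eqxx.
- move=> q hq; have Oq := open_square_sub e0 sub hq.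
  by rewrite /chi /chi' E // -surjective_pairing st // mulrA.
Qed.
End ChangeOfVariables.

(** * Stokes' theorem on a compact surface *)

Section ExtensionByZero.
Context {R : realType}.
Implicit Types (O K : set (R * R)) (f : R * R -> R).

Local Notation mu2 := (@lebesgue_measure R \x @lebesgue_measure R)%E.

Lemma patch_in O f q : O q -> (f \_ O) q = f q.
Proof. by move=> Oq; rewrite /patch mem_set. Qed.

Lemma patch_out O f q : ~ O q -> (f \_ O) q = 0.
Proof. by move=> Oq; rewrite /patch memNset. Qed.

Lemma patch_zero O K f q : (forall q, O q -> ~ K q -> f q = 0) -> ~ K q -> (f \_ O) q = 0.
Proof.
move=> z nK; have [Oq|/patch_out ->] := pselect (O q); last by [].
by rewrite patch_in //; exact: z.
Qed.

Lemma patch_near O f q : open O -> O q -> \near q, (f \_ O) q = f q.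
Proof. by move=> oO Oq; apply: (eq_nbhs_on oO Oq) => x; exact: patch_in. Qed.

Section Compact.
Variables (O K : set (R * R)) (f : R * R -> R).
Hypotheses (oO : open O) (cK : compact K) (KO : K `<=` O).
Hypothesis z : forall q, O q -> ~ K q -> f q = 0.

Lemma patch_continuous : (forall q, O q -> {for q, continuous f}) -> continuous (f \_ O).
Proof.
move=> cf; apply: (continuous_off_compact cK) => q Kq; first exact: (@patch_zero O K).
have Oq := KO Kq; have h : \near q, f q = (f \_ O) q.
  by apply: filterS (patch_near f oO Oq) => x ->.
exact: (near_eq_continuous h (cf q Oq)).
Qed.

Lemma patch_vanishes : exists L, vanishes_beyond L (f \_ O).
Proof. by apply: (vanishes_beyond_compact cK) => q; exact: (@patch_zero O K). Qed.

Lemma complement_nbhs q : ~ K q -> nbhs q (~` K).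
Proof.
move=> nK; apply: open_nbhs_nbhs; split => //; apply: closed_openC.
by apply: compact_closed cK; exact: norm_hausdorff.
Qed.

Lemma pv_patch q : pv (f \_ O) q = (pv f \_ O) q.
Proof.
have [Oq|nO] := pselect (O q).
  by rewrite (patch_in _ Oq) -!pvE; exact: (near_eq_pd false (patch_near f oO Oq)).
rewrite (patch_out _ nO).
have h : \near q, (f \_ O) q = (fun=> 0) q.
  have nK : ~ K q by move=> /KO.
  by apply: filterS (complement_nbhs nK) => x /=; exact: (@patch_zero O K).
rewrite -pvE; have -> : dv (f \_ O) q = dv (fun=> 0) q by exact: (near_eq_pd false h).
by rewrite pvE; exact: pv_cst.
Qed.

Lemma pv_zero q : O q -> ~ K q -> pv f q = 0.
Proof.
move=> Oq nK; have h : \near q, f q = (fun=> 0) q.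
  have nO : nbhs q O by exact: open_nbhs_nbhs.
  by apply: filterS2 nO (complement_nbhs nK) => x Ox /=; exact: z.
rewrite -pvE; have -> : dv f q = dv (fun=> 0) q by exact: (near_eq_pd false h).
by rewrite pvE; exact: pv_cst.
Qed.

Lemma patch_derivable : smooth_on O f ->
  forall q, derivable (fun t => (f \_ O) (q.1, t)) q.2 1.
Proof.
move=> sf q; apply/(derivable_slice2 (f \_ O) q).
have [Oq|nO] := pselect (O q).
  apply: near_eq_derivable; last exact: (smooth_derivable (b := false) sf Oq).
  by apply: filterS (patch_near f oO Oq) => x ->.
have nK : ~ K q by move=> /KO.
have h : \near q, (fun=> 0) q = (f \_ O) q.
  by apply: filterS (complement_nbhs nK) => x /= nKx; rewrite (@patch_zero O K).
by apply: near_eq_derivable h _; exact: derivable_cst.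
Qed.

End Compact.

Lemma integral_patch O f : \int[mu2]_(q in O) f q = \int[mu2]_q (f \_ O) q.
Proof. by rewrite Rintegral_mkcond. Qed.

(** The extension by zero is differentiable everywhere, so [integral_pv0] applies. *)
Lemma integral_pv_patch0 O K f : open O -> compact K -> K `<=` O -> smooth_on O f ->
  (forall q, O q -> ~ K q -> f q = 0) -> \int[mu2]_(q in O) pv f q = 0.
Proof.
move=> oO cK KO sf z; rewrite integral_patch.
have E : pv f \_ O = pv (f \_ O) by apply/funext => q; rewrite (pv_patch oO cK KO z).
have [L hL] := patch_vanishes cK z.
have [L' hL'] := patch_vanishes cK (pv_zero oO cK z).
rewrite (_ : (fun q => (pv f \_ O) q) = pv (f \_ O)); last by rewrite -E.
pose N := Num.max L L'.
apply: (@integral_pv0 _ _ N).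
- exact: (patch_derivable oO cK KO z sf).
- rewrite -E; apply: (patch_continuous oO cK KO (pv_zero oO cK z)).
  by move=> q Oq; exact: (smooth_continuous (smooth_pv sf) Oq).
- by move=> q hq; apply: hL; apply: le_lt_trans hq; rewrite le_max lexx.
- by move=> q hq; rewrite -E; apply: hL'; apply: le_lt_trans hq; rewrite le_max lexx orbT.
Qed.

Lemma integral_patch_sum (I : eqType) (s : seq I) O K (f : I -> R * R -> R) :
  open O -> compact K -> K `<=` O -> (forall i, smooth_on O (f i)) ->
  (forall i q, O q -> ~ K q -> f i q = 0) ->
  \int[mu2]_(q in O) (\sum_(i <- s) f i q) = \sum_(i <- s) \int[mu2]_(q in O) f i q.
Proof.
move=> oO cK KO sf z; rewrite integral_patch.
have -> : (fun q => \sum_(i <- s) f i q) \_ O = fun q => \sum_(i <- s) (f i \_ O) q.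
  apply/funext => q; have [Oq|nO] := pselect (O q).
    by rewrite patch_in //; apply: eq_bigr => i _; rewrite patch_in.
  by rewrite patch_out // big1 // => i _; rewrite patch_out.
rewrite plane_integral_sum.
- by apply: eq_bigr => i _; rewrite [RHS]integral_patch.
- by move=> i _; apply: (patch_continuous oO cK KO (z i)) => q Oq; exact: (smooth_continuous (sf i) Oq).
- by move=> i _; exact: (patch_vanishes cK (z i)).
Qed.

Lemma pv_sum (I : Type) (s : seq I) O (f : I -> R * R -> R) q : open O -> O q ->
  (forall i, smooth_on O (f i)) -> pv (fun q => \sum_(i <- s) f i q) q = \sum_(i <- s) pv (f i) q.
Proof.
move=> oO Oq sf; elim: s => [|i s IH].
  rewrite big_nil (_ : (fun q => _) = fun=> 0); first exact: pv_cst.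
  by apply/funext => x; rewrite big_nil.
rewrite big_cons -IH (_ : (fun q => _) = fun q => f i q + \sum_(j <- s) f j q); last first.
  by apply/funext => x; rewrite big_cons.
by rewrite (@pvD _ O) //; exact: smooth_sum.
Qed.

End ExtensionByZero.

Lemma smooth_fun_param_real (R : realType) (M : topologicalType) (S : oriented_surface R M)
    (f : M -> R) k : smooth_fun S setT f -> local_coords S k ->
  smooth_on (chart_img k) (fun q => f (chart_param k q)).
Proof.
move=> sf lk; have ck := lk.1.
have sF : smooth_fun S setT (fun p => const_mx (f p) : 'rV[R]_1).
  move=> a Sa; apply/smooth_rVP; first by apply: open_chart_image; [exact: atlas_chart Sa|rewrite setIT; have [] := atlas_chart Sa].
  move=> j; have := sf a Sa; apply: smooth_eq; first by apply: open_chart_image; [exact: atlas_chart Sa|rewrite setIT; have [] := atlas_chart Sa].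
  by move=> q _; rewrite mxE.
have [_ oI _ _ _] := ck.
have := smooth_coord oI 0 (smooth_fun_param sF lk).
by apply: (smooth_eq oI) => q _; rewrite mxE.
Qed.

(** The functions [p i] are the coordinate expressions of a 1-form p du, which is why [form]
    involves the derivative of [trans1] only. *)
Section Stokes.
Context {R : realType} {M : topologicalType} (S : oriented_surface R M).
Variables (d : nat) (k : 'I_d -> chart R M) (rho : 'I_d -> M -> R) (p : 'I_d -> R * R -> R).

Local Notation mu2 := (@lebesgue_measure R \x @lebesgue_measure R)%E.
Local Notation I i := (chart_img (k i)).
Local Notation r i j := (fun q => rho j (chart_param (k i) q)).

Hypothesis compactM : compact [set: M].
Hypothesis pk : forall i, positive_coords S (k i).
Hypothesis null : forall i j q, overlap (k i) (k j) q ->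
  pv (trans1 (k i) (k j)) q = 0 /\ pu (trans2 (k i) (k j)) q = 0.
Hypothesis prho : partition_of_unity S k rho.
Hypothesis sp : forall i, smooth_on (I i) (p i).
Hypothesis form : forall i j q, overlap (k i) (k j) q ->
  p i q = pu (trans1 (k i) (k j)) q * p j (transition (k i) (k j) q).

Definition supp i : set M := closure [set x | rho i x != 0].

Lemma supp_compact i : compact (supp i).
Proof. by apply: (subclosed_compact _ compactM) => //; exact: closed_closure. Qed.

Lemma off_supp i x : ~ supp i x -> rho i x = 0.
Proof.
by move=> nx; apply/eqP/negPn/negP => h; apply: nx; exact: subset_closure.
Qed.

Lemma supp_dom i : supp i `<=` chart_dom (k i).
Proof. by have [_ _ + _] := prho; exact. Qed.

Lemma coord_compact i (C : set M) : compact C -> C `<=` chart_dom (k i) ->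
  compact (chart_coord (k i) @` C).
Proof.
move=> cC sub; have [[_ _ _ cc _] _] := (pk i).1.
apply: continuous_compact cC; apply: continuous_in_subspaceT => x.
by rewrite inE => /sub; exact: cc.
Qed.

Lemma coord_sub i (C : set M) : C `<=` chart_dom (k i) -> chart_coord (k i) @` C `<=` I i.
Proof. by move=> sub _ [x /sub Cx <-]; exact: chart_imgP. Qed.

Lemma param_notin i (C : set M) q : I i q -> ~ (chart_coord (k i) @` C) q ->
  ~ C (chart_param (k i) q).
Proof.
move=> Iq nC Cq; apply: nC; exists (chart_param (k i) q) => //.
by case: (chart_param_dom (pk i).1.1 Iq).
Qed.

Lemma open_img i : open (I i).
Proof. by have [[]] := (pk i).1. Qed.

Lemma smooth_r i j : smooth_on (I i) (r i j).
Proof. by have [sr _ _ _] := prho; exact: smooth_fun_param_real (sr j) (pk i).1. Qed.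

Let K i := chart_coord (k i) @` supp i.

Lemma compact_K i : compact (K i).
Proof. by apply: coord_compact; [exact: supp_compact|exact: supp_dom]. Qed.

Lemma sub_K i : K i `<=` I i.
Proof. by apply: coord_sub; exact: supp_dom. Qed.

Lemma r_zero i j q : I i q -> ~ (chart_coord (k i) @` supp j) q -> r i j q = 0.
Proof. by move=> Iq h; apply: off_supp; exact: param_notin h. Qed.

Lemma r_pv_zero i j q : I i q -> ~ supp j (chart_param (k i) q) -> pv (r i j) q = 0.
Proof.
move=> Iq nj; have [[_ _ _ _ cp] _] := (pk i).1.
have oc : open (~` supp j) by apply: closed_openC; exact: closed_closure.
have h : \near q, r i j q = (fun=> 0) q.
  have n : nbhs (chart_param (k i) q) (~` supp j) by exact: open_nbhs_nbhs.
  have n' : nbhs q (chart_param (k i) @^-1` (~` supp j)) := cp q Iq _ n.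
  by apply: filterS n' => x /= hx; exact: off_supp.
rewrite -pvE; have -> : dv (r i j) q = dv (fun=> 0) q by exact: (near_eq_pd false h).
by rewrite pvE; exact: pv_cst.
Qed.

(* The coefficient of rho_j d(rho_l) /\ p du in the coordinates k i, up to sign. *)
Let w i j l q := r i j q * p i q * pv (r i l) q.

Lemma smooth_w i j l : smooth_on (I i) (w i j l).
Proof.
apply: smoothM; first exact: open_img.
  by apply: smoothM; [exact: open_img|exact: smooth_r|exact: sp].
by apply: smooth_pv; exact: smooth_r.
Qed.

Lemma w_zero i l q : I i q -> ~ K i q -> w i i l q = 0.
Proof. by move=> Iq nK; rewrite /w (r_zero Iq nK) !mul0r. Qed.

(** The form p du is multiplied by one diagonal entry of the Jacobian matrix and the
    v-derivative of [rho i] by the other, so the integrand transforms with the Jacobian. *)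
Lemma exchange i j :
  \int[mu2]_(q in I i) w i j i q = \int[mu2]_(q in I j) w j j i q.
Proof.
have ci := (pk i).1.1; have cj := (pk j).1.1.
have oOv := overlap_open ci cj.
have [st1 st2] := smooth_transition (pk i).1 (pk j).1.
rewrite [LHS]integral_patch [RHS]integral_patch.
pose C := supp i `&` supp j.
have cC : compact C.
  by apply: compact_closedI; [exact: supp_compact|exact: closed_closure].
have Cj : C `<=` chart_dom (k j) by move=> x [_ /supp_dom].
have KP x : (chart_coord (k j) @` C) x -> [/\ I j x, overlap (k j) (k i) x & C (chart_param (k j) x)].
  case=> y Cy <-; have dy := Cj y Cy; have [_ _ pK _ _] := cj.
  have dyi : chart_dom (k i) y by case: Cy => /supp_dom.
  split; [exact: chart_imgP| |by rewrite pK].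
  by apply/(overlapE _ _ cj); rewrite pK //; split => //; exact: chart_imgP.
apply: (@null_substitution R (overlap (k i) (k j)) (transition (k i) (k j))
  (transition (k j) (k i)) (chart_coord (k j) @` C)).
- exact: oOv.
- exact: st1.
- exact: st2.
- by move=> q /null[].
- by move=> q /null[].
- move=> q Oq; have := jacobian_gt0 (pk i) (pk j) Oq.
  by rewrite /Defs.jacobian !puE !pvE; have [-> _] := null Oq; rewrite mul0r subr0.
- by move=> q; exact: transitionK.
- exact: coord_compact.
- move=> x /KP[Ix Ox Cx]; split.
  + exact: transition_overlap.
  + exact: transitionK.
  + have [_ _ _ _ cpj] := cj; have [_ _ _ cci _] := ci.
    have -> : transition (k j) (k i) = chart_coord (k i) \o chart_param (k j).
      by apply/funext => y; exact: transitionE.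
    apply: continuous_comp; first exact: cpj.
    by apply: cci; move: Ox => /(overlapE _ _ cj)[].
- move=> x /KP[Ix _ _].
  have h : \near x, w j j i x = (w j j i \_ (I j)) x.
    by apply: filterS (patch_near (w j j i) (@open_img j) Ix) => z ->.
  exact: (near_eq_continuous h (smooth_continuous (@smooth_w j j i) Ix)).
- move=> x nK; have [Ix|nI] := pselect (I j x); last exact: patch_out.
  rewrite patch_in //; have nC := param_notin Ix nK; rewrite /w.
  have [si|nsi] := pselect (supp i (chart_param (k j) x)); last first.
    by rewrite (r_pv_zero Ix nsi) mulr0.
  by rewrite [rho j _]off_supp ?mul0r // => sj; exact: nC.
- have -> : (fun q => (transition (k i) (k j) q).1) = trans1 (k i) (k j) by [].
  have -> : (fun q => (transition (k i) (k j) q).2) = trans2 (k i) (k j) by [].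
  move=> q Oq; have [Iq dj] := (overlapE (k j) q ci).1 Oq.
  have Otq := transition_overlap ci cj Oq.
  have [Itq _] := (overlapE (k i) _ cj).1 Otq.
  rewrite !patch_in // /w (form Oq) -(param_transition ci cj Oq).
  have E : pv (r i i) q = pv (fun x => r j i (trans1 (k i) (k j) x, trans2 (k i) (k j) x)) q.
    apply: (eq_pv oOv _ Oq) => x Ox; congr (rho i _).
    by rewrite -[LHS](param_transition ci cj Ox).
  have inI x : overlap (k i) (k j) x -> I j (trans1 (k i) (k j) x, trans2 (k i) (k j) x).
    by move=> Ox; have [] := (overlapE (k i) _ cj).1 (transition_overlap ci cj Ox).
  rewrite E (@pv_comp _ _ (@open_img j) (overlap (k i) (k j)) (r j i) _ _ q inI
    (@smooth_r j i) st1 st2 Oq).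
  by have [-> _] := null Oq; rewrite /transition mulr0 add0r; ring.
- move=> q nO; have [Iq|nI] := pselect (I i q); last exact: patch_out.
  rewrite patch_in // /w [rho j _]off_supp ?mul0r // => /supp_dom dj.
  by apply: nO; apply/(overlapE _ _ ci).
Qed.

Lemma integration_by_parts i :
  \int[mu2]_(q in I i) (rho i (chart_param (k i) q) * pv (p i) q) =
  - \sum_(j < d) \int[mu2]_(q in I i) w i j i q.
Proof.
pose f (b : bool) := if b then fun q => r i i q * pv (p i) q
  else fun q => \sum_(j < d) w i j i q.
have zsum q : I i q -> ~ K i q -> \sum_(j < d) w i j i q = 0.
  move=> Iq nK; rewrite big1 // => j _; rewrite /w r_pv_zero ?mulr0 //.
  exact: param_notin Iq nK.
have E q : I i q -> \sum_(b <- [:: true; false]) f b q = pv (fun q => r i i q * p i q) q.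
  move=> Iq; rewrite !big_cons big_nil addr0 /f (pvM (@smooth_r i i) (sp i) Iq).
  rewrite addrC; congr (_ + _).
  rewrite /w -mulr_suml -mulr_suml; have [_ _ _ ->] := prho; rewrite mul1r; ring.
have sw : smooth_on (I i) (fun q => \sum_(j < d) w i j i q).
  by apply: smooth_sum; [exact: open_img|move=> j; exact: smooth_w].
have sf b : smooth_on (I i) (f b).
  case: b; rewrite /f //.
  by apply: smoothM; [exact: open_img|exact: smooth_r|apply: smooth_pv; exact: sp].
have zf b q : I i q -> ~ K i q -> f b q = 0.
  by move=> Iq nK; case: b; rewrite /f; [rewrite (r_zero Iq nK) mul0r|exact: zsum].
have := integral_patch_sum [:: true; false] (@open_img i) (@compact_K i) (@sub_K i) sf zf.
have -> : \int[mu2]_(q in I i) (\sum_(b <- [:: true; false]) f b q) = 0.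
  rewrite -[RHS](@integral_pv_patch0 R (I i) (K i) (fun q => r i i q * p i q)).
  - by apply: eq_Rintegral => q; rewrite inE; exact: E.
  - exact: open_img.
  - exact: compact_K.
  - exact: sub_K.
  - by apply: smoothM; [exact: open_img|exact: smooth_r|exact: sp].
  - by move=> q Iq nK; rewrite (r_zero Iq nK) mul0r.
rewrite !big_cons big_nil addr0 /f => /eqP; rewrite eq_sym addr_eq0 => /eqP ->.
congr (- _).
(* Each w i j i vanishes off K i, through its last factor. *)
apply: (integral_patch_sum _ (@open_img i) (@compact_K i) (@sub_K i)).
  by move=> j; exact: smooth_w.
move=> j q Iq nK; rewrite /w r_pv_zero ?mulr0 //; exact: param_notin Iq nK.
Qed.

(** Integration by parts moves the derivative to [rho i], and inserting the partition of
    unity a second time allows to integrate each term in the chart [k j] instead of [k i].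
    There the derivatives of the [rho i] add up to that of the constant 1. *)
Lemma stokes :
  \sum_(i < d) \int[mu2]_(q in I i) (rho i (chart_param (k i) q) * pv (p i) q) = 0.
Proof.
rewrite (eq_bigr _ (fun i _ => integration_by_parts i)) sumrN exchange_big /=.
rewrite big1 ?oppr0 // => j _.
rewrite (eq_bigr _ (fun i _ => exchange i j)).
rewrite -(integral_patch_sum _ (@open_img j) (@compact_K j) (@sub_K j)); last 2 first.
- by move=> i; exact: smooth_w.
- by move=> i q; exact: w_zero.
rewrite (_ : \int[mu2]_(q in I j) _ = \int[mu2]_(q in I j) 0).
  by rewrite /Rintegral integral0.
apply: eq_Rintegral => q; rewrite inE => Iq; rewrite /w -mulr_sumr.
rewrite -(pv_sum _ (@open_img j) Iq); last by move=> i; exact: smooth_r.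
have -> : (fun q => \sum_(i < d) r j i q) = fun=> 1.
  by apply/funext => x; have [_ _ _ ->] := prho.
by rewrite pv_cst mulr0.
Qed.

Lemma stokes_invariance (g g' : 'I_d -> R * R -> R) :
  (forall i, smooth_on (I i) (g i)) ->
  (forall i q, I i q -> g' i q = g i q + pv (p i) q) ->
  \sum_(i < d) \int[mu2]_(q in I i) (rho i (chart_param (k i) q) * g' i q) =
  \sum_(i < d) \int[mu2]_(q in I i) (rho i (chart_param (k i) q) * g i q).
Proof.
move=> sg E; rewrite -[RHS]addr0 -[X in _ = _ + X]stokes -big_split /=; apply: eq_bigr => i _.
pose f (b : bool) := if b then fun q => r i i q * g i q else fun q => r i i q * pv (p i) q.
have sf b : smooth_on (I i) (f b).
  case: b; apply: smoothM => //; try exact: open_img; try exact: smooth_r.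
  by apply: smooth_pv; exact: sp.
have zf b q : I i q -> ~ K i q -> f b q = 0.
  by move=> Iq nK; case: b; rewrite /f (r_zero Iq nK) mul0r.
have := integral_patch_sum [:: true; false] (@open_img i) (@compact_K i) (@sub_K i) sf zf.
rewrite !big_cons big_nil addr0 => <-; apply: eq_Rintegral => q; rewrite inE => Iq.
by rewrite !big_cons big_nil addr0 /f E // mulrDr.
Qed.

End Stokes.

(** * Invariance of the Willmore functional *)

Section LogarithmicDerivative.
Context {R : realType}.
Variable O : set (R * R).
Hypothesis oO : open O.
Implicit Types (f g : R * R -> R) (q : R * R).

Definition dlog f q := pu f q / f q.

Lemma smooth_dlog f : smooth_on O f -> (forall q, O q -> f q != 0) -> smooth_on O (dlog f).
Proof. by move=> sf f0; apply: (smooth_div oO f0 _ sf); exact: smooth_pu. Qed.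

Lemma dlogM f g q : smooth_on O f -> smooth_on O g -> O q -> f q != 0 -> g q != 0 ->
  dlog (fun q => f q * g q) q = dlog f q + dlog g q.
Proof.
move=> sf sg Oq f0 g0; rewrite /dlog (puM sf sg Oq); field.
by rewrite f0 g0.
Qed.

(** The mixed derivative of log |f|, without a logarithm and without a choice of sign. *)
Definition log_uv f q := pv (dlog f) q.

Lemma log_uvM f g q : smooth_on O f -> smooth_on O g ->
  (forall q, O q -> f q != 0) -> (forall q, O q -> g q != 0) -> O q ->
  log_uv (fun q => f q * g q) q = log_uv f q + log_uv g q.
Proof.
move=> sf sg f0 g0 Oq; rewrite /log_uv.
rewrite (eq_pv oO (G := fun q => dlog f q + dlog g q) _ Oq); last first.
  by move=> x Ox; exact: (dlogM sf sg Ox (f0 x Ox) (g0 x Ox)).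
by rewrite (pvD _ _ Oq) //; exact: smooth_dlog.
Qed.

Lemma log_uv_eq f g q : (forall q, O q -> f q = g q) -> O q -> log_uv f q = log_uv g q.
Proof.
move=> fg Oq; apply: (eq_pv oO _ Oq) => x Ox.
by rewrite /dlog (eq_pu oO fg Ox) fg.
Qed.

Lemma log_uv_v0 f q : smooth_on O f -> (forall q, O q -> f q != 0) ->
  (forall q, O q -> pv f q = 0) -> O q -> log_uv f q = 0.
Proof.
move=> sf f0 fv Oq; rewrite /log_uv /dlog (pv_div oO (smooth_pu sf) sf f0 Oq).
by rewrite (pvuC_real oO sf Oq) (eq_pu oO fv Oq) pu_cst (fv q Oq) mulr0 mul0r subr0 mul0r.
Qed.

Lemma log_uv_u0 f q : (forall q, O q -> pu f q = 0) -> O q -> log_uv f q = 0.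
Proof.
move=> fu Oq; rewrite /log_uv (eq_pv oO (G := fun=> 0) _ Oq) ?pv_cst //.
by move=> x Ox; rewrite /dlog fu // mul0r.
Qed.

Lemma log_uvE f q : smooth_on O f -> (forall q, O q -> f q != 0) -> O q ->
  log_uv f q = pv (pu f) q / f q - pu f q * pv f q / f q ^+ 2.
Proof.
move=> sf f0 Oq; rewrite /log_uv /dlog (pv_div oO (smooth_pu sf) sf f0 Oq); field.
exact: f0.
Qed.

End LogarithmicDerivative.

Section NullTransition.
Context {R : realType} {M : topologicalType} (S : oriented_surface R M).
Context {m : nat} (A : 'M[R]_m) (y : M -> 'M[R]_m) (c : R) (psi : M -> 'rV[R]_m).
Hypotheses (sA : A^T = A) (uA : A \in unitmx) (polar : polar_transform S A y c psi).
Variables (k l : chart R M) (Y Z : R * R -> 'rV[R]_m).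
Hypotheses (lk : local_coords S k) (ll : local_coords S l).
Hypotheses (nY : null_lift A y k Y) (nZ : null_lift A y l Z).

Local Notation X k := (fun q => psi (chart_param k q)).
Local Notation t1 := (trans1 k l).
Local Notation t2 := (trans2 k l).

(** Here [rho] is the quotient of the two lifts.  The first two equations say that null
    directions correspond, the third one that both lifts are normalised; the others follow
    from [pairing_first_order]. *)
Lemma pairing_transition q : overlap k l q -> exists rho : R,
  [/\ pu t1 q * pu t2 q = 0, pv t1 q * pv t2 q = 0,
      rho ^+ 4 * (pu t1 q * pv t2 q + pu t2 q * pv t1 q) ^+ 2 = 1,
      hopf_pairing1 A Y (X k) q =
        rho * (pu t1 q ^+ 2 * hopf_pairing1 A Z (X l) (transition k l q)
             + pu t2 q ^+ 2 * hopf_pairing2 A Z (X l) (transition k l q)) &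
      hopf_pairing2 A Y (X k) q =
        rho * (pv t1 q ^+ 2 * hopf_pairing1 A Z (X l) (transition k l q)
             + pv t2 q ^+ 2 * hopf_pairing2 A Z (X l) (transition k l q))].
Proof.
move=> Oq; have ck := lk.1; have cl := ll.1.
have oOv := overlap_open ck cl.
have [_ oIk _ _ _] := ck; have [_ oIl _ _ _] := cl.
have [st1 st2] := smooth_transition lk ll.
have inI x : overlap k l x -> chart_img l (t1 x, t2 x).
  by move=> Ox; have [] := (overlapE k _ cl).1 (transition_overlap ck cl Ox).
have [P [rho [oP Pq PO srho E]]] := lift_change lk ll nY.1 nZ.1 Oq.
have Itq := inI q Oq; have [Iq _] := (overlapE l q ck).1 Oq.
have sP1 := smooth_sub PO st1; have sP2 := smooth_sub PO st2.
have inP x : P x -> chart_img l (t1 x, t2 x) by move=> /PO /inI.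
have [sZ Z0 Zuu Zvv _] := conformal_liftE (null_lift_conformal nZ).
have sZt : smooth_on P (fun x => Z (t1 x, t2 x)) by exact: (smooth_comp oIl oP inP sZ sP1 sP2).
have EP x : P x -> Y x = rho x *: Z (t1 x, t2 x) by move=> /E[].
have yu : pu Y q = pu rho q *: Z (t1 q, t2 q) + rho q *: (pu t1 q *: pu Z (t1 q, t2 q) + pu t2 q *: pv Z (t1 q, t2 q)).
  by rewrite (eq_pu oP EP Pq) (puZ oP srho sZt Pq) (pu_compv oIl oP inP sZ sP1 sP2 Pq).
have yv : pv Y q = pv rho q *: Z (t1 q, t2 q) + rho q *: (pv t1 q *: pu Z (t1 q, t2 q) + pv t2 q *: pv Z (t1 q, t2 q)).
  by rewrite (eq_pv oP EP Pq) (pvZ oP srho sZt Pq) (pv_compv oIl oP inP sZ sP1 sP2 Pq).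
have sX := smooth_polar polar ll.
have EX x : overlap k l x -> X k x = X l (t1 x, t2 x).
  by move=> Ox; rewrite -[LHS]/(psi _) -(param_transition ck cl Ox).
have xu : pu (X k) q = pu t1 q *: pu (X l) (t1 q, t2 q) + pu t2 q *: pv (X l) (t1 q, t2 q).
  by rewrite (eq_pu oOv EX Oq) (pu_compv oIl oOv inI sX st1 st2 Oq).
have xv : pv (X k) q = pv t1 q *: pu (X l) (t1 q, t2 q) + pv t2 q *: pv (X l) (t1 q, t2 q).
  by rewrite (eq_pv oOv EX Oq) (pv_compv oIl oOv inI sX st1 st2 Oq).
have z00 := Z0 _ Itq; have zuu := Zuu _ Itq; have zvv := Zvv _ Itq.
have zu := self_dot_du sA oIl sZ Z0 Itq.
have zv := self_dot_dv sA oIl sZ Z0 Itq.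
have /null_liftP[_ /(_ _ Itq)[_ _ nzuv]] := nZ.
have /null_liftP[_ /(_ _ Iq)[yuu yvv nyuv]] := nY.
have [xuE xvE _ _ _] := polar_pointwise sA uA polar ll nZ Itq.
have [p1 p2] := pairing_first_order sA uA polar ll nZ Itq.
have [p1' p2'] := pairing_first_order sA uA polar lk nY Iq.
have xuz : ip A (pu (X l) (t1 q, t2 q)) (Z (t1 q, t2 q)) = 0.
  by rewrite xuE !ip_linE (ipC _ (Z _) sA) z00 zv; ring.
have xvz : ip A (pv (X l) (t1 q, t2 q)) (Z (t1 q, t2 q)) = 0.
  by rewrite xvE !ip_linE z00 (ipC _ (Z _) sA) zu; ring.
have xuzv : ip A (pu (X l) (t1 q, t2 q)) (pv Z (t1 q, t2 q)) = 0.
  by rewrite xuE !ip_linE zv zvv; ring.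
have xvzu : ip A (pv (X l) (t1 q, t2 q)) (pu Z (t1 q, t2 q)) = 0.
  by rewrite xvE !ip_linE zu zuu; ring.
have zuz : ip A (pu Z (t1 q, t2 q)) (Z (t1 q, t2 q)) = 0 by rewrite ipC.
have zvz : ip A (pv Z (t1 q, t2 q)) (Z (t1 q, t2 q)) = 0 by rewrite ipC.
have zvu : ip A (pv Z (t1 q, t2 q)) (pu Z (t1 q, t2 q)) = ip A (pu Z (t1 q, t2 q)) (pv Z (t1 q, t2 q)) by rewrite ipC.
have [rho0 _] := E q Pq.
have [s [s2 g _]] := sign_cases nzuv.
have [s' [s2' g' _]] := sign_cases nyuv.
have s0 : s != 0 by rewrite -sqrf_eq0 s2 oner_eq0.
exists (rho q); rewrite /transition.
move: yuu yvv g'; rewrite yu yv !ip_linE z00 zu zv zuz zvz zuu zvv zvu g => yuu yvv g'.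
split.
- apply: (mulfI (mulf_neq0 (mulf_neq0 rho0 rho0) s0)); rewrite mulr0 -[RHS]yuu; by field.
- apply: (mulfI (mulf_neq0 (mulf_neq0 rho0 rho0) s0)); rewrite mulr0 -[RHS]yvv; by field.
- have /(congr1 (fun x => 4 * x ^+ 2)) : s' / 2 = rho q ^+ 2 * (pu t1 q * pv t2 q + pu t2 q * pv t1 q) * (s / 2).
    by rewrite -g'; field.
  rewrite (_ : 4 * (s' / 2) ^+ 2 = s' ^+ 2); last by field.
  by rewrite s2' => e1; rewrite -[LHS]mulr1 -[U in _ * U]s2 [RHS]e1; field.
- rewrite p1' xu yu !ip_linE xuz xvz xuzv xvzu p1 p2; ring.
- rewrite p2' xv yv !ip_linE xuz xvz xuzv xvzu p1 p2; ring.
Qed.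

End NullTransition.

Lemma smooth_lift_metric (R : realType) m (O : set (R * R)) (A : 'M[R]_m) X : open O ->
  smooth_on O X -> (forall q, O q -> ip A (pu X q) (pv X q) != 0) ->
  smooth_on O (lift_metric A X).
Proof.
move=> oO sX b0.
have sb := smooth_ip oO A (smooth_pu sX) (smooth_pv sX).
apply: (smooth_div oO) => [q Oq| |].
- by rewrite mulf_neq0 ?pnatr_eq0 ?b0.
- apply: (smoothB oO); first exact: (smooth_ip oO A (smooth_pu (smooth_pu sX)) (smooth_pv (smooth_pv sX))).
  by apply: (smooth_div oO b0 _ sb); apply: (smoothM oO); [exact: smooth_pu|exact: smooth_pv].
- by apply: (smoothM oO) => //; exact: smooth_cst.
Qed.

Section WillmorePolar.
Context {R : realType} {M : topologicalType} (S : oriented_surface R M).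
Context {m : nat} (A : 'M[R]_m) (y : M -> 'M[R]_m) (c : R) (psi : M -> 'rV[R]_m) (e : bool).
Hypotheses (sA : A^T = A) (uA : A \in unitmx) (iso : isothermic S A y e).
Hypotheses (polar : polar_transform S A y c psi) (imm : immersed S c psi).
Implicit Types (k l : chart R M) (q : R * R).

Local Notation X k := (fun q => psi (chart_param k q)).
Local Notation eps := ((-1) ^+ e : R).

Section Lift.
Variables (k : chart R M) (Y : R * R -> 'rV[R]_m).
Hypotheses (lk : local_coords S k) (nY : null_lift A y k Y).
Local Notation f1 := (hopf_pairing1 A Y (X k)).
Local Notation f2 := (hopf_pairing2 A Y (X k)).

Let ck : is_chart k := lk.1.
Let oI : open (chart_img k). Proof. by have [] := ck. Qed.

Lemma adapted_near q : chart_img k q -> exists l F, [/\ adapted S A y e l F,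
  overlap k l q, local_coords S l & null_lift A y l (frame_lift F)].
Proof.
move=> kq; have [_ /(_ (chart_param k q))[l [F [adF lq]]]] := iso.
by exists l, F; split => //; [exact/overlapE|case: adF|case: adF => _ []].
Qed.

(** If one pairing vanishes then so do both, and the derivatives of [psi] are multiples of
    [Y], which contradicts the rank of an immersion. *)
Lemma immersed_pairing q : chart_img k q -> f1 q != 0 /\ f2 q != 0.
Proof.
move=> kq.
have both : f1 q = 0 -> f2 q = 0 -> False.
  move=> f10 f20; have [xu xv _ _ _] := polar_pointwise sA uA polar lk nY kq.
  have uY : (pu (X k) q <= Y q)%MS.
    by rewrite xu f10 mulr0 scale0r subr0; exact: scalemx_sub.
  have vY : (pv (X k) q <= Y q)%MS.
    by rewrite xv f20 mulr0 scale0r subr0; exact: scalemx_sub.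
  have := imm lk kq; cbv zeta; rewrite !puE !pvE; case: ifP => _ rk.
    have : (psi (chart_param k q) + pu (X k) q + pv (X k) q <= psi (chart_param k q) + Y q)%MS.
      by rewrite !addsmx_sub addsmxSl (submx_trans uY (addsmxSr _ _)) (submx_trans vY (addsmxSr _ _)).
    move/mxrankS; rewrite rk => /leq_trans/(_ (mxrank_adds_leqif _ _)).
    move/leq_trans/(_ (leq_add (rank_leq_row _) (rank_leq_row _))); by [].
  have : (pu (X k) q + pv (X k) q <= Y q)%MS by rewrite addsmx_sub uY vY.
  by move/mxrankS; rewrite rk => /leq_trans/(_ (rank_leq_row _)).
have [l [F [adF Oq ll nF]]] := adapted_near kq.
have [rho [uu vv det E1 E2]] := pairing_transition sA uA polar lk ll nY nF Oq.
have Itq : chart_img l (transition k l q).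
  by have [] := (overlapE k _ ll.1).1 (transition_overlap ck ll.1 Oq).
have e2 := pairing2E sA uA polar adF Itq.
set g := hopf_pairing1 A (frame_lift F) (X l) (transition k l q) in E1 E2 e2.
suff g0 : g != 0.
  have eps0 : eps != 0 by rewrite signr_eq0.
  have rho0 : rho != 0.
    by apply: contra_eqN det => /eqP ->; rewrite expr0n mul0r eq_sym oner_eq0.
  have J0 : pu (trans1 k l) q * pv (trans2 k l) q + pu (trans2 k l) q * pv (trans1 k l) q != 0.
    by apply: contra_eqN det => /eqP ->; rewrite expr0n mulr0 eq_sym oner_eq0.
  move: E1 E2 uu vv J0; rewrite e2.
  move: (pu (trans1 k l) q) (pv (trans1 k l) q) (pu (trans2 k l) q) (pv (trans2 k l) q) => a a' b b'.
  move=> -> -> /eqP; rewrite mulf_eq0 => /orP[]/eqP-> /eqP; rewrite mulf_eq0 => /orP[]/eqP->;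
    rewrite ?mul0r ?mulr0 ?add0r ?addr0 ?eqxx // mulf_eq0 negb_or => /andP[? ?];
    by rewrite !expr0n /= ?mul0r ?add0r ?addr0 !mulf_neq0 ?expf_neq0.
apply/eqP => g0; apply: both; first by rewrite E1 e2 g0 !mulr0 addr0 mulr0.
by rewrite E2 e2 g0 !mulr0 addr0 mulr0.
Qed.

Let f10 q : chart_img k q -> f1 q != 0. Proof. by move=> /immersed_pairing[]. Qed.
Let f20 q : chart_img k q -> f2 q != 0. Proof. by move=> /immersed_pairing[]. Qed.
Let sf := smooth_pairings polar lk nY.

(** Against an adapted chart the quotient f1/f2 is, up to sign, the square of a quotient of
    a function of u by a function of v. *)
Lemma isothermic_log_uv q : chart_img k q -> log_uv f1 q = log_uv f2 q.
Proof.
move=> kq; have [l [F [adF Oq ll nF]]] := adapted_near kq.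
have [sf1 sf2] := sf; have cl := ll.1.
have oOv := overlap_open ck cl.
have [st1 st2] := smooth_transition lk ll.
have key (s t : R * R -> R) : let a := pu s in let b := pv t in
    smooth_on (overlap k l) s -> smooth_on (overlap k l) t -> a q != 0 -> b q != 0 ->
    (forall x, overlap k l x -> a x != 0 -> b x != 0 -> pv s x = 0 /\ pu t x = 0) ->
    (forall x, overlap k l x -> a x != 0 -> b x != 0 ->
       (b x * b x) * f1 x = eps * (a x * a x) * f2 x) ->
    log_uv f1 q = log_uv f2 q.
  move=> a b ss st a0 b0 dst E; have sa := smooth_pu ss; have sb := smooth_pv st.
  pose P := [set x | overlap k l x /\ a x * b x != 0].
  have oP : open P by apply: open_nonvanishing => //; exact: smoothM.
  have Pq : P q by split => //; rewrite mulf_neq0.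
  have PO : P `<=` overlap k l by move=> x [].
  have PI : P `<=` chart_img k by move=> x /PO /(overlapE l x ck)[].
  have a0P x : P x -> a x != 0 by case=> _; rewrite mulf_eq0 negb_or => /andP[].
  have b0P x : P x -> b x != 0 by case=> _; rewrite mulf_eq0 negb_or => /andP[].
  have dst' x (Px : P x) := dst x (PO x Px) (a0P x Px) (b0P x Px).
  have av x : P x -> pv a x = 0.
    move=> Px; rewrite /a (pvuC_real oOv ss (PO x Px)).
    by rewrite (eq_pu oP (fun z Pz => (dst' z Pz).1) Px) pu_cst.
  have bu x : P x -> pu b x = 0.
    move=> Px; rewrite /b -(pvuC_real oOv st (PO x Px)).
    by rewrite (eq_pv oP (fun z Pz => (dst' z Pz).2) Px) pv_cst.
  have saP := smooth_sub PO sa; have sbP := smooth_sub PO sb.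
  have s1P := smooth_sub PI sf1; have s2P := smooth_sub PI sf2.
  have aa0 x : P x -> a x * a x != 0 by move=> Px; rewrite mulf_neq0 ?a0P.
  have bb0 x : P x -> b x * b x != 0 by move=> Px; rewrite mulf_neq0 ?b0P.
  have eaa0 x : P x -> eps * (a x * a x) != 0 by move=> Px; rewrite mulf_neq0 ?signr_eq0 ?aa0.
  have f1P x : P x -> f1 x != 0 by move=> /PI /f10.
  have f2P x : P x -> f2 x != 0 by move=> /PI /f20.
  have saa : smooth_on P (fun x => a x * a x) by exact: smoothM.
  have sbb : smooth_on P (fun x => b x * b x) by exact: smoothM.
  have seaa : smooth_on P (fun x => eps * (a x * a x)).
    by apply: smoothM => //; exact: smooth_cst.
  have := log_uv_eq oP (fun x Px => E x (PO x Px) (a0P x Px) (b0P x Px)) Pq.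
  rewrite (log_uvM oP sbb s1P bb0 f1P Pq) (log_uvM oP seaa s2P eaa0 f2P Pq).
  rewrite (log_uv_u0 oP _ Pq (f := fun x => b x * b x)); last first.
    by move=> x Px; rewrite (puM sbP sbP Px) bu // mul0r mulr0 addr0.
  rewrite add0r => ->.
  rewrite (log_uv_v0 oP seaa eaa0 _ Pq) ?add0r // => x Px.
  rewrite (pvM (smooth_cst P eps) saa Px) pv_cst mul0r add0r (pvM saP saP Px).
  by rewrite av // mul0r mulr0 addr0 mulr0.
have at_ x : overlap k l x -> exists rho g : R,
    [/\ pu (trans1 k l) x * pu (trans2 k l) x = 0, pv (trans1 k l) x * pv (trans2 k l) x = 0,
      pu (trans1 k l) x * pv (trans2 k l) x + pu (trans2 k l) x * pv (trans1 k l) x != 0,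
      f1 x = rho * g * (pu (trans1 k l) x ^+ 2 + eps * pu (trans2 k l) x ^+ 2) &
      f2 x = rho * g * (pv (trans1 k l) x ^+ 2 + eps * pv (trans2 k l) x ^+ 2)].
  move=> Ox; have [rho [uu vv det E1 E2]] := pairing_transition sA uA polar lk ll nY nF Ox.
  have Itx : chart_img l (transition k l x).
    by have [] := (overlapE k _ cl).1 (transition_overlap ck cl Ox).
  exists rho, (hopf_pairing1 A (frame_lift F) (X l) (transition k l x)); split => //.
  - by apply: contra_eqN det => /eqP ->; rewrite expr0n mulr0 eq_sym oner_eq0.
  - rewrite E1 (pairing2E sA uA polar adF Itx); ring.
  - rewrite E2 (pairing2E sA uA polar adF Itx); ring.
have ee : eps * eps = 1 by rewrite -expr2 sqrr_sign.
have cases x : overlap k l x ->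
    (pu (trans1 k l) x != 0 -> pv (trans2 k l) x != 0 -> 
       pv (trans1 k l) x = 0 /\ pu (trans2 k l) x = 0) /\
    (pu (trans2 k l) x != 0 -> pv (trans1 k l) x != 0 -> 
       pu (trans1 k l) x = 0 /\ pv (trans2 k l) x = 0).
  move=> /at_[rho [g [uu vv _ _ _]]]; move/eqP: uu; move/eqP: vv; rewrite !mulf_eq0.
  by split => a0 b0; move: uu vv; rewrite (negbTE a0) (negbTE b0) ?orbF /= => /eqP-> /eqP->.
have [rho0 [g0 [uu vv J0 _ _]]] := at_ q Oq.
have [/andP[h1 h2]|/andP[h1 h2]] : (pu (trans1 k l) q != 0) && (pv (trans2 k l) q != 0) \/
    (pu (trans2 k l) q != 0) && (pv (trans1 k l) q != 0).
  apply/orP; rewrite -!negb_or -!mulf_eq0 -negb_and; apply: contra J0 => /andP[/eqP-> /eqP->].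
  by rewrite addr0.
- apply: (key (trans1 k l) (trans2 k l)) => //.
  + by move=> x Ox a0 b0; have [+ _] := cases x Ox; exact.
  + move=> x Ox a0 b0; have [rho [g [_ _ _ -> ->]]] := at_ x Ox.
    have [/(_ a0 b0)[-> ->] _] := cases x Ox.
    by rewrite -!expr2 !expr0n /= !mulr0 addr0 add0r -[LHS]mul1r -[U in U * _]ee; ring.
- apply: (key (trans2 k l) (trans1 k l)) => //.
  + by move=> x Ox a0 b0; have [_ +] := cases x Ox; move=> /(_ a0 b0)[].
  + move=> x Ox a0 b0; have [rho [g [_ _ _ -> ->]]] := at_ x Ox.
    have [_ /(_ a0 b0)[-> ->]] := cases x Ox.
    by rewrite -!expr2 !expr0n /= !mulr0 addr0 add0r; ring.
Qed.

(** By [pairing_transition] a change of null coordinates that does not exchange u and v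
    multiplies f1 f2^3 by the fourth power of a function of v.  Its logarithmic derivative
    in u is therefore the coefficient of a global 1-form p du, see [potential_form]; the
    product f1 f2 itself would only give a form up to derivatives of the transition maps. *)
Definition potential q := 4^-1 * dlog (fun q => f1 q * (f2 q * (f2 q * f2 q))) q.

Let Q q := f1 q * (f2 q * (f2 q * f2 q)).

Let sQ : smooth_on (chart_img k) Q.
Proof. by have [sf1 sf2] := sf; apply: smoothM => //; apply: smoothM => //; exact: smoothM. Qed.

Let Q0 q : chart_img k q -> Q q != 0.
Proof. by move=> kq; rewrite !mulf_neq0 ?f10 ?f20. Qed.

Lemma smooth_potential : smooth_on (chart_img k) potential.
Proof. by apply: smoothM => //; [exact: smooth_cst|apply: smooth_dlog]. Qed.

(** log |f1 f2^3| and 2 log |f1 f2| have the same mixed derivative by [isothermic_log_uv]. *)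
Lemma pv_potential q : chart_img k q -> pv potential q = log_uv (fun q => f1 q * f2 q) q / 2.
Proof.
move=> kq; have [sf1 sf2] := sf.
have f22 x : chart_img k x -> f2 x * f2 x != 0 by move=> kx; rewrite mulf_neq0 ?f20.
have f23 x : chart_img k x -> f2 x * (f2 x * f2 x) != 0 by move=> kx; rewrite mulf_neq0 ?f20 ?f22.
have s22 : smooth_on (chart_img k) (fun x => f2 x * f2 x) by exact: smoothM.
have s23 : smooth_on (chart_img k) (fun x => f2 x * (f2 x * f2 x)) by exact: smoothM.
rewrite /potential (pvM (smooth_cst _ _) (smooth_dlog oI sQ Q0) kq) pv_cst mul0r add0r.
rewrite -/(log_uv Q q) (log_uvM oI sf1 s23 f10 f23 kq) (log_uvM oI sf2 s22 f20 f22 kq).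
rewrite (log_uvM oI sf2 sf2 f20 f20 kq) (log_uvM oI sf1 sf2 f10 f20 kq) (isothermic_log_uv kq); by field.
Qed.

Lemma polar_null_immersed : null_immersed_on A psi k.
Proof.
split; first exact: (smooth_polar polar lk).
move=> q kq; have [xuu xvv _] := polar_null sA uA polar lk nY kq; split => //.
have [_ _ -> _ _] := polar_pointwise sA uA polar lk nY kq.
have /null_liftP[_ /(_ q kq)[_ _ n]] := nY.
rewrite !mulf_neq0 ?f10 ?f20 ?pnatr_eq0 // sgr_eq0 -normr_eq0 n.
by rewrite invr_eq0 pnatr_eq0.
Qed.

Lemma null_lift_metric G q : conf_metric A y k G -> chart_img k q ->
  lift_metric A (X k) q = G q + pv potential q.
Proof.
move=> cG kq; have [sf1 sf2] := sf.
have h0 x : chart_img k x -> f1 x * f2 x != 0 by move=> kx; rewrite mulf_neq0 ?f10 ?f20.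
have [_ _ _ _ /(_ (h0 q kq)) ->] := polar_pointwise sA uA polar lk nY kq.
rewrite (pv_potential kq) (log_uvE oI (smoothM oI sf1 sf2) h0 kq).
congr (_ + _); rewrite (conf_metric_unique sA ck lk (null_lift_conformal nY) cG kq).
have [F [EF hF]] := hopf_schwarz_exists sA ck nY.
pose G' q := Num.sg (dot A (du Y q) (dv Y q)) * dot A (hopf1 F q) (hopf2 F q).
have cG' : conf_metric A y k G' by exists F; rewrite EF.
rewrite -(conf_metric_unique sA ck lk (null_lift_conformal nY) cG' kq) /G'.
have nF : null_lift A y k (frame_lift F) by rewrite EF.
by rewrite (hopf_dot sA ck nF hF kq) EF !puE !pvE ipE.
Qed.

End Lift.

Lemma potential_form k l Y Z q : local_coords S k -> local_coords S l ->
  null_lift A y k Y -> null_lift A y l Z ->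
  (forall q, overlap k l q -> pv (trans1 k l) q = 0 /\ pu (trans2 k l) q = 0) ->
  overlap k l q ->
  potential k Y q = pu (trans1 k l) q * potential l Z (transition k l q).
Proof.
move=> lk ll nY nZ null Oq; have ck := lk.1; have cl := ll.1.
have oOv := overlap_open ck cl; have [_ oIl _ _ _] := cl.
have [st1 st2] := smooth_transition lk ll.
have inI x : overlap k l x -> chart_img l (trans1 k l x, trans2 k l x).
  by move=> Ox; have [] := (overlapE k _ cl).1 (transition_overlap ck cl Ox).
pose Q1 q := hopf_pairing1 A Y (X k) q * (hopf_pairing2 A Y (X k) q *
  (hopf_pairing2 A Y (X k) q * hopf_pairing2 A Y (X k) q)).
pose Q2 q := hopf_pairing1 A Z (X l) q * (hopf_pairing2 A Z (X l) q *
  (hopf_pairing2 A Z (X l) q * hopf_pairing2 A Z (X l) q)).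
pose b q := pv (trans2 k l) q.
have sb : smooth_on (overlap k l) b by exact: smooth_pv.
have [sZ1 sZ2] := smooth_pairings polar ll nZ.
have sQ2 : smooth_on (chart_img l) Q2 by apply: smoothM => //; apply: smoothM => //; exact: smoothM.
have sQ2t : smooth_on (overlap k l) (fun x => Q2 (trans1 k l x, trans2 k l x)).
  exact: (smooth_comp_real oIl oOv inI sQ2 st1 st2).
have E x : overlap k l x -> Q1 x = b x * b x * (b x * b x) * Q2 (trans1 k l x, trans2 k l x).
  move=> Ox; have [rho [_ _]] := pairing_transition sA uA polar lk ll nY nZ Ox.
  have [-> ->] := null x Ox; rewrite mul0r addr0 => det E1 E2.
  rewrite /Q1 E1 E2 /Q2 -/(b x) -[RHS]mul1r -det -/(b x) /transition; ring.
have b0 : b q != 0.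
  have := jacobian_neq0 lk ll Oq; rewrite /Defs.jacobian !puE !pvE.
  have [-> _] := null q Oq; rewrite mul0r subr0 mulf_eq0 negb_or.
  by case/andP.
have bu x : overlap k l x -> pu b x = 0.
  move=> Ox; rewrite /b -(pvuC_real oOv st2 Ox).
  by rewrite (eq_pv oOv (fun z Oz => (null z Oz).2) Ox) pv_cst.
have sbb : smooth_on (overlap k l) (fun x => b x * b x) by exact: smoothM.
have sbbbb : smooth_on (overlap k l) (fun x => b x * b x * (b x * b x)) by exact: smoothM.
have Itq := inI q Oq.
have Q20 : Q2 (trans1 k l q, trans2 k l q) != 0.
  by have [h1 h2] := immersed_pairing ll nZ Itq; rewrite /Q2 !mulf_neq0.
rewrite /potential -/Q1 -/Q2 /dlog (eq_pu oOv E Oq) (E q Oq).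
rewrite (puM sbbbb sQ2t Oq) (puM sbb sbb Oq) (puM sb sb Oq) (bu q Oq).
rewrite (pu_comp oIl inI sQ2 st1 st2 Oq); have [_ ->] := null q Oq.
rewrite /transition; field.
by rewrite Q20 b0.
Qed.

(** By [null_lift_metric] the densities of [psi] and [y] differ by the exact form given by
    the potential, whose integral vanishes by Stokes' theorem, for any choice of charts and
    partition of unity. *)
Lemma willmore_polar N : compact [set: M] -> null_atlas S A y N ->
  conf_of A c psi (fun m' B z => null_atlas S B z N /\ willmore S B z N = willmore S A y N).
Proof.
move=> cM [Nk Ncov Nnull].
have [Yk HY] : exists Yk : chart R M -> R * R -> 'rV[R]_m, forall k, N k -> null_lift A y k (Yk k).
  have H k : exists Y : R * R -> 'rV[R]_m, N k -> null_lift A y k Y; last by have [f Hf] := choice H; exists f.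
  have [Nkk|nN] := pselect (N k); last by exists (fun=> 0).
  by have [_ [G [F [nF _ _]]]] := Nk k Nkk; exists (frame_lift F).
have [_ psi0 psic _] := polar.
apply: conf_of_imp (conf_of_lift sA psi0 psic) => m' B z [sB lift].
have locN k : N k -> local_coords S k by move=> /Nk[[]].
have conf k : N k -> conf_metric B z k (lift_metric A (X k)).
  move=> Nkk; have lk := locN k Nkk.
  have [X' [cX' E]] := lift k lk.1 (polar_null_immersed lk (HY k Nkk)).
  by apply: (conf_metric_exists sB lk.1 cX') => q kq; rewrite E.
have confU k G : N k -> conf_metric B z k G ->
    forall q, chart_img k q -> G q = lift_metric A (X k) q.
  move=> Nkk cG q kq; have lk := locN k Nkk.
  have [X' [cX' E]] := lift k lk.1 (polar_null_immersed lk (HY k Nkk)).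
  by rewrite (conf_metric_unique sB lk.1 lk cX' cG kq) E.
split; first by split => // k Nkk; have [pk _] := Nk k Nkk; split => //; exists (lift_metric A (X k)); exact: conf.
rewrite /willmore; suff -> : is_willmore S B z N = is_willmore S A y N by [].
have int d (k : 'I_d -> chart R M) (rho : 'I_d -> M -> R) (G G' : 'I_d -> R * R -> R) :
    (forall i, N (k i)) -> partition_of_unity S k rho ->
    (forall i, conf_metric A y (k i) (G i)) -> (forall i, conf_metric B z (k i) (G' i)) ->
    \sum_(i < d) \int[(@lebesgue_measure R \x @lebesgue_measure R)%E]_(q in chart_img (k i))
      (rho i (chart_param (k i) q) * G' i q) =
    \sum_(i < d) \int[(@lebesgue_measure R \x @lebesgue_measure R)%E]_(q in chart_img (k i))
      (rho i (chart_param (k i) q) * G i q).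
  move=> kN prho cG cG'.
  have pk i : positive_coords S (k i) by have [] := Nk _ (kN i).
  have nl i : null_lift A y (k i) (Yk (k i)) by exact: HY.
  have null i j q : overlap (k i) (k j) q ->
      pv (trans1 (k i) (k j)) q = 0 /\ pu (trans2 (k i) (k j)) q = 0.
    by rewrite -pvE -puE; exact: (Nnull _ _ (kN i) (kN j)).
  apply: (stokes_invariance cM pk null prho (p := fun i => potential (k i) (Yk (k i)))).
  - by move=> i; exact: (smooth_potential (pk i).1 (nl i)).
  - by move=> i j q; exact: (potential_form (pk i).1 (pk j).1 (nl i) (nl j) (null i j)).
  - move=> i; have lk := (pk i).1; have [_ oI _ _ _] := lk.1.
    have [sY _ _ _ b0] := conformal_liftE (null_lift_conformal (nl i)).
    have := smooth_lift_metric oI sY b0.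
    by apply: (smooth_eq oI) => q kq; rewrite (conf_metric_unique sA lk.1 lk (null_lift_conformal (nl i)) (cG i) kq).
  - move=> i q kq; rewrite (confU _ _ (kN i) (cG' i) q kq).
    exact: (null_lift_metric (pk i).1 (nl i) (cG i) kq).
apply/funext => w; apply/propext; split => -[d [k [rho [G [kN prho cG ->]]]]].
- have [G' HG'] : exists G' : 'I_d -> R * R -> R, forall i, conf_metric A y (k i) (G' i).
    have H i : exists G, conf_metric A y (k i) G by have [_] := Nk _ (kN i).
    by have [f Hf] := choice H; exists f.
  by exists d, k, rho, G'; split => //; rewrite (int d k rho G' G).
- exists d, k, rho, (fun i => lift_metric A (X (k i))); split => //.
    by move=> i; exact: conf.
  by rewrite -(int d k rho G _ kN prho cG (fun i => conf _ (kN i))).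
Qed.

End WillmorePolar.

Theorem theorem3p4 (R : realType) (n r : nat) (hr : (1 <= r)%N)
    (hnr : (r + 2 <= n)%N) (M : topologicalType) (S : oriented_surface R M)
    (e : bool) (y : M -> 'M[R]_n.+2)
    (hy : isothermic S (pseudo_gram R n.+2 r.+1) y e) :
  let A := pseudo_gram R n.+2 r.+1 in
  (forall (c : R) (psi : M -> 'rV[R]_n.+2) (M0 : set M),
      c != 0 -> polar_transform S A y c psi ->
      open M0 -> dense M0 ->
      (forall k F, adapted S A y e k F -> forall q, chart_img (chart_restr k M0) q ->
         dot A (psi (chart_param k q)) (hopf1 F q) != 0) ->
      pc_isothermic S A c e M0 psi /\
      forall k F, adapted S A y e k F ->
        let k0 := chart_restr k M0 in
        let X := fun q => psi (chart_param k q) in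
        [/\ pc_adapted S A e k0 psi,
            generalized_H_surface A X (chart_img k0) &
            exists Ypsi : R * R -> 'rV[R]_n.+2,
              [/\ is_lift A y k0 Ypsi,
                  forall q, chart_img k0 q ->
                    (du Ypsi q :=: dv X q)%MS /\ (dv Ypsi q :=: du X q)%MS,
                  minimal_section A X (chart_img k0) Ypsi &
                  parallel_section A X (chart_img k0) Ypsi]])
  /\
  (forall (c : R) (psi : M -> 'rV[R]_n.+2),
      polar_transform S A y c psi ->
      (forall k F, adapted S A y e k F ->
         let X := fun q => psi (chart_param k q) in
         let k0 := chart_restr k [set p | dot A (psi p) (hopf1 F (chart_coord k p)) != 0] in
         conf_of A c psi (fun m' B z =>
           conf_metric B z k0 (fun q =>
             dot A (hopf1 F q) (hopf2 F q)
             + dv (fun q' => dot A (X q') (Du A (frame_lift F) (hopf1 F) q')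
                             / dot A (X q') (hopf1 F q')) q)))
      /\
      (compact [set: M] -> immersed S c psi ->
         forall N : set (chart R M), null_atlas S A y N ->
           conf_of A c psi (fun m' B z =>
             null_atlas S B z N /\ willmore S B z N = willmore S A y N))).
Proof.
move=> A; have sA : A^T = A by exact: pseudo_gram_sym.
have uA : A \in unitmx by exact: pseudo_gram_unit.
split=> [c psi M0 c0 polar oM0 _ nz|c psi polar].
  split; first exact: (polar_isothermic sA uA hy polar c0 oM0 nz).
  by move=> k F adF; exact: (polar_generalized_H_surface sA uA polar c0 oM0 adF (nz k F adF)).
split; first by move=> k F adF; exact: (polar_conf_metric sA uA polar adF).
by move=> cM imm N nN; exact: (willmore_polar sA uA hy polar imm cM nN).
Qed.
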